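(* Let $S$ be an inverse semigroup with actions on a totally disconnected locally compact Hausdorff space $X$ and a locally finite weak semilattice $L$, and let $U \colon L \to \mathcal O_c(X)$ be an $S$-equivariant generating representation of $L$ on $X$. Suppose that $\mathscr R$ is a thorough $S$-invariant system of concrete finite covers in $L$. Set $(L_0,\mathscr R_0) = (L,\mathscr R)$ and consider the recursively constructed sequence $(L_k,\mathscr R_k)_{k \geq 0}$, where $(L_{k+1},\mathscr R_{k+1})$ is the locally finite weak semilattice of relative complements, with its system of finite covers, associated to $(L_k,\mathscr R_k)$. Then the sequence $(G_i := S \ltimes \widehat{L_i})_{i \geq 0}$ of groupoids is an independent resolution \[\cdots \to G_i \to \cdots \to G_0 \to G \to \emptyset \] of $G := S \ltimes X$. Moreover, if $N := \sup_{l \in L} \# \{F \in \mathscr R(l) \mid F \text{ non-trivial}\}$ is finite, then $G_i = \emptyset$ for $i \geq N+1$. If $L$ is a semilattice, then so is $L_k$ for $k \geq 0$.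
   Context: **Weak semilattices.** A weak semilattice is a poset $L$ with least element $0$ such that for all $k,l\in L$ there is a finite set $A$ of common lower bounds of $k,l$ such that each common lower bound is $\le$ some element of $A$; $k\downarrow l$ is the finite set of maximal common lower bounds. It is locally finite if each finite subset lies in a finite subset closed under $\downarrow$. $L^\times=L\setminus\{0\}$. $k\perp l$ means that $0$ is the only common lower bound. $\widehat L$ is the space (pointwise convergence) of nonzero maps $\chi\colon L\to\{0,1\}$ with $\chi(0)=0$ such that $\chi(k)=\chi(l)=1$ iff $\chi(m)=1$ for some $m\in k\downarrow l$. **Actions.** Inverse semigroups have a $0$. Actions on spaces $X$ are by partial homeomorphisms $s\colon\mathrm{dom}_X(s)\to\mathrm{ran}_X(s)$ between open sets, compatible with products, $\mathrm{dom}_X(0)=\emptyset$, domains covering $X$. $S\ltimes X=\{(s,x):x\in\mathrm{dom}_X(s)\}/\!\sim$ with $(s,x)\sim(t,y)$ iff $x=y$ and there is $u\le s,t$ with $x\in\mathrm{dom}_X(u)$; $[s,x]$ has source $x$, range $s.x$. An action of $S$ on $L$ is by order isomorphisms between down-sets, restricting to an action on the discrete space $L^\times$. It induces an action on $\widehat L$: $\mathrm{dom}_{\widehat L}(s)=\{\chi:\chi(l)=1\text{ for some }l\in\mathrm{dom}_L(s)\}$, $(s.\chi)(l)=1$ iff there is $k\in\mathrm{ran}_L(s)$, $k\le l$, $\chi(s^{-1}.k)=1$. **Representations.** $\mathcal O_c(X)$ is the set of compact open subsets. A representation of $L$ on $X$ is an order-preserving map $U\colon L\to\mathcal O_c(X)$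 with $U(0)=\emptyset$, $U(k)\cap U(l)=\bigcup_{m\in k\downarrow l}U(m)$. It is generating if $\{U(l)\}$ generates $\mathcal O_c(X)$ under finite unions and relative complements $V\setminus W$, $W\subseteq V$. It is $S$-equivariant if $\mathrm{dom}_X(s)=\bigcup_{l\in\mathrm{dom}_L(s)}U(l)$ and $s.(U(l))=U(s.l)$ for all $s \in S$, $l\in\mathrm{dom}_L(s)$. **Covers.** A finite cover of $l\in L$ is a finite set $F\subseteq L$ of elements $\le l$ such that $k\perp f$ for all $f\in F$ implies $k\perp l$. It is trivial if $l\in F$; concrete if $U(l)=\bigcup_{f\in F}U(f)$. For $k\le l$, $k\downarrow F$ is the set of maximal elements of $\bigcup_{f\in F}(k\downarrow f)$; for a set $\mathcal F$ of finite covers, $k\downarrow\mathcal F=\{k\downarrow F:F\in\mathcal F\}$. A system of finite covers in $L$ is a family $\mathscr R=(\mathscr R(l))_{l\in L}$, $\mathscr R(l)$ a set of finite covers of $l$, such that $\{l\}\in\mathscr R(l)$ and $k\downarrow F\in\mathscr R(k)$ whenever $F\in\mathscr R(l)$, $k\le l$. It is $S$-invariant if $s.F\in\mathscr R(s.l)$ whenever $l\in\mathrm{dom}_L(s)$, $F\in\mathscr R(l)$. A system of concrete finite covers is thorough if whenever $U(l)\subseteq\bigcup_{i=1}^nU(l_i)$ there are a positive integer $N$ and covers $F(l)\in\mathscr R(l)$, $F(l,f_1)\in\mathscr R(f_1)$ for all $f_1\in F(l)$, ..., $F(l,f_1,\dots,f_{N-1})\in\mathscr R(f_{N-1})$ for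 all $f_1\in F(l),\dots,f_{N-1}\in F(l,f_1,\dots,f_{N-2})$, such that for every chain $f_1\in F(l)$, $f_2\in F(l,f_1)$, ..., $f_N\in F(l,f_1,\dots,f_{N-1})$ there is $i$ with $f_N\le l_i$. **The recursion.** $\mathbb ZL$ is the free abelian group on $L^\times$ (with $0\in L$ identified with $0$), with the commutative ring structure for which $l\mapsto1_{\{k\in L^\times:k\le l\}}$ induces an injective ring homomorphism to functions $L^\times\to\mathbb Z$; so elements of $L$ are idempotents and $k\cdot l=\bigvee_{m\in k\downarrow l}m$, where $\bigvee_{p\in F}p=\sum_{\emptyset\ne F'\subseteq F}(-1)^{\#F'-1}\prod_{p\in F'}p$ for finite sets of idempotents. For a finite set $\mathcal F$ of finite covers of $l$, $(l\mid\mathcal F)=l-\bigvee_{f\in F\in\mathcal F}f\in\mathbb ZL$. Given $(L_0,\mathscr R_0)$, put $L_1=\{(l\mid\mathcal F):l\in L_0,\ \emptyset\ne\mathcal F\subseteq\mathscr R_0(l)\text{ finite}\}\cup\{0\}\subseteq\mathbb ZL_0$, ordered as idempotents ($p\le q$ iff $pq=p$). For $(l\mid\mathcal F)\in L_1$ and $F'\in\mathscr R_0(l)$, $R(l\mid\mathcal F\mid F')$ is the set of maximal elements of $\{(l\mid\mathcal F\cup\{F'\})\}\cup\{(f\mid f\downarrow\mathcal F):f\in F'\}$, and $\mathscr R_1(l\mid\mathcal F)=\{R(l\mid\mathcal F\mid F'):F'\in\mathscr R_0(l)\}$ (and $\mathscr R_1(0)=\{\{0\}\}$). If $S$ acts on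 $L_0$ with $\mathscr R_0$ $S$-invariant, $S$ acts on $L_1$ by $s.(l\mid\mathcal F)=(s.l\mid s.\mathcal F)$ for $l\in\mathrm{dom}_{L_0}(s)$, and $\mathscr R_1$ is $S$-invariant. This is iterated. **Independent resolutions.** An independent resolution of an ample groupoid $G$ is a sequence of ample groupoids $G_i$, $i\ge-1$, with $G_{-1}=G$; decompositions $G_i^0=C_i\amalg O_i$ with $C_i$ closed and $G_i$-invariant, where $O_{-1}=G^0$; groupoid isomorphisms $G_i|_{O_i}\cong G_{i+1}|_{C_{i+1}}$ for all $i\ge-1$; and for each $i\ge0$ an action $S_i\curvearrowright L_i$ of an inverse semigroup on a locally finite weak semilattice and an isomorphism $G_i\cong S_i\ltimes\widehat{L_i}$. *)

(* Defs.v *)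
From HB Require Import structures.
From mathcomp Require Import all_boot all_order all_algebra finmap.
From mathcomp Require Import generic_quotient freeg.
From mathcomp Require Import all_classical topology measurable_structure.

Set Implicit Arguments.
Unset Strict Implicit.
Unset Printing Implicit Defensive.

Import Order.TTheory GRing.Theory.

Local Open Scope classical_set_scope.

HB.mixin Record Semigroup_isInverse S of Semigroup S := {
  sinv : S -> S;
  szero : S;
  mulKs : forall s : S, (s * sinv s * s)%g = s;
  mulsK : forall s : S, (sinv s * s * sinv s)%g = sinv s;
  sinv_uniq : forall s t : S,
    (s * t * s)%g = s -> (t * s * t)%g = t -> t = sinv s;
  mul0s : forall s : S, (szero * s)%g = szero;
  muls0 : forall s : S, (s * szero)%g = szero
}.

#[short(type="invSemigroupType")]
HB.structure Definition InvSemigroup := {S of Semigroup_isInverse S & Semigroup S}.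

Section InvSemigroupTheory.
Context {S : invSemigroupType}.
Implicit Types s t e f : S.
Local Open Scope group_scope.

Definition sidem e : Prop := e * e = e.

Definition sle s t : Prop := exists2 e, sidem e & s = t * e.

Lemma sinv_idem e : sidem e -> sinv e = e.
Proof. by move=> ee; apply/esym/sinv_uniq; rewrite ee. Qed.

Lemma sinvK s : sinv (sinv s) = s.
Proof. by apply/esym/sinv_uniq; rewrite (mulKs, mulsK). Qed.

Lemma sidemM e f : sidem e -> sidem f -> sidem (e * f).
Proof.
move=> ee ff; set x := sinv (e * f).
have fxe : f * x * e = x.
  apply: sinv_uniq.
  - have -> : e * f * (f * x * e) * (e * f) = e * (f * f) * x * ((e * e) * f).
      by rewrite !mulgA.
    by rewrite ee ff mulKs.
  - have -> : f * x * e * (e * f) * (f * x * e)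
              = f * (x * ((e * e) * (f * f)) * x) * e by rewrite !mulgA.
    by rewrite ee ff mulsK.
have xx : sidem x.
  rewrite /sidem -{1}fxe -[X in _ * X]fxe !mulgA.
  have -> : f * x * e * f * x * e = f * (x * (e * f) * x) * e by rewrite !mulgA.
  by rewrite mulsK.
by have := sinv_idem xx; rewrite /x sinvK => ->.
Qed.

Lemma sidemC e f : sidem e -> sidem f -> e * f = f * e.
Proof.
move=> ee ff; have ef := sidemM ee ff; have fe := sidemM ff ee.
rewrite -[LHS](sinv_idem ef); apply/esym/sinv_uniq.
  have -> : e * f * (f * e) * (e * f) = e * (f * f) * (e * e) * f by rewrite !mulgA.
  by rewrite ee ff -[RHS]ef !mulgA.
have -> : f * e * (e * f) * (f * e) = f * (e * e) * (f * f) * e by rewrite !mulgA.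
by rewrite ee ff -[RHS]fe !mulgA.
Qed.

Lemma sidem_sinvM s : sidem (sinv s * s).
Proof. by rewrite /sidem mulgA mulsK. Qed.

Lemma sidem_Msinv s : sidem (s * sinv s).
Proof. by rewrite /sidem mulgA mulKs. Qed.

Lemma sle_refl s : sle s s.
Proof. by exists (sinv s * s); [exact: sidem_sinvM | rewrite mulgA mulKs]. Qed.

Lemma sinvM s t : sinv (s * t) = sinv t * sinv s.
Proof.
have C := sidemC (sidem_sinvM s) (sidem_Msinv t).
apply/esym/sinv_uniq.
  have -> : s * t * (sinv t * sinv s) * (s * t)
            = s * ((t * sinv t) * (sinv s * s)) * t by rewrite !mulgA.
  by rewrite -C !mulgA mulKs -!mulgA [t * _]mulgA mulKs.
have -> : sinv t * sinv s * (s * t) * (sinv t * sinv s)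
          = sinv t * ((sinv s * s) * (t * sinv t)) * sinv s by rewrite !mulgA.
by rewrite C !mulgA mulsK -!mulgA [sinv s * _]mulgA mulsK.
Qed.

Lemma sidem_mull e s : sidem e ->
  let f := sinv s * e * s in sidem f /\ e * s = s * f.
Proof.
move=> ee f; have C := sidemC ee (sidem_Msinv s).
have es : e * s = s * f.
  by rewrite /f !mulgA -C -mulgA mulKs.
split=> //; rewrite /sidem {1}/f -mulgA -es.
by rewrite mulgA -(mulgA _ e e) ee.
Qed.

Lemma sle_sinv s t : sle s t -> sle (sinv s) (sinv t).
Proof.
move=> [e ee ->]; rewrite sinvM (sinv_idem ee).
by have [ff eq] := sidem_mull (sinv t) ee; exists (sinv (sinv t) * e * sinv t).
Qed.

Lemma sleM s s' t t' : sle s s' -> sle t t' -> sle (s * t) (s' * t').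
Proof.
move=> [e ee ->] [f ff ->]; have [gg eq] := sidem_mull t' ee.
exists (sinv t' * e * t' * f); first exact: sidemM.
by rewrite mulgA -(mulgA s') eq !mulgA.
Qed.

End InvSemigroupTheory.

Section PartialMaps.
Context {X : Type}.

Definition pdom (f : X -> option X) : set X := [set x | f x].
Definition pran (f : X -> option X) : set X := [set y | exists x, f x = Some y].
Definition pimage (f : X -> option X) (A : set X) : set X :=
  [set y | exists2 x, A x & f x = Some y].
Definition ppreimage (f : X -> option X) (A : set X) : set X :=
  [set x | exists2 y, A y & f x = Some y].

End PartialMaps.

Record paction (S : invSemigroupType) (X : Type) := PAction {
  act :> S -> X -> option X;
  act_inj : forall s x y z, act s x = Some z -> act s y = Some z -> x = y;
  actM : forall s t x, act (s * t)%g x = obind (act s) (act t x);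
  act0 : forall x, act szero x = None;
  act_cover : forall x, exists s, act s x
}.

(** A partial injection is a homeomorphism between open sets iff its domain and
    range are open and it pulls back and pushes forward open sets to open sets. *)
Definition topological_action (S : invSemigroupType) (X : topologicalType)
    (a : paction S X) : Prop :=
  forall s, [/\ open (pdom (a s)), open (pran (a s)),
    forall V, open V -> open (ppreimage (a s) V) &
    forall V, open V -> open (pimage (a s) V)].

Section PActionTheory.
Context {S : invSemigroupType} {X : Type} (a : paction S X).

Lemma act_idem e x y : sidem e -> a e x = Some y -> y = x.
Proof.
move=> ee exy; apply: (@act_inj _ _ a e _ _ y) => //.
by have := actM a e e x; rewrite ee exy /= => ->.
Qed.

Lemma act_sle s t x y : sle s t -> a s x = Some y -> a t x = Some y.
Proof.
move=> [e ee ->]; rewrite actM; case E: (a e x) => [z|//] /=.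
by rewrite (act_idem ee E).
Qed.

Lemma act_sinv s x y : a s x = Some y -> a (sinv s) y = Some x.
Proof.
move=> sxy; have := sxy; rewrite -{1}(mulKs s) -mulgA actM => sxy'.
move: sxy'; case E: (a (sinv s * s)%g x) => [z|//] /= _.
have zx := act_idem (sidem_sinvM s) E.
by move: E; rewrite zx actM sxy.
Qed.

Lemma act_id_exists x : exists2 e, sidem e & a e x = Some x.
Proof.
have [s] := act_cover a x; case E: (a s x) => [y|//] _.
exists (sinv s * s)%g; first exact: sidem_sinvM.
by rewrite actM E /=; exact: act_sinv.
Qed.

Lemma sle_dom_dir s t u v w x : sle u s -> sle u t -> sle v t -> sle v w ->
  a u x -> a v x -> exists z, [/\ sle z s, sle z w & a z x].
Proof.
move=> [e ee ues] [e' ee' uet] [f ff vft] [f' ff' vfw] ux vx.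
exists (u * (e' * f))%g; split.
- exists (e * (e' * f))%g; last by rewrite ues !mulgA.
  by apply: sidemM => //; exact: sidemM.
- exists (f' * e')%g; first exact: sidemM.
  rewrite uet mulgA -(mulgA t e' e') ee'.
  by rewrite -mulgA (sidemC ee' ff) !mulgA -vft vfw.
- have ef z : sidem z -> a z x -> a z x = Some x.
    by move=> zz; case E: (a z x) => [y|//] _; rewrite (act_idem zz E).
  have e'x : a e' x = Some x.
    by apply: ef => //; move: ux; rewrite uet actM; case: (a e' x).
  have fx : a f x = Some x.
    by apply: ef => //; move: vx; rewrite vft actM; case: (a f x).
  by rewrite !actM fx /= e'x.
Qed.

End PActionTheory.

(** [mul g h] is only meaningful when [src g = rng h]. *)
Record is_groupoid (X A : Type) (src rng : A -> X) (unit : X -> A) (inv : A -> A)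
    (mul : A -> A -> A) : Prop := IsGroupoid {
  gpd_src_unit : forall x, src (unit x) = x;
  gpd_rng_unit : forall x, rng (unit x) = x;
  gpd_src_inv : forall g, src (inv g) = rng g;
  gpd_rng_inv : forall g, rng (inv g) = src g;
  gpd_src_mul : forall g h, src g = rng h -> src (mul g h) = src h;
  gpd_rng_mul : forall g h, src g = rng h -> rng (mul g h) = rng g;
  gpd_mul_unitl : forall g, mul (unit (rng g)) g = g;
  gpd_mul_unitr : forall g, mul g (unit (src g)) = g;
  gpd_mul_inv : forall g, mul g (inv g) = unit (rng g);
  gpd_inv_mul : forall g, mul (inv g) g = unit (src g);
  gpd_mul_assoc : forall g h k, src g = rng h -> src h = rng k ->
    mul g (mul h k) = mul (mul g h) k
}.

Record groupoid := Groupoid {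
  obj : topologicalType;
  arr : topologicalType;
  src : arr -> obj;
  rng : arr -> obj;
  gunit : obj -> arr;
  ginv : arr -> arr;
  gmul : arr -> arr -> arr;
  groupoidP : is_groupoid src rng gunit ginv gmul
}.

Section GroupoidTheory.
Context (G : groupoid).
Definition src_unit := gpd_src_unit (groupoidP G).
Definition rng_unit := gpd_rng_unit (groupoidP G).
Definition src_inv := gpd_src_inv (groupoidP G).
Definition rng_inv := gpd_rng_inv (groupoidP G).
Definition src_mul := gpd_src_mul (groupoidP G).
Definition rng_mul := gpd_rng_mul (groupoidP G).
Definition mul_unitl := gpd_mul_unitl (groupoidP G).
Definition mul_unitr := gpd_mul_unitr (groupoidP G).
Definition mul_inv := gpd_mul_inv (groupoidP G).
Definition inv_mul := gpd_inv_mul (groupoidP G).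
Definition mul_assoc := gpd_mul_assoc (groupoidP G).
End GroupoidTheory.

Definition local_homeo (X Y : topologicalType) (f : X -> Y) : Prop :=
  continuous f /\
  forall x, exists V, [/\ open V, V x, {in V &, injective f} &
    forall W, open W -> W `<=` V -> open (f @` W)].

Definition topological_groupoid (G : groupoid) : Prop :=
  [/\ continuous (@src G), continuous (@rng G), continuous (@gunit G),
      continuous (@ginv G) &
      {within [set gh : arr G * arr G | src gh.1 = rng gh.2],
        continuous (fun gh => gmul gh.1 gh.2)}].

Definition lch_totally_disconnected (X : topologicalType) : Prop :=
  [/\ hausdorff_space X, locally_compact [set: X] & totally_disconnected [set: X]].

Definition ample (G : groupoid) : Prop :=
  [/\ topological_groupoid G, local_homeo (@src G) &
      lch_totally_disconnected (obj G)].

Definition invariant_set (G : groupoid) (A : set (obj G)) : Prop :=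
  forall g : arr G, A (src g) <-> A (rng g).

Definition groupoid_empty (G : groupoid) : Prop := [set: arr G] = set0.

Definition groupoid_isomorphic (G H : groupoid) : Prop :=
  exists (f0 : obj G -> obj H) (f : arr G -> arr H)
         (h0 : obj H -> obj G) (h : arr H -> arr G),
  [/\ cancel f0 h0 /\ cancel h0 f0, cancel f h /\ cancel h f,
      continuous f0 /\ continuous h0, continuous f /\ continuous h &
      [/\ forall g, src (f g) = f0 (src g),
          forall g, rng (f g) = f0 (rng g) &
          forall g g', src g = rng g' -> f (gmul g g') = gmul (f g) (f g')]].

Section Restriction.
Context (G : groupoid) (A : set (obj G)).

Definition restr_arr : Type := set_type [set g : arr G | A (src g) /\ A (rng g)].
HB.instance Definition _ := Topological.on restr_arr.

Lemma restr_arrP (g : restr_arr) : A (src (val g)) /\ A (rng (val g)).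
Proof. by case: g => /= g /set_mem. Qed.

Definition restr_Arr (g : arr G) (gA : A (src g) /\ A (rng g)) : restr_arr :=
  exist _ g (mem_set gA).

Definition restr_src (g : restr_arr) : A :=
  exist _ (src (val g)) (mem_set (restr_arrP g).1).
Definition restr_rng (g : restr_arr) : A :=
  exist _ (rng (val g)) (mem_set (restr_arrP g).2).

Lemma restr_unit_subproof (x : A) :
  A (src (gunit (val x))) /\ A (rng (gunit (val x))).
Proof. by rewrite src_unit rng_unit; split; exact: set_valP. Qed.
Definition restr_unit (x : A) : restr_arr := restr_Arr (restr_unit_subproof x).

Lemma restr_inv_subproof (g : restr_arr) :
  A (src (ginv (val g))) /\ A (rng (ginv (val g))).
Proof. by rewrite src_inv rng_inv; have [] := restr_arrP g. Qed.
Definition restr_inv (g : restr_arr) : restr_arr :=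
  restr_Arr (restr_inv_subproof g).

Lemma restr_mul_subproof (g h : restr_arr) : src (val g) = rng (val h) ->
  A (src (gmul (val g) (val h))) /\ A (rng (gmul (val g) (val h))).
Proof.
by move=> gh; rewrite src_mul// rng_mul//; have [] := restr_arrP g;
  have [] := restr_arrP h.
Qed.
Definition restr_mul (g h : restr_arr) : restr_arr :=
  if pselect (src (val g) = rng (val h)) is left gh
  then restr_Arr (restr_mul_subproof gh) else g.

Lemma restr_mulE (g h : restr_arr) : src (val g) = rng (val h) ->
  val (restr_mul g h) = gmul (val g) (val h).
Proof. by rewrite /restr_mul; case: pselect. Qed.

Lemma restr_is_groupoid :
  is_groupoid restr_src restr_rng restr_unit restr_inv restr_mul.
Proof.
split.
- by move=> x; apply: val_inj => /=; rewrite src_unit.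
- by move=> x; apply: val_inj => /=; rewrite rng_unit.
- by move=> g; apply: val_inj => /=; rewrite src_inv.
- by move=> g; apply: val_inj => /=; rewrite rng_inv.
- move=> g h /(congr1 val)/= gh; apply: val_inj => /=.
  by rewrite restr_mulE// src_mul.
- move=> g h /(congr1 val)/= gh; apply: val_inj => /=.
  by rewrite restr_mulE// rng_mul.
- by move=> g; apply: val_inj; rewrite restr_mulE /= ?src_unit// mul_unitl.
- by move=> g; apply: val_inj; rewrite restr_mulE /= ?rng_unit// mul_unitr.
- by move=> g; apply: val_inj; rewrite restr_mulE /= ?rng_inv// mul_inv.
- by move=> g; apply: val_inj; rewrite restr_mulE /= ?src_inv// inv_mul.
- move=> g h k /(congr1 val)/= gh /(congr1 val)/= hk; apply: val_inj.
  by rewrite !restr_mulE ?rng_mul ?src_mul// mul_assoc.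
Qed.

Definition restriction : groupoid := Groupoid restr_is_groupoid.

End Restriction.

Section Germs.
Context {S : invSemigroupType} {X : choiceType} (a : paction S X).

Definition pregerm := {sx : S * X | isSome (a sx.1 sx.2)}.
HB.instance Definition _ := Choice.on pregerm.

Definition germ_rel (p q : pregerm) : bool :=
  `[< (val p).2 = (val q).2 /\
      exists u, [/\ sle u (val p).1, sle u (val q).1 & a u (val p).2] >].

Lemma germ_rel_refl : reflexive germ_rel.
Proof.
by move=> [[s x] /= sx]; apply/asboolP; split=> //; exists s; split=> //;
  exact: sle_refl.
Qed.

Lemma germ_rel_sym : symmetric germ_rel.
Proof.
suff H p q : germ_rel p q -> germ_rel q p by move=> p q; apply/idP/idP; exact: H.
move=> /asboolP[pq [u [up uq ux]]]; apply/asboolP; split => //.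
by exists u; rewrite -pq.
Qed.

Lemma germ_rel_trans : transitive germ_rel.
Proof.
move=> q p r /asboolP[pq [u [up uq ux]]] /asboolP[qr [v [vq vr vx]]].
apply/asboolP; rewrite pq; split=> //; rewrite -pq in vx.
by rewrite -pq; exact: (sle_dom_dir up uq vq vr ux vx).
Qed.

Definition germ_equiv : equiv_rel pregerm :=
  EquivRel germ_rel germ_rel_refl germ_rel_sym germ_rel_trans.

Definition germ : Type := {eq_quot germ_equiv}%qT.
HB.instance Definition _ := Choice.on germ.
HB.instance Definition _ := Quotient.on germ.

Definition mk_germ s x (sx : a s x) : germ :=
  \pi_(germ)%qT (exist (fun sx : S * X => is_true (isSome (a sx.1 sx.2))) (s, x) sx).

Lemma germP s x t y (sx : a s x) (ty : a t y) :
  mk_germ sx = mk_germ ty <->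
  x = y /\ exists u, [/\ sle u s, sle u t & a u x].
Proof.
by split=> [/eqmodP/asboolP//|H]; apply/eqmodP/asboolP.
Qed.

Lemma germW (P : germ -> Prop) :
  (forall s x (sx : a s x), P (mk_germ sx)) -> forall g, P g.
Proof. by move=> H g; rewrite -[g]reprK; case: (repr g) => -[s x] /= sx; exact: H. Qed.

Definition germ_src (g : germ) : X := (val (repr g)).2.
Definition germ_rng (g : germ) : X :=
  odflt (germ_src g) (a (val (repr g)).1 (germ_src g)).

(** [[s, x]], or [g0] when [s.x] is undefined. *)
Definition germ_or (g0 : germ) (s : S) (x : X) : germ :=
  if insub (s, x) is Some p then \pi_(germ)%qT (p : pregerm) else g0.

Definition germ_inv (g : germ) : germ :=
  germ_or g (sinv (val (repr g)).1) (germ_rng g).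
Definition germ_mul (g h : germ) : germ :=
  germ_or g ((val (repr g)).1 * (val (repr h)).1)%g (germ_src h).

Definition unit_idem (x : X) : S := s2val (cid2 (act_id_exists a x)).
Lemma unit_idemP x : a (unit_idem x) x.
Proof. by rewrite /unit_idem; case: cid2 => /= e _ ->. Qed.
Definition germ_unit (x : X) : germ := mk_germ (unit_idemP x).

Lemma germ_orE g0 s x (sx : a s x) : germ_or g0 s x = mk_germ sx.
Proof.
rewrite /germ_or /mk_germ; case: insubP => [p _ ep|/negP//].
by apply: f_equal; exact: val_inj.
Qed.

Lemma mk_germ_repr s x (sx : a s x) (g := mk_germ sx) :
  germ_src g = x /\ exists u, [/\ sle u s, sle u (val (repr g)).1 & a u x].
Proof.
have : \pi_(germ)%qT (repr g) = g by exact: reprK.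
rewrite {2}/g /germ_src; case: (repr g) => -[t y] /= ty.
by move=> /(germP ty sx)[-> [u [ut us ux]]]; split=> //; exists u.
Qed.

Lemma germ_srcE s x (sx : a s x) : germ_src (mk_germ sx) = x.
Proof. by have [] := mk_germ_repr sx. Qed.

Lemma germ_rngE s x (sx : a s x) : a s x = Some (germ_rng (mk_germ sx)).
Proof.
have [e [u [us ut ux]]] := mk_germ_repr sx; rewrite /germ_rng e.
move: ux; case ux: (a u x) => [y|//] _.
by rewrite (act_sle us ux) (act_sle ut ux).
Qed.

Lemma germ_unitE e x (ex : a e x) : sidem e -> mk_germ ex = germ_unit x.
Proof.
move=> ee; apply/germP; split=> //.
have ff : sidem (unit_idem x) by rewrite /unit_idem; case: cid2.
exists (e * unit_idem x)%g; split.
- by exists (unit_idem x).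
- by exists e => //; exact: sidemC.
- rewrite actM; have := unit_idemP x.
  by case E: (a _ x) => [y|//] _ /=; rewrite (act_idem ff E).
Qed.

Lemma germ_invE s x y (sx : a s x) (sy : a (sinv s) y) :
  a s x = Some y -> germ_inv (mk_germ sx) = mk_germ sy.
Proof.
move=> sxy; rewrite /germ_inv.
have -> : germ_rng (mk_germ sx) = y by move: (germ_rngE sx); rewrite sxy => -[].
have [_ [u [us ut ux]]] := mk_germ_repr sx.
have {ux}uxy : a u x = Some y.
  by move: ux; case E: (a u x) => [z|//] _; rewrite -sxy (act_sle us E).
set t := (val _).1 in ut *.
have txy : a t x = Some y by exact: act_sle uxy.
have ty : a (sinv t) y by rewrite (act_sinv txy).
rewrite (germ_orE _ ty); apply/germP; split=> //; exists (sinv u); split.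
- exact: sle_sinv.
- exact: sle_sinv.
- by rewrite (act_sinv uxy).
Qed.

Lemma germ_mulE s t x y (sy : a s y) (tx : a t x) (stx : a (s * t)%g x) :
  a t x = Some y -> germ_mul (mk_germ sy) (mk_germ tx) = mk_germ stx.
Proof.
move=> txy; rewrite /germ_mul germ_srcE.
have [_ [u [us us' uy]]] := mk_germ_repr sy.
have [_ [v [vt vt' vx]]] := mk_germ_repr tx.
have vxy : a v x = Some y.
  by move: vx; case E: (a v x) => [z|//] _; rewrite -(act_sle vt E).
have uvx : a (u * v)%g x by rewrite actM vxy.
set s' := (val _).1 in us' *; set t' := (val _).1 in vt' *.
have stx' : a (s' * t')%g x.
  rewrite actM (act_sle vt' vxy) /=.
  by move: uy; case E: (a u y) => [z|//] _; rewrite (act_sle us' E).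
rewrite (germ_orE _ stx'); apply/germP; split=> //.
by exists (u * v)%g; split=> //; exact: sleM.
Qed.

End Germs.

Section TransformationGroupoid.
Context {S : invSemigroupType} {X : topologicalType} (a : paction S X).

(** The bisection [[s, x] | x in V]. *)
Definition bisection (s : S) (V : set X) : set (germ a) :=
  [set g | exists x (sx : a s x), V x /\ g = mk_germ sx].

HB.instance Definition _ := isSubBaseTopological.Build (germ a)
  (I := set (germ a)) [set B | exists s V, open V /\ B = bisection s V] id.

Lemma germ_is_groupoid : is_groupoid (@germ_src _ _ a) (@germ_rng _ _ a)
  (@germ_unit _ _ a) (@germ_inv _ _ a) (@germ_mul _ _ a).
Proof.
have rngE s x (sx : a s x) y : a s x = Some y -> germ_rng (mk_germ sx) = y.
  by rewrite (germ_rngE sx) => -[].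
have domV s x y : a s x = Some y -> a (sinv s) y by move=> sxy; rewrite (act_sinv sxy).
have domM s t x y : a s y -> a t x = Some y -> a (s * t)%g x.
  by move=> sy tx; rewrite actM tx.
have unitE e x (ex : a e x) : sidem e -> germ_unit a x = mk_germ ex.
  by move=> ee; rewrite germ_unitE.
have unitx x : exists e (ex : a e x),
    [/\ sidem e, a e x = Some x & germ_unit a x = mk_germ ex].
  have [e ee ex] := act_id_exists a x.
  have ex' : a e x by rewrite ex.
  by exists e, ex'; split=> //; exact: unitE.
have mulE s t x y (sy : a s y) (tx : a t x) (txy : a t x = Some y) :
    germ_mul (mk_germ sy) (mk_germ tx) = mk_germ (domM _ _ _ _ sy txy).
  exact: germ_mulE.
have invE s x y (sx : a s x) (sxy : a s x = Some y) :
    germ_inv (mk_germ sx) = mk_germ (domV _ _ _ sxy).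
  exact: germ_invE.
have srcE := @germ_srcE _ _ a.
split.
- by move=> x; rewrite srcE.
- by move=> x; have [e [ex [ee exx ->]]] := unitx x; exact: rngE.
- apply: germW => s x sx; have sxy := germ_rngE sx.
  by rewrite (invE _ _ _ sx sxy) srcE.
- apply: germW => s x sx; have sxy := germ_rngE sx.
  by rewrite (invE _ _ _ sx sxy) srcE; apply: rngE; exact: act_sinv.
- apply: germW => s y sy; apply: germW => t x tx; rewrite srcE => yE.
  have txy := germ_rngE tx; rewrite -yE in txy.
  by rewrite (mulE _ _ _ _ sy tx txy) !srcE.
- apply: germW => s y sy; apply: germW => t x tx; rewrite srcE => yE.
  have txy := germ_rngE tx; rewrite -yE in txy.
  rewrite (mulE _ _ _ _ sy tx txy); apply: rngE.
  by rewrite actM txy /=; exact: germ_rngE.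
- apply: germW => s x sx; have sxy := germ_rngE sx.
  have [e [ex [ee exx ->]]] := unitx (germ_rng (mk_germ sx)).
  rewrite (mulE _ _ _ _ ex sx sxy); apply/germP; split=> //; exists (e * s)%g.
  split; last by rewrite actM sxy.
  + exact: sle_refl.
  + by have [ff ->] := sidem_mull s ee; exists (sinv s * e * s)%g.
- apply: germW => s x sx; rewrite srcE; have [e [ex [ee exx ->]]] := unitx x.
  rewrite (mulE _ _ _ _ sx ex exx); apply/germP; split=> //; exists (s * e)%g.
  split; last by rewrite actM exx.
  + exact: sle_refl.
  + by exists e.
- apply: germW => s x sx; have sxy := germ_rngE sx.
  rewrite (invE _ _ _ sx sxy) (mulE _ _ _ _ sx _ (act_sinv sxy)).
  by rewrite germ_unitE//; exact: sidem_Msinv.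
- apply: germW => s x sx; have sxy := germ_rngE sx.
  rewrite (invE _ _ _ sx sxy) srcE (mulE _ _ _ _ _ sx sxy).
  by rewrite germ_unitE//; exact: sidem_sinvM.
- apply: germW => r z rz; apply: germW => s y sy; apply: germW => t x tx.
  rewrite !srcE => zE yE.
  have sxy := germ_rngE sy; rewrite -zE in sxy.
  have txy := germ_rngE tx; rewrite -yE in txy.
  have stxz : a (s * t)%g x = Some z by rewrite actM txy.
  rewrite (mulE _ _ _ _ sy tx txy) (mulE _ _ _ _ rz sy sxy).
  rewrite (mulE _ _ _ _ rz _ stxz) (mulE _ _ _ _ _ tx txy).
  apply/germP; split=> //; exists (r * s * t)%g.
  by rewrite mulgA actM txy /= actM sxy; split=> //; exact: sle_refl.
Qed.

Definition transformation_groupoid : groupoid :=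
  @Groupoid X (germ a) _ _ _ _ _ germ_is_groupoid.

End TransformationGroupoid.

(** The orders built below on the iterated lattices of relative complements are
    only known to be partial orders under hypotheses on the previous stage, so
    the order structure is kept separate from its laws. *)
Record pposet := PPoset {
  pp_sort :> choiceType;
  ple : rel pp_sort;
  pbot : pp_sort
}.
Arguments pbot {_}.

Definition pposet_of d (L : bPOrderType d) : pposet :=
  PPoset (<=%O : rel L) (\bot)%O.

Section PPosets.
Context {L : pposet}.
Implicit Types (k l m : L) (A F : set L).

Definition maximals A : set L := [set m | A m /\ forall x, A x -> ple m x -> x = m].

Definition lower_bounds2 k l : set L := [set m | ple m k /\ ple m l].

Definition meets k l : set L := maximals (lower_bounds2 k l).

Definition perp k l : Prop := forall m, lower_bounds2 k l m -> m = pbot.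

Definition downward_closed A : Prop := forall k l, ple k l -> A l -> A k.

Definition finite_cover l F : Prop :=
  [/\ finite_set F, forall f, F f -> ple f l &
      forall k, (forall f, F f -> perp k f) -> perp k l].

Definition meets_cover k F : set L := maximals (\bigcup_(f in F) meets k f).

End PPosets.

Definition is_pposet (L : pposet) : Prop :=
  [/\ reflexive (@ple L), antisymmetric (@ple L), transitive (@ple L) &
      forall l : L, ple pbot l].

Definition weak_semilattice (L : pposet) : Prop :=
  is_pposet L /\
  forall k l : L, exists A : set L,
    [/\ finite_set A, A `<=` lower_bounds2 k l &
        forall m, lower_bounds2 k l m -> exists2 a, A a & ple m a].

Definition locally_finite (L : pposet) : Prop :=
  forall A : set L, finite_set A -> exists B : set L,
    [/\ finite_set B, A `<=` B & forall k l, B k -> B l -> meets k l `<=` B].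

Definition lf_weak_semilattice (L : pposet) : Prop :=
  weak_semilattice L /\ locally_finite L.

Definition semilattice (L : pposet) : Prop :=
  is_pposet L /\
  forall k l : L, exists2 m, lower_bounds2 k l m &
    forall x, lower_bounds2 k l x -> ple x m.

Definition order_iso_of_downsets (L : pposet) (f : L -> option L) : Prop :=
  [/\ downward_closed (pdom f), downward_closed (pran f) &
      forall k l k' l', f k = Some k' -> f l = Some l' -> ple k' l' = ple k l].

(** Every down-set is taken to contain the least element, which is then fixed. *)
Definition lattice_action (S : invSemigroupType) (L : pposet)
    (a : S -> L -> option L) : Prop :=
  [/\ forall s, order_iso_of_downsets (a s),
      forall s, a s pbot = Some pbot,
      forall s t l, a (s * t)%g l = obind (a s) (a t l),
      forall l, l <> pbot -> a szero l = None &
      forall l, l <> pbot -> exists s, a s l].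

Definition is_character (L : pposet) (chi : L -> bool) : Prop :=
  [/\ exists l, chi l, chi pbot = false &
      forall k l, (chi k /\ chi l) <-> exists2 m, meets k l m & chi m].

Definition spectrum (L : pposet) : Type :=
  set_type [set chi : {ptws L -> bool} | is_character chi].
HB.instance Definition _ (L : pposet) := Topological.on (spectrum L).

Definition spectrum_fun (L : pposet) (chi : spectrum L) : L -> bool :=
  proj1_sig chi.

Definition Spectrum (L : pposet) (chi : L -> bool) (H : is_character chi) :
    spectrum L :=
  exist (fun f : {ptws L -> bool} => f \in [set f : {ptws L -> bool} | is_character f])
    chi (mem_set H).

Lemma spectrumP (L : pposet) (chi : spectrum L) : is_character (spectrum_fun chi).
Proof. by case: chi => /= chi /set_mem. Qed.

Section SpectrumTheory.
Context {L : pposet} (HL : weak_semilattice L).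

Lemma seq_maximal (s : seq L) (a : L) : a \in s ->
  exists2 m, m \in s /\ ple a m & forall x, x \in s -> ple m x -> x = m.
Proof.
have [[refl anti trans _] _] := HL.
have antiP (x y : L) : ple x y -> ple y x -> x = y.
  by move=> xy yx; apply: anti; rewrite xy.
elim: s a => [//|b s IH] a; rewrite inE => /orP[/eqP -> {a}|/IH].
  have [[c [cs bc]]|nb] := pselect (exists c, c \in s /\ ple b c).
    have [m [ms cm] mmax] := IH c cs.
    exists m; first by rewrite inE ms orbT; split=> //; exact: trans cm.
    move=> x; rewrite inE => /orP[/eqP -> mb|]; last exact: mmax.
    by apply: antiP => //; exact: trans cm.
  exists b; first by rewrite inE eqxx.
  move=> x; rewrite inE => /orP[/eqP //|xs bx].
  by exfalso; apply: nb; exists x.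
move=> [m [ms am] mmax]; have [mb|mb] := boolP (ple m b).
  exists b; first by rewrite inE eqxx; split=> //; exact: trans mb.
  move=> x; rewrite inE => /orP[/eqP //|xs bx].
  have xm : x = m by apply: mmax => //; exact: trans bx.
  by subst x; exact: antiP.
exists m; first by rewrite inE ms orbT.
move=> x; rewrite inE => /orP[/eqP ->|]; last exact: mmax.
by rewrite (negbTE mb).
Qed.

Lemma below_meets (k l x : L) : lower_bounds2 k l x ->
  exists2 m, meets k l m & ple x m.
Proof.
have [[_ _ trans _] H] := HL; move=> /[dup] xkl.
have [A [/finite_seqP[s ->] Akl Amax]] := H k l.
move=> /Amax[a /seq_maximal[m [ms am] mmax] xa].
exists m; last exact: trans am.
split; first exact: Akl.
move=> y /Amax[b bs yb] my; have bm : b = m.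
  by apply: mmax => //; exact: trans yb.
by subst b; have [[_ anti _ _] _] := HL; apply: anti; rewrite yb.
Qed.

Lemma character_mono (chi : L -> bool) k l :
  is_character chi -> ple k l -> chi k -> chi l.
Proof.
have [[refl anti _ _] _] := HL; move=> [_ _ M] kl ck.
suff /M[] : exists2 m, meets k l m & chi m by [].
exists k => //; split; first by split.
by move=> x [xk _] kx; apply: anti; rewrite xk.
Qed.

End SpectrumTheory.

Section SpectrumAction.
Context {S : invSemigroupType} {L : pposet} (a : S -> L -> option L).

Definition spectrum_dom (s : S) : set (spectrum L) :=
  [set chi | exists2 l, pdom (a s) l & spectrum_fun chi l].

Definition spectrum_val (s : S) (chi : L -> bool) : L -> bool := fun l =>
  `[< exists k j, [/\ pran (a s) k, ple k l, a (sinv s) k = Some j & chi j] >].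

Context (HL : weak_semilattice L) (Ha : lattice_action a).

Lemma lact_inj s k l m : a s k = Some m -> a s l = Some m -> k = l.
Proof.
have [iso _ _ _ _] := Ha; have [[refl anti _ _] _] := HL.
have [_ _ mono] := iso s; move=> km lm; apply: anti.
by rewrite -(mono _ _ _ _ km lm) -(mono _ _ _ _ lm km) refl.
Qed.

Lemma lact_idem e k l : sidem e -> a e k = Some l -> l = k.
Proof.
have [_ _ M _ _] := Ha; move=> ee kl; apply: (@lact_inj e _ _ l) => //.
by have := M e e k; rewrite ee kl /= => ->.
Qed.

Lemma lact_sinv s k l : a s k = Some l -> a (sinv s) l = Some k.
Proof.
have [_ _ M _ _] := Ha; move=> kl.
have := kl; rewrite -{1}(mulKs s) -mulgA M.
case E: (a (sinv s * s)%g k) => [z|//] _.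
have zk := lact_idem (sidem_sinvM s) E.
by move: E; rewrite zk M kl.
Qed.

Lemma spectrum_valP s chi l :
  spectrum_val s chi l <-> exists j k, [/\ a s j = Some k, ple k l & chi j].
Proof.
split=> [/asboolP[k [j [[j' jk] kl kj cj]]]|[j [k [jk kl cj]]]].
  exists j, k; split=> //.
  by have := lact_sinv jk; rewrite kj => -[->].
apply/asboolP; exists k, j; split=> //; first by exists j.
exact: lact_sinv.
Qed.

Lemma spectrum_val_character s (chi : spectrum L) :
  spectrum_dom s chi -> is_character (spectrum_val s (spectrum_fun chi)).
Proof.
have [iso ab _ _ _] := Ha; have [dd _ mono] := iso s.
have [[refl anti trans bot] _] := HL.
have [_ c0 M] := spectrumP chi.
move=> [l0]; rewrite /pdom /=.
case E: (a s l0) => [k0|//] _ cl0; split.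
- by exists k0; apply/spectrum_valP; exists l0, k0; rewrite refl.
- apply/negbTE/negP => /spectrum_valP[j [k [jk k0' cj]]].
  have kb : k = pbot by apply: anti; rewrite k0' bot.
  subst k; have jb := lact_inj jk (ab s).
  by subst j; rewrite c0 in cj.
- move=> k l; split=> [[]|[m [[mk ml] _]]].
    move=> /spectrum_valP[i [i' [ii' i'k ci]]] /spectrum_valP[j [j' [jj' j'l cj]]].
    have /M[m [[mi mj] _] cm] : spectrum_fun chi i /\ spectrum_fun chi j by [].
    have : a s m by apply: (dd m i mi); rewrite /pdom /= ii'.
    case mm': (a s m) => [m'|//] _.
    have [] : exists2 n, meets k l n & ple m' n.
      apply: below_meets => //; split.
        by apply: trans i'k; rewrite (mono _ _ _ _ mm' ii').
      by apply: trans j'l; rewrite (mono _ _ _ _ mm' jj').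
    by move=> n kln m'n; exists n => //; apply/spectrum_valP; exists m, m'.
  move=> /spectrum_valP[j [j' [jj' j'm cj]]].
  by split; apply/spectrum_valP; exists j, j'; split=> //; exact: trans j'm _.
Qed.

Definition spectrum_act (s : S) (chi : spectrum L) : option (spectrum L) :=
  if pselect (spectrum_dom s chi) is left H
  then Some (Spectrum (spectrum_val_character H)) else None.

Lemma spectrum_eq (chi psi : spectrum L) :
  (forall l, spectrum_fun chi l <-> spectrum_fun psi l) -> chi = psi.
Proof.
move=> H; apply: val_inj; apply/funext => l /=.
by apply/idP/idP => /H.
Qed.

Lemma spectrum_actP s chi psi : spectrum_act s chi = Some psi <->
  spectrum_dom s chi /\
  forall l, spectrum_fun psi l <->
    exists j k, [/\ a s j = Some k, ple k l & spectrum_fun chi j].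
Proof.
rewrite /spectrum_act; case: pselect => [H|H]; split=> //; last by case.
  by move=> [<-]; split=> // l; exact: spectrum_valP.
move=> [_ Hpsi]; congr Some; apply: spectrum_eq => l.
by apply: iff_trans (iff_sym (Hpsi l)); exact: spectrum_valP.
Qed.

Lemma spectrum_actN s chi : ~ spectrum_dom s chi -> spectrum_act s chi = None.
Proof. by rewrite /spectrum_act; case: pselect. Qed.

Lemma spectrum_act_ex s chi : spectrum_dom s chi ->
  exists psi, spectrum_act s chi = Some psi.
Proof. by rewrite /spectrum_act; case: pselect => // H _; eexists. Qed.

Lemma spectrum_act_inj s chi chi' psi :
  spectrum_act s chi = Some psi -> spectrum_act s chi' = Some psi -> chi = chi'.
Proof.
have [iso ab M a0 cov] := Ha; have [[refl anti trans bot] _] := HL.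
suff H : forall phi phi' : spectrum L, spectrum_act s phi = Some psi ->
    spectrum_act s phi' = Some psi ->
    forall l, spectrum_fun phi l -> spectrum_fun phi' l.
  by move=> h h'; apply: spectrum_eq => l; split; exact: H.
move=> {}chi {}chi' /spectrum_actP[[l0 l0s cl0] E] /spectrum_actP[_ E'].
move=> l cl; have [_ _ Mc] := spectrumP chi; have [dd _ mono] := iso s.
have /Mc[m [[ml ml0] _] cm] : spectrum_fun chi l /\ spectrum_fun chi l0 by [].
have : a s m by exact: dd l0s.
case mm': (a s m) => [m'|//] _.
have /E' [j [j' [jj' j'm' cj]]] : spectrum_fun psi m'.
  by apply/E; exists m, m'; rewrite refl.
apply: (character_mono HL (spectrumP chi') _ cj).
by apply: trans ml; rewrite -(mono _ _ _ _ jj' mm').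
Qed.

Lemma spectrum_actM s t chi :
  spectrum_act (s * t)%g chi = obind (spectrum_act s) (spectrum_act t chi).
Proof.
have [iso ab M a0 cov] := Ha; have [[refl anti trans bot] _] := HL.
have domE : spectrum_dom (s * t)%g chi <->
    exists2 psi, spectrum_act t chi = Some psi & spectrum_dom s psi.
  split=> [[l]|[psi /spectrum_actP[_ E] [l]]].
    rewrite /pdom /= M; case tl: (a t l) => [l'|//] /= sl' cl.
    have : spectrum_dom t chi by exists l => //; rewrite /pdom /= tl.
    move=> /spectrum_act_ex[psi Hpsi]; exists psi => //.
    have [_ E] := (spectrum_actP _ _ _).1 Hpsi.
    by exists l' => //; apply/E; exists l, l'; rewrite refl.
  move=> sl /E[j [k [jk kl cj]]]; exists j => //.
  by rewrite /pdom /= M jk /=; have [dd _ _] := iso s; exact: dd sl.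
have [/domE[psi Hpsi sd]|nd] := pselect (spectrum_dom (s * t)%g chi); last first.
  rewrite spectrum_actN//; case Hpsi: (spectrum_act t chi) => [psi|//] /=.
  by rewrite spectrum_actN// => sd; apply: nd; apply/domE; exists psi.
rewrite Hpsi /=; have [phi Hphi] := spectrum_act_ex sd; rewrite Hphi.
apply/spectrum_actP; split; first by apply/domE; exists psi.
have /spectrum_actP[_ E] := Hpsi; have /spectrum_actP[_ E'] := Hphi.
have [dd _ mono] := iso s.
move=> l; split=> [/E'[i [i' [ii' i'l /E[j [k [jk ki cj]]]]]]|].
  have : a s k by apply: (dd k i ki); rewrite /pdom /= ii'.
  case kk': (a s k) => [k'|//] _; exists j, k'; split=> //.
    by rewrite M jk.
  by apply: trans i'l; rewrite (mono _ _ _ _ kk' ii').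
move=> [j [k [+ kl cj]]]; rewrite M; case jj': (a t j) => [j'|//] /= j'k.
by apply/E'; exists j', k; split=> //; apply/E; exists j, j'; rewrite refl.
Qed.

Lemma spectrum_act0 chi : spectrum_act szero chi = None.
Proof.
have [iso ab M a0 cov] := Ha; have [[refl anti trans bot] _] := HL.
apply: spectrum_actN => -[l]; rewrite /pdom /= => sl cl.
have [_ c0 _] := spectrumP chi.
have [lb|/eqP lb] := eqVneq l pbot; last by rewrite a0 in sl.
by rewrite lb c0 in cl.
Qed.

Lemma spectrum_act_cover chi : exists s, spectrum_act s chi.
Proof.
have [iso ab M a0 cov] := Ha; have [[refl anti trans bot] _] := HL.
have [[l cl] c0 _] := spectrumP chi.
have [|s sl] := cov l; first by move=> lb; rewrite lb c0 in cl.
exists s; suff /spectrum_act_ex[psi ->] : spectrum_dom s chi by [].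
by exists l.
Qed.

Definition spectrum_action : paction S (spectrum L) :=
  PAction spectrum_act_inj spectrum_actM spectrum_act0 spectrum_act_cover.

End SpectrumAction.

Definition compact_open (X : topologicalType) : set (set X) :=
  [set V | compact V /\ open V].

Definition representation (L : pposet) (X : topologicalType) (U : L -> set X) : Prop :=
  [/\ forall l, compact_open (U l),
      forall k l, ple k l -> U k `<=` U l,
      U pbot = set0 &
      forall k l, U k `&` U l = \bigcup_(m in meets k l) U m].

Definition generating (L : pposet) (X : topologicalType) (U : L -> set X) : Prop :=
  smallest (fun A => setU_closed A /\ setSD_closed A) (range U) = @compact_open X.

Definition equivariant (S : invSemigroupType) (L : pposet) (X : topologicalType)
    (aL : S -> L -> option L) (aX : paction S X) (U : L -> set X) : Prop :=
  (forall s, pdom (aX s) = \bigcup_(l in pdom (aL s)) U l) /\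
  forall s l k, aL s l = Some k -> pimage (aX s) (U l) = U k.

Section Covers.
Context {L : pposet}.
Implicit Types (R : L -> set (set L)) (l : L) (F : set L).

Definition cover_system R : Prop :=
  [/\ forall l F, R l F -> finite_cover l F,
      forall l, R l [set l] &
      forall k l F, ple k l -> R l F -> R k (meets_cover k F)].

Definition invariant_covers (S : invSemigroupType) (a : S -> L -> option L) R : Prop :=
  forall s l k F, a s l = Some k -> R l F -> R k (pimage (a s) F).

Definition concrete_covers (X : topologicalType) (U : L -> set X) R : Prop :=
  forall l F, R l F -> U l = \bigcup_(f in F) U f.

(** A tree of covers is a function [T] giving, for a chain [f_1, ..., f_j], the set
    [T [:: f_1; ...; f_j]] in which [f_(j+1)] may be chosen. *)
Definition chain (T : seq L -> set L) (p : seq L) : Prop :=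
  forall j, (j < size p)%N -> T (take j p) (nth pbot p j).

Definition thorough (X : topologicalType) (U : L -> set X) R : Prop :=
  forall l (ls : seq L), ls <> [::] -> U l `<=` \bigcup_(i in [set` ls]) U i ->
    exists (N : nat) (T : seq L -> set L),
      [/\ (0 < N)%N,
          forall p, chain T p -> (size p < N)%N -> R (last l p) (T p) &
          forall p, chain T p -> size p = N ->
            exists2 i, i \in ls & ple (last l p) i].

Definition nontrivial_covers R l : set (set L) := [set F | R l F /\ ~ F l].

Definition sup_nontrivial_covers R (N : nat) : Prop :=
  (forall l, nontrivial_covers R l #<= `I_N)%card /\
  forall M, (forall l, nontrivial_covers R l #<= `I_M)%card -> (N <= M)%N.

End Covers.

Section IntegralRing.
Local Open Scope ring_scope.
Context {L : pposet}.

Definition nonbot : choiceType := {l : L | l != pbot}.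

Definition ZL : zmodType := {freeg nonbot / int}.

(** The image of [l] in [Z L], the least element being identified with [0]. *)
Definition zgen (l : L) : ZL := if insub l is Some x then << x >> else 0.

(** The additive extension of [l |-> 1_{k | k <= l}]. *)
Definition zfun (z : ZL) (k : nonbot) : int :=
  fglift (fun l : nonbot => (ple (val k) (val l))%:R : int^o) z.

(** The product on [Z L] is the one making the injective map [zfun] multiplicative;
    it exists when [L] is a locally finite weak semilattice. *)
Definition zmul (x y : ZL) : ZL :=
  xget 0 [set z | forall k, zfun z k = zfun x k * zfun y k].

(** Product of a nonempty sequence; [Z L] need not have a unit. *)
Definition zprod (s : seq ZL) : ZL :=
  if s is x :: s' then foldl zmul x s' else 0.

Definition zjoin (F : set ZL) : ZL :=
  \sum_(F' <- fpowerset (fset_set F) | F' != fset0)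
    zprod (enum_fset F') *~ (-1) ^+ (#|` F'|.-1).

(** The element [(l | FF)]. *)
Definition rel_compl (l : L) (FF : set (set L)) : ZL :=
  zgen l - zjoin (zgen @` \bigcup_(F in FF) F).

End IntegralRing.
Arguments ZL : clear implicits.

Record covered_lattice (S : invSemigroupType) := CoveredLattice {
  cl_poset :> pposet;
  cl_covers : cl_poset -> set (set cl_poset);
  cl_act : S -> cl_poset -> option cl_poset
}.

Section RelativeComplements.
Context {S : invSemigroupType} (D : covered_lattice S).
Let L : pposet := D.
Let R : L -> set (set L) := @cl_covers S D.
Let a : S -> L -> option L := @cl_act S D.

Definition admissible (l : L) (FF : set (set L)) : Prop :=
  [/\ FF !=set0, finite_set FF & FF `<=` R l].

Definition rc_set : set (ZL L) :=
  [set p | exists l FF, admissible l FF /\ p = rel_compl l FF] `|` [set 0%R].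

Definition rc_sort : choiceType := set_type rc_set.

Definition rc_le : rel rc_sort := fun p q => zmul (val p) (val q) == val p.

Definition rc_bot : rc_sort := exist _ 0%R (mem_set (or_intror erefl)).

Definition rc_poset : pposet := PPoset rc_le rc_bot.

(** [R(l | FF | F')] *)
Definition rc_cover (l : L) (FF : set (set L)) (F' : set L) : set rc_poset :=
  maximals [set p : rc_poset |
    val p = rel_compl l (FF `|` [set F']) \/
    exists2 f, F' f & val p = rel_compl f (meets_cover f @` FF)].

Definition rc_covers (p : rc_poset) : set (set rc_poset) :=
  [set C | (p = rc_bot /\ C = [set rc_bot]) \/
    p <> rc_bot /\ exists l FF F',
      [/\ admissible l FF, val p = rel_compl l FF, R l F' & C = rc_cover l FF F']].

(** [s.(l | FF) = (s.l | s.FF)] for [l] in the domain of [s] *)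
Definition rc_act_rel (s : S) (p q : rc_poset) : Prop :=
  exists l k FF, [/\ admissible l FF, val p = rel_compl l FF, a s l = Some k &
    val q = rel_compl k (pimage (a s) @` FF)].

Definition rc_act (s : S) (p : rc_poset) : option rc_poset :=
  if pselect (exists q, rc_act_rel s p q) is left H then Some (projT1 (cid H))
  else None.

Definition relative_complements : covered_lattice S :=
  CoveredLattice rc_covers rc_act.

End RelativeComplements.

Definition relative_complements_seq (S : invSemigroupType) (D : covered_lattice S)
    (k : nat) : covered_lattice S :=
  iter k (@relative_complements S) D.

Definition spectrum_groupoid (S : invSemigroupType) (L : pposet)
    (a : S -> L -> option L) (HL : lf_weak_semilattice L) (Ha : lattice_action a) :
    groupoid :=
  transformation_groupoid (spectrum_action HL.1 Ha).

Definition independent_resolution (G : groupoid) (Gs : nat -> groupoid) : Prop :=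
  ample G /\ (forall i, ample (Gs i)) /\
  exists (C O : forall i, set (obj (Gs i))),
    [/\ forall i, [/\ closed (C i), invariant_set (C i), C i `&` O i = set0 &
                      C i `|` O i = setT],
        groupoid_isomorphic (restriction [set: obj G]) (restriction (C 0)),
        forall i, groupoid_isomorphic (restriction (O i)) (restriction (C i.+1)) &
        forall i, exists (T : invSemigroupType) (L : pposet) (a : T -> L -> option L)
          (HL : lf_weak_semilattice L) (Ha : lattice_action a),
          groupoid_isomorphic (Gs i) (spectrum_groupoid HL Ha)].

(* Main.v *)
(** An element [p = (l | FF)] of [L_(i+1)] is determined by its support, the set of
    nonzero [k <= l] below no [f] in a member of [FF]: the order is inclusion of
    supports, and a nonempty support has [l] as its largest element. All of the
    structure of [L_(i+1)] is computed on supports.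

    In the spectrum of [L_i] let [C_i] consist of the characters [chi] such that
    [chi l = 1] implies [chi f = 1] for some [f] in [F], whenever [F] is a cover of [l].
    Evaluation of compact open sets identifies [X] with [C_0]; surjectivity is
    compactness together with thoroughness. Regarding a character as a filter, a
    [chi] outside [C_i] defines the character of [L_(i+1)] taking the value [1] at [p]
    iff [chi] is eventually in the support of [p]. This is a homeomorphism onto
    [C_(i+1)], whose inverse sends [phi] to the [chi] with [chi k = 1] iff [phi p = 1]
    for some [p] with support below [k]; thoroughness is not needed for it. Both
    homeomorphisms are equivariant, hence extend to the groupoids of germs. *)

From Pilot Require Import Defs.
From HB Require Import structures.
From mathcomp Require Import all_boot all_order all_algebra finmap freeg.
From mathcomp Require Import all_classical topology.
Import Pilot.Defs.

Set Implicit Arguments.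
Unset Strict Implicit.
Unset Printing Implicit Defensive.

Import Order.TTheory GRing.Theory.
Local Open Scope classical_set_scope.

(** * Maximal elements and meets in weak semilattices *)

Section PosetFacts.
Context {L : pposet} (HL : weak_semilattice L).
Implicit Types (k l m : L) (A B : set L).

(** An element of the next stage has many presentations (l | FF), of which only the top l is
    determined when it is nonzero. Action and covers are defined through presentations, and the
    order through a product on Z L that is a choice with a default value. Passing to supports
    removes both choices; it requires that pointwise products of functions are attained in Z L,
    which follows from local finiteness. That FF is nonempty matters twice. If chi is eventually in
    the support of (l | FF), it violates the members of FF, so it lies outside C_i. And the members
    of FF are nontrivial covers of l inducing trivial covers of (l | FF), so each stage loses a
    nontrivial cover. None is left at stage N, and a stage without nontrivial covers is followed by
    zero: hence N+1. The cover of (l | FF) induced by F splits it into a part avoiding F and the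
    parts below each f in F. A character of L_i outside C_i takes one of these sides, so its image
    is covered. Conversely, a covered character of the next stage can be pushed into the parts
    avoiding the members of FF one at a time, which shows that it comes from L_i. *)

Lemma ple_refl k : ple k k.
Proof. by have [[]] := HL. Qed.

Lemma ple_trans l k m : ple k l -> ple l m -> ple k m.
Proof. by have [[_ _ tr _] _] := HL; exact: tr. Qed.

Lemma ple_anti k l : ple k l -> ple l k -> k = l.
Proof. by have [[_ an _ _] _] := HL => kl lk; apply: an; rewrite kl. Qed.

Lemma ple_bot k : ple pbot k.
Proof. by have [[]] := HL. Qed.

Lemma ple_eqbot k : ple k pbot -> k = pbot.
Proof. by move=> kb; apply: ple_anti => //; exact: ple_bot. Qed.

Lemma ple_nbot k l : ple k l -> k != pbot -> l != pbot.
Proof. by move=> kl; apply: contraNN => /eqP lb; apply/eqP/ple_eqbot; rewrite -lb. Qed.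

Lemma meets_finite k l : finite_set (meets k l).
Proof.
have [_ /(_ k l)[A [fA Akl Amax]]] := HL.
apply: sub_finite_set fA => m [mkl mmax].
by have [a Aa ma] := Amax _ mkl; rewrite -(mmax a (Akl _ Aa) ma).
Qed.

Lemma maximals_below A : finite_set A -> forall a, A a ->
  exists2 m, maximals A m & ple a m.
Proof.
move=> /finite_seqP[s ->] a /= /(seq_maximal HL)[m [ms am] mm].
by exists m.
Qed.

Lemma maximals_sub A : maximals A `<=` A.
Proof. by move=> m []. Qed.

Lemma maximals_finite A : finite_set A -> finite_set (maximals A).
Proof. by apply: sub_finite_set; exact: maximals_sub. Qed.

(** A maximal element of one set lies below a maximal element of the other, which lies below an
    element of the first. Equalities between covers, which are sets of maximal elements, are reduced
    to this mutual cofinality. *)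
Lemma maximals_eq A B : finite_set A -> finite_set B ->
  (forall x, A x -> exists2 y, B y & ple x y) ->
  (forall x, B x -> exists2 y, A y & ple x y) -> maximals A = maximals B.
Proof.
suff H (C D : set L) : finite_set D ->
    (forall x, C x -> exists2 y, D y & ple x y) ->
    (forall x, D x -> exists2 y, C y & ple x y) -> maximals C `<=` maximals D.
  by move=> fA fB AB BA; apply/seteqP; split; exact: H.
move=> fD CD DC m [Cm mmax]; have [d Dd md] := CD _ Cm.
have [d' [Dd' d'max] dd'] := maximals_below fD Dd.
have [c Cc d'c] := DC _ Dd'.
have cm : c = m by apply: mmax => //; exact: ple_trans (ple_trans md dd') d'c.
subst c; have -> : m = d' by apply: ple_anti => //; exact: ple_trans dd'.
by split.
Qed.

Lemma meets_cover_finite k (F : set L) : finite_set F ->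
  finite_set (\bigcup_(f in F) meets k f).
Proof. by move=> fF; apply: bigcup_finite => // f _; exact: meets_finite. Qed.

(** A common lower bound of [k] and [f] lies below a maximal one, and that below a maximal element
    of the finite union of the [meets k f]. So restricting a cover to [k] does not change the
    down-set that it generates below [k]. *)
Lemma meets_cover_below k (F : set L) x : finite_set F -> ple x k ->
  (exists2 f, F f & ple x f) <-> exists2 g, meets_cover k F g & ple x g.
Proof.
move=> fF xk; split=> [[f Ff xf]|[g [[f Ff [[gk gf] _]] _] xg]].
  have [m mkf xm] := below_meets HL (conj xk xf).
  have [|g gm mg] := maximals_below (meets_cover_finite k fF) (a := m).
    by exists f.
  by exists g => //; exact: ple_trans mg.
by exists f => //; exact: ple_trans gf.
Qed.

Lemma meets_below k l m : meets k l m -> ple m k /\ ple m l.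
Proof. by move=> []. Qed.

Lemma meets_cover_le k F g : meets_cover k F g -> ple g k.
Proof. by move=> [[f _ /meets_below[]]]. Qed.

End PosetFacts.

(** * The ring Z L as a ring of functions *)

Section IntegralRingTheory.
Local Open Scope ring_scope.

(** Expansion of the product, by splitting the subsets of [A] into those with and without a chosen
    [x]. It turns the inclusion-exclusion sum of [zjoin] into a product. *)
Lemma sum_fpowerset (R : comPzRingType) (K : choiceType) (w : K -> R) (A : {fset K}) :
  \sum_(B <- fpowerset A) \prod_(x <- B) w x = \prod_(x <- A) (1 + w x).
Proof.
elim/finSet_rect: A => A IH; have [->|[x xA]] := fset_0Vmem A.
  by rewrite fpowerset0 !big_seq_fset0 big_seq_fset1 big_seq_fset0.
rewrite (big_fsetD1 x xA) -IH ?fproperD1//= (big_fsetID _ (fun B : {fset K} => x \in B)) /=.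
have -> : [fset B in fpowerset A | x \in B]%fset =
    [fset (x |` B)%fset | B in fpowerset (A `\ x)%fset]%fset.
  apply/fsetP => B; rewrite !inE /= fpowersetE; apply/andP/imfsetP => /= [[BA xB]|[C + ->]].
    exists (B `\ x)%fset; last by rewrite fsetD1K.
    by rewrite fpowersetE fsetSD.
  rewrite fpowersetE => CA; split; last by rewrite !inE eqxx.
  by rewrite fsubUset fsub1set xA; apply: fsubset_trans CA _; exact: fsubD1set.
have -> : [fset B in fpowerset A | x \notin B]%fset = fpowerset (A `\ x)%fset.
  by apply/fsetP => B; rewrite !inE /= !fpowersetE fsubsetD1.
have xC C : C \in fpowerset (A `\ x)%fset -> x \notin C.
  by rewrite fpowersetE fsubsetD1 => /andP[].
rewrite big_imfset /=; last first.
  by move=> B C /xC xB /xC xC' /(congr1 (fun D => (D `\ x)%fset)); rewrite !fsetU1K.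
rewrite mulrDl mul1r addrC; congr (_ + _); rewrite big_distrr /=.
by apply: eq_big_seq => B /xC xB; rewrite big_fsetU1.
Qed.

Context {L : pposet}.
Implicit Types (k : @nonbot L) (z : ZL L).

(** The arguments of [zfun] are exchanged so that evaluation at [k] can be registered as an additive
    map. *)
Definition zeval k z : int := zfun z k.

Lemma zeval_is_additive k : additive (zeval k).
Proof. exact: (@lift_is_additive int nonbot int^o). Qed.
HB.instance Definition _ k :=
  GRing.isAdditive.Build (ZL L) int (zeval k) (zeval_is_additive k).

Lemma zfun0 k : zfun 0 k = 0.
Proof. exact: (raddf0 (zeval k)). Qed.

Lemma zfunD z z' k : zfun (z + z') k = zfun z k + zfun z' k.
Proof. exact: (raddfD (zeval k)). Qed.

Lemma zfunB z z' k : zfun (z - z') k = zfun z k - zfun z' k.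
Proof. exact: (raddfB (zeval k)). Qed.

Lemma zfunMz z (n : int) k : zfun (z *~ n) k = zfun z k *~ n.
Proof. by have := raddfMz (zeval k) n z. Qed.

Lemma zfun_sum I (r : seq I) (P : pred I) (F : I -> ZL L) k :
  zfun (\sum_(i <- r | P i) F i) k = \sum_(i <- r | P i) zfun (F i) k.
Proof. exact: (raddf_sum (zeval k)). Qed.

Lemma zfun_gen (l : L) k : zfun (zgen l) k = (l != pbot)%:R * (ple (val k) l)%:R.
Proof.
rewrite /zgen; case: insubP => [x -> xl|]; last first.
  by move=> /negbTE ->; rewrite mul0r zfun0.
by rewrite /zfun liftU scale1r xl mul1r.
Qed.

Context (HL : lf_weak_semilattice L).
Let HW := HL.1.

Lemma zfun_genE (l : L) k : zfun (zgen l) k = (ple (val k) l)%:R.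
Proof.
rewrite zfun_gen; case: eqVneq => [->|_]; last by rewrite mul1r.
rewrite mul0r; case: (boolP (ple _ _)) => // /(ple_eqbot HW) kb.
by have := valP k; rewrite kb eqxx.
Qed.

Lemma zfunE z k : zfun z k = \sum_(l <- dom z) coeff l z * (ple (val k) (val l))%:R.
Proof.
rewrite -{1}[z]Freeg_dom /zfun fglift_Freeg /prelift big_map.
by apply: eq_bigr => l _.
Qed.

(** At a maximal element [m] of the support of [z - z'], the function takes the coefficient of [m]
    as its value, since no other generator in the support lies above [m]. *)
Lemma zfun_inj z z' : (forall k, zfun z k = zfun z' k) -> z = z'.
Proof.
move=> H; apply/eqP; rewrite -subr_eq0; set y := z - z'.
have y0 k : zfun y k = 0.
  by rewrite zfunB H subrr.
rewrite -dom_eq0; case E: (dom y) => [//|l0 s].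
have : val l0 \in map val (dom y) by rewrite E /= mem_head.
move=> /(seq_maximal HW)[_ [/mapP[m my ->] _] mm].
have := y0 m; rewrite zfunE (bigD1_seq m) ?uniq_dom//= (ple_refl HW) mulr1.
rewrite big_seq_cond big1 ?addr0 => [c0|l /andP[ly lm]].
  by move: my; rewrite mem_dom c0 eqxx.
case: (boolP (ple _ _)) => [ml|]; last by rewrite mulr0.
have /val_inj lE : val l = val m by apply: mm => //; exact: map_f.
by rewrite lE eqxx in lm.
Qed.

(** Running through the elements [c] of [B] above [k], the current element is replaced by a member
    of its meets with [c] that lies above [k]. Hence the type of [k] over [B], the set of elements
    of [B] above [k], is empty or the type of an element of [B]. *)
Lemma type_least (B : set L) (k : L) : finite_set B ->
  (forall a b, B a -> B b -> meets a b `<=` B) ->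
  (forall b, B b -> ~ ple k b) \/
  exists b, [/\ B b, ple k b & forall c, B c -> ple k c = ple b c].
Proof.
move=> /finite_seqP[s sB] clB.
suff H (t : seq L) (b : L) : (forall c, c \in t -> B c) -> B b -> ple k b ->
    exists b', [/\ B b', ple k b' & forall c, c \in b :: t -> ple k c -> ple b' c].
  have [[b Bb kb]|nb] := pselect (exists2 b, B b & ple k b); last first.
    by left=> b Bb kb; apply: nb; exists b.
  right; have [|b' [Bb' kb' b'min]] := H s b _ Bb kb; first by move=> c; rewrite sB.
  exists b'; split=> // c; rewrite sB /= => cs; apply/idP/idP => [kc|].
    by apply: b'min => //; rewrite inE cs orbT.
  exact: ple_trans.
elim: t => [|c t IH] tB Bb kb.
  by exists b; split=> // c; rewrite inE => /eqP -> _; exact: ple_refl.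
have [|b' [Bb' kb' b'min]] := IH _ Bb kb.
  by move=> d dt; apply: tB; rewrite inE dt orbT.
have [kc|nkc] := boolP (ple k c); last first.
  exists b'; split=> // d; rewrite !inE => /or3P[/eqP ->|/eqP ->|dt] kd.
  - by apply: b'min => //; rewrite mem_head.
  - by rewrite kd in nkc.
  - by apply: b'min => //; rewrite inE dt orbT.
have [m mb'c km] := below_meets HW (conj kb' kc).
have [mb' mc] := meets_below mb'c.
exists m; split=> //; first by apply: clB mb'c => //; apply: tB; rewrite mem_head.
move=> d; rewrite !inE => /or3P[/eqP ->|/eqP -> //|dt] kd.
- by apply: (ple_trans HW) mb' _; apply: b'min; rewrite ?mem_head.
- by apply: (ple_trans HW) mb' _; apply: b'min; rewrite // inE dt orbT.
Qed.

(** On a finite set closed under meets, [1_{k <= b}] for [b] in the set form a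
    unitriangular system, hence span all functions of the type of [k]. *)
Lemma zfun_surj (B : set L) (g : L -> int) : finite_set B ->
  (forall a b, B a -> B b -> meets a b `<=` B) ->
  (forall k k' : L, k != pbot -> k' != pbot ->
     (forall b, B b -> ple k b = ple k' b) -> g k = g k') ->
  (forall k : L, k != pbot -> (forall b, B b -> ~ ple k b) -> g k = 0) ->
  exists z, forall k, zfun z k = g (val k).
Proof.
move=> fB clB; have /finite_seqP[s sB] := fB.
(* [t] is a down-set in [B] outside of which [g] vanishes on the nonzero elements of [B]. A maximal
   [m] of [t] is removed after subtracting [g m] times [zgen m]; this changes [g] only at elements
   below [m], which belong to [t]. *)
suff H n (t : seq L) : (size t <= n)%N -> (forall b, b \in t -> B b) ->
    (forall a b, B a -> b \in t -> ple a b -> a \in t) ->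
    forall g : L -> int,
    (forall k k' : L, k != pbot -> k' != pbot ->
       (forall b, B b -> ple k b = ple k' b) -> g k = g k') ->
    (forall k : L, k != pbot -> (forall b, B b -> ~ ple k b) -> g k = 0) ->
    (forall b, B b -> b != pbot -> b \notin t -> g b = 0) ->
    exists z, forall k, zfun z k = g (val k).
  move=> gE g0; apply: (H (size s) s) => //; rewrite ?sB //.
  by move=> b /= ->.
elim: n t => [|n IH] t st tB tdown {}g gE g0 gt.
  move: st; rewrite leqn0 size_eq0 => /eqP t0.
  exists 0 => k; rewrite zfun0; have kb := valP k.
  have [nb|[b [Bb kb' bE]]] := type_least (val k) fB clB.
    by rewrite g0.
  rewrite (gE _ b) ?gt ?t0//; exact: (ple_nbot HW) kb' kb.
case: t st tB tdown gt => [|b0 t0]; first by move=> *; apply: (IH [::]).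
set t := b0 :: t0 => st tB tdown gt.
have [|m [mt _] mm] := seq_maximal HW (s := t) (a := b0); first exact: mem_head.
have [mb|mb] := eqVneq m pbot.
  apply: (IH [seq x <- t | x != m]) => //.
  - rewrite -ltnS (leq_trans _ st)// size_filter -(count_predC (pred1 m)).
    by rewrite -[X in (X < _)%N]add0n ltn_add2r -has_count has_pred1.
  - by move=> b; rewrite mem_filter => /andP[_ /tB].
  - move=> a b Ba; rewrite !mem_filter => /andP[bm bt] ab; rewrite (tdown _ _ Ba bt ab) andbT.
    apply/eqP => am; move/eqP: bm; apply; apply: mm => //.
    by rewrite mb; exact: ple_bot.
  - move=> b Bb bb; rewrite mem_filter mb bb /=; exact: gt.
pose g' (k : L) := g k - g m * (ple k m)%:R.
have [| | | | | |z zE] := IH [seq x <- t | x != m] _ _ _ g'.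
- rewrite -ltnS (leq_trans _ st)// size_filter -(count_predC (pred1 m)).
  by rewrite -[X in (X < _)%N]add0n ltn_add2r -has_count has_pred1.
- by move=> b; rewrite mem_filter => /andP[_ /tB].
- move=> a b Ba; rewrite !mem_filter => /andP[bm bt] ab.
  rewrite (tdown _ _ Ba bt ab) andbT; apply/eqP => am; move/eqP: bm; apply.
  by apply: mm => //; rewrite -am.
- by move=> k k' kb k'b E; rewrite /g' (gE k k')// E//; exact: tB.
- move=> k kb E; have /negbTE km : ~~ ple k m by apply/negP/E/tB.
  by rewrite /g' g0// km mulr0 subr0.
- move=> b Bb bb; rewrite mem_filter /g' negb_and negbK => /orP[/eqP ->|bt].
    by rewrite (ple_refl HW) mulr1 subrr.
  have /negbTE bm : ~~ ple b m by apply: contra bt; exact: tdown.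
  by rewrite gt// bm mulr0 subr0.
exists (z + zgen m *~ g m) => k.
rewrite zfunD zfunMz zE zfun_genE /g'.
by rewrite -mulrzl intz subrK.
Qed.

(** The choice in [zmul] defaults to 0, so a product has to be exhibited. By local finiteness the
    supports of both factors lie in a finite [B] closed under meets; the pointwise product depends
    only on types over [B], and [zfun_surj] applies. *)
Lemma zfun_mul z z' k : zfun (zmul z z') k = zfun z k * zfun z' k.
Proof.
have [B [fB sB clB]] : exists B : set L, [/\ finite_set B,
    [set` [seq val x | x <- dom z ++ dom z']] `<=` B &
    forall a b, B a -> B b -> meets a b `<=` B].
  by apply: HL.2; exact: finite_seq.
have mB y x : y = z \/ y = z' -> x \in dom y -> B (val x).
  move=> yz xy; apply: sB => /=; apply: map_f; rewrite mem_cat.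
  by case: yz xy => -> ->; rewrite ?orbT.
pose ext (y : ZL L) (l : L) : int := \sum_(x <- dom y) coeff x y * (ple l (val x))%:R.
have extE y k' : zfun y k' = ext y (val k') by rewrite zfunE.
have extB y (k1 k2 : L) : y = z \/ y = z' -> (forall b, B b -> ple k1 b = ple k2 b) ->
    ext y k1 = ext y k2.
  by move=> yz E; apply: eq_big_seq => x xy; rewrite E//; exact: mB xy.
have [| |w wE] := zfun_surj (g := fun l => ext z l * ext z' l) fB clB.
- move=> k1 k2 _ _ E; congr (_ * _); apply: extB => //; [by left|by right].
- move=> k1 _ E; rewrite [ext z k1]big_seq_cond big1 ?mul0r// => x /andP[xz _].
  have /negbTE -> : ~~ ple k1 (val x) by apply/negP/E/(mB z) => //; left.
  by rewrite mulr0.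
rewrite /zmul; case: xgetP => [y _ ->//|/(_ w)[]].
by move=> k'; rewrite wE !extE.
Qed.

Lemma zfun_prod (s : seq (ZL L)) k : s != [::] ->
  zfun (zprod s) k = \prod_(x <- s) zfun x k.
Proof.
case: s => [//|x s] _ /=; rewrite big_cons.
elim: s x => [|y s IH] x /=; first by rewrite big_nil mulr1.
by rewrite IH zfun_mul big_cons mulrA.
Qed.

(** Inclusion-exclusion: the sum is 1 minus the product of the [1 - zfun p k], the empty subset
    accounting for the 1. With all values 0 or 1, the product vanishes if some value is 1 and is 1
    otherwise. *)
Lemma zfun_join (F : set (ZL L)) k : finite_set F ->
  (forall p, F p -> zfun p k = 0 \/ zfun p k = 1) ->
  zfun (zjoin F) k = `[< exists2 p, F p & zfun p k = 1 >]%:R.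
Proof.
move=> fF F01; rewrite /zjoin zfun_sum.
have sgn (s : seq (ZL L)) : \prod_(x <- s) - zfun x k =
    (-1) ^+ size s * \prod_(x <- s) zfun x k.
  elim: s => [|x s IH]; first by rewrite !big_nil mulr1.
  by rewrite !big_cons IH /= exprS !mulN1r !mulNr mulrCA.
transitivity (1 - \prod_(x <- fset_set F) (1 + - zfun x k)).
  rewrite -sum_fpowerset (bigD1_seq fset0) ?fset_uniq ?fpowersetE ?fsub0set//=.
  rewrite big_seq_fset0 opprD addrA subrr sub0r -sumrN; apply: eq_bigr => B B0.
  have B0' : enum_fset B != [::].
    by apply: contraNN B0 => /eqP B0; rewrite -cardfs_eq0 B0.
  rewrite zfunMz zfun_prod// sgn.
  case E : (size B) B0' => [|n] nB; first by move/size0nil: E nB => ->.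
  by rewrite /= exprS mulN1r mulNr opprK mulrC -mulrzr intz.
case: asboolP => [[p Fp p1]|nF].
  rewrite (bigD1_seq p) ?fset_uniq//= ?in_fset_set ?inE//.
  by rewrite p1 subrr mul0r subr0.
rewrite big_seq_cond big1 ?subrr// => p /andP[]; rewrite in_fset_set// inE => Fp _.
by have [->|p1] := F01 _ Fp; [rewrite subr0 | case: nF; exists p].
Qed.

Definition compl_set (l : L) (FF : set (set L)) : set L :=
  [set k | [/\ k != pbot, ple k l & forall F f, FF F -> F f -> ~ ple k f]].

Lemma zfun_rel_compl l (FF : set (set L)) k : finite_set (\bigcup_(F in FF) F) ->
  (forall F f, FF F -> F f -> ple f l) ->
  zfun (rel_compl l FF) k = `[< compl_set l FF (val k) >]%:R.
Proof.
move=> fFF FFl; rewrite zfunB zfun_genE zfun_join; first last.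
- by move=> p [f _ <-]; rewrite zfun_genE; case: (ple _ _); [right|left].
- exact: finite_image.
case: asboolP => [[p [f [F FFF Ff] <-]]|nF].
  rewrite zfun_genE; case kf: (ple _ _) => // _.
  rewrite (ple_trans HW kf (FFl _ _ FFF Ff)) subrr.
  by case: asboolP => // -[_ _ /(_ _ _ FFF Ff)].
rewrite subr0; case: asboolP => [[_ -> //]|nc]; case: (boolP (ple _ _)) => // kl.
exfalso; apply: nc; split => //; first exact: (valP k).
move=> F f FFF Ff kf; apply: nF; exists (zgen f); last by rewrite zfun_genE kf.
by exists f => //; exists F.
Qed.

End IntegralRingTheory.

Lemma card_le_rem (T : choiceType) (A : set T) (x : T) N :
  (A #<= `I_N.+1)%card -> A x -> ([set y | A y /\ y <> x] #<= `I_N)%card.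
Proof.
move=> AN Ax; have fA := card_le_finite AN (finite_II _).
have := geq_card_fset_set AN; rewrite (cardfsD1 x) in_fset_set// mem_set// add1n ltnS => XN.
have -> : [set y | A y /\ y <> x] = [set` (fset_set A `\ x)%fset].
  apply/seteqP; split=> y /=; rewrite in_fsetD1 in_fset_set//.
    by move=> [Ay /eqP ->]; rewrite mem_set.
  by move=> /andP[/eqP yx /set_mem].
have /card_eq_fsetP E := erefl #|` (fset_set A `\ x)%fset|.
by rewrite (card_le_eql E) card_le_II.
Qed.

(** * Relative complements: supports and presentations *)

Section RelativeComplementsTheory.
Context {S : invSemigroupType} (D : covered_lattice S).
Let R : D -> set (set D) := @cl_covers S D.
Let a : S -> D -> option D := @cl_act S D.
Context (HL : lf_weak_semilattice D) (Ha : lattice_action a)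
  (HR : cover_system R) (HI : invariant_covers a R).
Let HW := HL.1.

Local Notation L1 := (rc_poset D).
Local Notation rc0 := (@pbot L1).
Implicit Types (p q r : L1) (k l m f : D) (F : set D) (FF : set (set D)).

Let Rfin l F : R l F -> finite_set F.
Proof. by have [/(_ l F) H _ _] := HR => /H[]. Qed.

Let Rle l F f : R l F -> F f -> ple f l.
Proof. by have [/(_ l F) H _ _] := HR => /H[_ + _]; apply. Qed.

Let R1 l : R l [set l].
Proof. by have [] := HR. Qed.

Let Rmeets k l F : ple k l -> R l F -> R k (meets_cover k F).
Proof. by have [_ _ H] := HR; exact: H. Qed.

(** [supp p] is the set of nonzero [k] with [k <= p] in [Z L]. *)
Definition supp p : set D := [set k | exists2 x : nonbot, val x = k & zfun (val p) x = 1%R].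

Lemma supp_nbot p k : supp p k -> k != pbot.
Proof. by move=> [x <- _]; exact: (valP x). Qed.

Lemma zfun_rc l FF (x : @nonbot D) : admissible l FF ->
  zfun (rel_compl l FF) x = (`[< compl_set l FF (val x) >]%:R)%R.
Proof.
move=> [_ fFF FFR]; apply: zfun_rel_compl => //.
- by apply: bigcup_finite => // F /FFR /Rfin.
- by move=> F f /FFR; exact: Rle.
Qed.

(** This presents the element 0, which [rc_set] adds separately, so that every element has a
    presentation. *)
Lemma admissible_bot : admissible pbot [set [set pbot : D]].
Proof. by split; [exists [set pbot] | exact: finite_set1 | move=> _ ->; exact: R1]. Qed.

Lemma compl_set_bot : compl_set (pbot : D) [set [set pbot]] = set0.
Proof.
by rewrite -subset0 => k [kb /(ple_eqbot HW) kb' _]; rewrite kb' eqxx in kb.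
Qed.

Lemma rel_compl_eq0 l FF : admissible l FF -> compl_set l FF = set0 ->
  rel_compl l FF = 0%R.
Proof.
move=> ad c0; apply: (zfun_inj HL) => k.
by rewrite zfun_rc// c0 asboolF ?zfun0.
Qed.

Lemma rc_rep p : exists l FF, admissible l FF /\ val p = rel_compl l FF.
Proof.
case: (set_valP p) => [[l [FF [ad ->]]]|/= ->]; first by exists l, FF.
exists pbot, [set [set pbot]]; split; first exact: admissible_bot.
rewrite rel_compl_eq0 ?compl_set_bot//; exact: admissible_bot.
Qed.

Lemma zfun_supp p (k : @nonbot D) : zfun (val p) k = (`[< supp p (val k) >]%:R)%R.
Proof.
have [l [FF [ad E]]] := rc_rep p; rewrite E zfun_rc//; congr ((nat_of_bool _)%:R)%R.
apply: asbool_equiv_eq; split=> [c|[x /val_inj -> ]].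
  by exists k => //; rewrite E zfun_rc// asboolT.
by rewrite E zfun_rc//; case: asboolP.
Qed.

Lemma supp_inj p q : supp p = supp q -> p = q.
Proof.
by move=> pq; apply: val_inj; apply: (zfun_inj HL) => k; rewrite !zfun_supp pq.
Qed.

Lemma finite_supp (A : set (set D)) : finite_set A -> finite_set [set p | A (supp p)].
Proof.
have inj : {in (supp @^-1` A) &, injective supp} by move=> ? ? _ _; exact: supp_inj.
exact: finite_preimage.
Qed.

Lemma supp_rc p l FF : admissible l FF ->
  val p = rel_compl l FF <-> supp p = compl_set l FF.
Proof.
move=> ad; split=> [E|E].
  apply/seteqP; split=> k [].
    by move=> x <-; rewrite E zfun_rc//; case: asboolP.
  move=> kb kl nk; exists (Sub k kb) => //.
  by rewrite E zfun_rc// asboolT.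
by apply: (zfun_inj HL) => k; rewrite zfun_supp zfun_rc// E.
Qed.

Lemma rc_form p : exists l FF, admissible l FF /\ supp p = compl_set l FF.
Proof. by have [l [FF [ad /supp_rc E]]] := rc_rep p; exists l, FF; split=> //; exact: E. Qed.

Lemma rc_mk l FF : admissible l FF -> exists p, supp p = compl_set l FF.
Proof.
move=> ad; have pP : rc_set (rel_compl l FF) by left; exists l, FF.
by exists (exist (fun z => is_true (z \in @rc_set S D)) _ (mem_set pP) : L1); apply/supp_rc.
Qed.

Lemma supp_bot : supp rc0 = set0.
Proof. by rewrite -subset0 => k [x _]; rewrite /= zfun0. Qed.

Lemma supp0 p : supp p = set0 -> p = rc0.
Proof. by move=> p0; apply: supp_inj; rewrite supp_bot. Qed.

Lemma rc_leP p q : ple p q <-> supp p `<=` supp q.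
Proof.
split=> [/eqP pq k [x <- px]|pq].
  have := zfun_mul HL (val p) (val q) x; rewrite pq px zfun_supp mul1r.
  by case: asboolP.
apply/eqP; apply: (zfun_inj HL) => k; rewrite zfun_mul// !zfun_supp -natrM mulnb.
congr ((nat_of_bool _)%:R)%R; apply/andP/idP => [[]//|] /[dup] /asboolP /pq ?.
by split=> //; exact/asboolP.
Qed.

(** Being nonzero and below no [f] passes to larger elements, so any member of the support forces
    [l] to be one. *)
Lemma supp_top p l FF : supp p = compl_set l FF -> p <> rc0 -> supp p l.
Proof.
move=> E; apply: contra_notP => nl; apply: supp0; rewrite -subset0 => k.
rewrite E => -[kb kl nk]; apply: nl; rewrite E; split.
- exact: ple_nbot kl kb.
- exact: ple_refl.
- move=> F f FFF Ff lf; apply: nk FFF Ff _; exact: ple_trans lf.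
Qed.

(** A presentation of a nonzero [p]: the last condition excludes 0 and makes [l] unique, whereas
    [FF] is not. *)
Definition shape p l FF := [/\ admissible l FF, supp p = compl_set l FF & supp p l].

Lemma shape_ex p : p <> rc0 -> exists l FF, shape p l FF.
Proof.
by move=> p0; have [l [FF [ad E]]] := rc_form p; exists l, FF; split=> //; exact: supp_top E p0.
Qed.

Lemma shape_le p l FF k : shape p l FF -> supp p k -> ple k l.
Proof. by move=> [_ -> _] []. Qed.

Lemma supp_convex p l FF n m : supp p = compl_set l FF ->
  supp p n -> ple n m -> ple m l -> supp p m.
Proof.
move=> -> [nb nl nn] nm ml; split=> //; first exact: ple_nbot nm nb.
by move=> F f FFF Ff mf; apply: nn FFF Ff _; exact: ple_trans mf.
Qed.

Lemma shape_nbot p l FF : shape p l FF -> p <> rc0.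
Proof. by move=> [_ _ pl] pb; rewrite pb supp_bot in pl. Qed.

Lemma shape_top_uniq p l FF l' FF' : shape p l FF -> shape p l' FF' -> l = l'.
Proof.
move=> s s'; apply: (ple_anti HW); first by apply: shape_le s' _; case: s.
by apply: shape_le s _; case: s'.
Qed.

(** By [meets_cover_below], an element below [m] avoids [F] iff it avoids the restriction of [F] to
    [m]. In Z L this says that the complement at [m] of the restricted covers is the product of m
    and (l | FF). *)
Lemma compl_set_cut m l FF : admissible l FF -> ple m l ->
  compl_set m (meets_cover m @` FF) = [set k | ple k m] `&` compl_set l FF.
Proof.
move=> [_ _ FFR] ml; apply/seteqP; split=> k.
  move=> [kb km nk]; split=> //; split=> //; first exact: ple_trans ml.
  move=> F f FFF Ff kf; have [|g mg kg] := (meets_cover_below HW (Rfin (FFR _ FFF)) km).1.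
    by exists f.
  by apply: (nk (meets_cover m F) g) => //; exists F.
move=> /= [km [kb kl nk]]; split=> // _ g [F FFF <-] mg kg.
have [|f Ff kf] := (meets_cover_below HW (Rfin (FFR _ FFF)) km).2; first by exists g.
exact: nk FFF Ff kf.
Qed.

Lemma admissible_cut m l FF : admissible l FF -> ple m l ->
  admissible m (meets_cover m @` FF).
Proof.
move=> [[F FFF] fFF FFR] ml; split.
- by exists (meets_cover m F); exists F.
- exact: finite_image.
- by move=> _ [G /FFR RG <-]; exact: Rmeets ml RG.
Qed.

Lemma rc_cut p l FF m : shape p l FF -> ple m l ->
  exists q, supp q = [set k | ple k m] `&` supp p.
Proof.
move=> [ad pE _] ml; rewrite pE -(compl_set_cut ad ml).
by apply: rc_mk; exact: admissible_cut ml.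
Qed.

Definition avoids F : set D := [set k | forall f, F f -> ~ ple k f].

Lemma compl_setU1 l FF F : compl_set l (FF `|` [set F]) = avoids F `&` compl_set l FF.
Proof.
apply/seteqP; split=> k.
  move=> [kb kl nk]; split; last by split=> // G f GG; apply: nk; left.
  by move=> f Ff; apply: nk Ff; right.
by move=> [nF [kb kl nk]]; split=> // G f [GG|->]; [exact: nk GG|exact: nF].
Qed.

Lemma admissibleU1 l FF F : admissible l FF -> R l F -> admissible l (FF `|` [set F]).
Proof.
move=> [[G GG] fFF FFR] RF; split.
- by exists G; left.
- by rewrite finite_setU; split=> //; exact: finite_set1.
- by move=> H [/FFR//|->].
Qed.

Lemma rc_avoid p l FF F : shape p l FF -> R l F ->
  exists q, supp q = avoids F `&` supp p.
Proof.
move=> [ad pE _] RF; rewrite pE -compl_setU1.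
by apply: rc_mk; exact: admissibleU1.
Qed.

(** * Relative complements form a locally finite weak semilattice *)

Lemma rc_pposet : is_pposet L1.
Proof.
split.
- by move=> p; apply/rc_leP.
- by move=> p q /andP[/rc_leP pq /rc_leP qp]; apply: supp_inj; apply/seteqP.
- by move=> q p r /rc_leP pq /rc_leP qr; apply/rc_leP; exact: subset_trans qr.
- by move=> p; apply/rc_leP; rewrite supp_bot.
Qed.

(** [r] is the product [m p q] in [Z L]. *)
Lemma rc_meet_ex p q l FF k GG m : shape p l FF -> shape q k GG -> meets l k m ->
  exists r, supp r = [set x | ple x m] `&` supp p `&` supp q.
Proof.
move=> [[nF fF FR] pE pl] [[nG fG GR] qE qk] /meets_below[ml mk].
have ad1 := admissible_cut (And3 nF fF FR) ml.
have ad2 := admissible_cut (And3 nG fG GR) mk.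
have ad : admissible m (meets_cover m @` FF `|` meets_cover m @` GG).
  split.
  - by case: nF => F FFF; exists (meets_cover m F); left; exists F.
  - by rewrite finite_setU; split; exact: finite_image.
  - by case: ad1 => _ _ ?; case: ad2 => _ _ ?; rewrite subUset.
have [r rE] := rc_mk ad; exists r; rewrite rE.
transitivity (([set x | ple x m] `&` supp p) `&` ([set x | ple x m] `&` supp q)).
  rewrite pE qE -!compl_set_cut//.
  apply/seteqP; split=> x.
    by move=> [xb xm nx]; split; split=> // F f FF'; apply: nx; [left|right].
  by move=> [[xb xm n1] [_ _ n2]]; split=> // F f [/n1|/n2]; exact.
by rewrite setIACA setIid setIA.
Qed.

(** The support of a nonzero common lower bound [r] has a top, which lies below [l] and [k], hence
    below some [m] in [meets l k]; then [r] lies below the product m p q. These finitely many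
    products, together with 0, bound all common lower bounds. *)
Lemma rc_weak_semilattice : weak_semilattice L1.
Proof.
split; first exact: rc_pposet.
move=> p q.
have [->|p0] := pselect (p = rc0).
  exists [set rc0]; split; first exact: finite_set1.
    by move=> _ ->; split; apply/rc_leP; rewrite supp_bot.
  by move=> m [mb _]; exists rc0.
have [->|q0] := pselect (q = rc0).
  exists [set rc0]; split; first exact: finite_set1.
    by move=> _ ->; split; apply/rc_leP; rewrite supp_bot.
  by move=> m [_ mb]; exists rc0.
have [l [FF sp]] := shape_ex p0; have [k [GG sq]] := shape_ex q0.
exists (rc0 |` [set r | exists2 m, meets l k m & supp r = [set x | ple x m] `&` supp p `&` supp q]).
split.
- rewrite finite_setU; split; first exact: finite_set1.
  have /finite_supp := finite_image (fun m => [set x | ple x m] `&` supp p `&` supp q)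
    (meets_finite HW l k).
  by apply: sub_finite_set => r [m lkm rE] /=; exists m.
- move=> r [->|[m _ rE]]; first by split; apply/rc_leP; rewrite supp_bot.
  by split; apply/rc_leP; rewrite rE => x [[]].
- move=> r [/rc_leP rp /rc_leP rq].
  have [->|r0] := pselect (r = rc0); first by exists rc0; [left | apply/rc_leP].
  have [n [HH sr]] := shape_ex r0; have [_ _ rn] := sr.
  have [m lkm nm] := below_meets HW (conj (shape_le sp (rp _ rn)) (shape_le sq (rq _ rn))).
  have [r' r'E] := rc_meet_ex sp sq lkm; exists r'; first by right; exists m.
  apply/rc_leP; rewrite r'E => x rx; split; [split|exact: rq] => /=; last exact: rp.
  exact: ple_trans (shape_le sr rx) nm.
Qed.

Lemma rc_meets p q l FF k GG r : shape p l FF -> shape q k GG -> meets p q r ->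
  r = rc0 \/ exists m, [/\ meets l k m, supp r m &
    supp r = [set x | ple x m] `&` supp p `&` supp q].
Proof.
move=> sp sq [[/rc_leP rp /rc_leP rq] rmax].
have [->|r0] := pselect (r = rc0); [by left|right].
have [n [HH sr]] := shape_ex r0; have [_ _ rn] := sr.
have [m lkm nm] := below_meets HW (conj (shape_le sp (rp _ rn)) (shape_le sq (rq _ rn))).
have [r' r'E] := rc_meet_ex sp sq lkm.
have rr' : ple r r'.
  apply/rc_leP; rewrite r'E => x rx; split; [split|exact: rq] => /=; last exact: rp.
  exact: ple_trans (shape_le sr rx) nm.
have E : r' = r by apply: rmax => //; split; apply/rc_leP; rewrite r'E => x [[]].
subst r'; exists m; split=> //.
(* [n] is in both supports and lies below [m], which lies below both tops; by convexity [m] is in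
   both supports. *)
have [ml mk] := meets_below lkm.
have [_ pE _] := sp; have [_ qE _] := sq.
rewrite r'E; split; first (split; first exact: ple_refl).
- exact: supp_convex pE (rp _ rn) nm ml.
- exact: supp_convex qE (rq _ rn) nm mk.
Qed.

Lemma rc_locally_finite : locally_finite L1.
Proof.
move=> A fA.
pose tops := \bigcup_(p in A) [set l | exists FF, shape p l FF].
have ftops : finite_set tops.
  apply: bigcup_finite => // p _.
  have [[l [FF sp]]|np] := pselect (exists l FF, shape p l FF); last first.
    by rewrite (_ : mkset _ = set0) // -subset0 => l [FF sp]; apply: np; exists l, FF.
  by apply: (sub_finite_set _ (finite_set1 l)) => k [GG sk]; exact: shape_top_uniq sk sp.
have [B [fB topsB clB]] := HL.2 _ ftops.
(* [T l C] is the support of the product of [l] with the members of [C]. With [l] in the closed set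
   [B] and [C] contained in [A] there are finitely many; a nonzero meet replaces the two tops by one
   of their meets and unites the two sets [C]. *)
pose T l (C : {fset L1}) : set D := [set k | ple k l /\ forall c, c \in C -> supp c k].
have fT : finite_set [set T l C | l in B & C in [set` fpowerset (fset_set A)]].
  by apply: finite_image2 => //; exact: finite_fset.
exists (rc0 |` [set p | exists l C, [/\ B l, (C `<=` fset_set A)%fset, supp p l & supp p = T l C]]).
split.
- rewrite finite_setU; split; first exact: finite_set1.
  apply: (sub_finite_set _ (finite_supp fT)) => p [l [C [Bl CA pl pE]]] /=.
  by exists l => //; exists C => //=; rewrite fpowersetE.
- move=> p Ap; have [->|p0] := pselect (p = rc0); [by left|right].
  have [l [FF sp]] := shape_ex p0; exists l, [fset p]%fset; split.
  + by apply: topsB; exists p => //; exists FF.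
  + by rewrite fsub1set in_fset_set// inE.
  + by case: sp.
  + apply/seteqP; split=> k.
      by move=> pk; split=> [|c]; [exact: shape_le sp pk | rewrite inE => /eqP ->].
    by move=> [_]; apply; rewrite inE.
- move=> p q Tp Tq r pqr; have [->|r0] := pselect (r = rc0); [by left|right].
  have [/rc_leP rp /rc_leP rq] := meets_below pqr.
  have neq t : supp r `<=` supp t -> t <> rc0.
    by move=> rt t0; apply: r0; apply: supp0; rewrite -subset0 -supp_bot -t0.
  have [p0 q0] := (neq _ rp, neq _ rq).
  case: Tp => [//|[l [C [Bl CA pl pE]]]]; case: Tq => [//|[k [C' [Bk CA' qk qE]]]].
  have [l' [FF sp]] := shape_ex p0; have [k' [GG sq]] := shape_ex q0.
  have El : l = l'.
    apply: (ple_anti HW); first exact: shape_le sp pl.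
    by case: (sp) => _ _; rewrite pE => -[].
  have Ek : k = k'.
    apply: (ple_anti HW); first exact: shape_le sq qk.
    by case: (sq) => _ _; rewrite qE => -[].
  subst l' k'; case: (rc_meets sp sq pqr) => [//|[m [lkm rm rE]]].
  exists m, (C `|` C')%fset; split=> //; first exact: clB lkm.
    by rewrite fsubUset CA.
  rewrite rE pE qE; apply/seteqP; split=> x.
    move=> [[xm [_ xC]] [_ xC']]; split=> // c; rewrite inE => /orP[]; [exact: xC|exact: xC'].
  have [ml mk] := meets_below lkm.
  move=> [xm xC]; split; [split=> //|]; split.
  + exact: ple_trans ml.
  + by move=> c cC; apply: xC; rewrite inE cC.
  + exact: ple_trans mk.
  + by move=> c cC; apply: xC; rewrite inE cC orbT.
Qed.

Lemma rc_lf : lf_weak_semilattice L1.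
Proof. by split; [exact: rc_weak_semilattice | exact: rc_locally_finite]. Qed.

(** * The action on relative complements *)

Lemma act_mono s k l k' l' : a s k = Some k' -> a s l = Some l' -> ple k' l' = ple k l.
Proof. by have [/(_ s)[_ _ H] _ _ _ _] := Ha; exact: H. Qed.

Lemma act_down s k l l' : a s l = Some l' -> ple k l -> exists2 k', a s k = Some k' & ple k' l'.
Proof.
move=> sl kl; have [/(_ s)[dd _ _] _ _ _ _] := Ha.
have : a s k by apply: dd kl _; rewrite /pdom /= sl.
by case sk: (a s k) => [k'|//] _; exists k' => //; rewrite (act_mono sk sl).
Qed.

Lemma act_up s k' l l' : a s l = Some l' -> ple k' l' -> exists2 k, a s k = Some k' & ple k l.
Proof.
move=> sl kl; have [/(_ s)[_ dr _] _ _ _ _] := Ha.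
have [k sk] : pran (a s) k' by apply: dr kl _; exists l.
by exists k => //; rewrite -(act_mono sk sl).
Qed.

Lemma act_bot s : a s pbot = Some pbot.
Proof. by have [_ + _ _ _] := Ha; apply. Qed.

Lemma act_nbot s k k' : a s k = Some k' -> k != pbot -> k' != pbot.
Proof.
move=> sk; apply: contraNN => /eqP kb; apply/eqP.
by apply: (lact_inj HW Ha sk); rewrite kb act_bot.
Qed.

Lemma act_sinvE s k l : a s k = Some l <-> a (sinv s) l = Some k.
Proof.
by split=> [|/(lact_sinv HW Ha)]; [exact: lact_sinv | rewrite sinvK].
Qed.

Lemma pimage_compl_set s l k FF : a s l = Some k -> (forall F f, FF F -> F f -> ple f l) ->
  pimage (a s) (compl_set l FF) = compl_set k (pimage (a s) @` FF).
Proof.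
move=> sl FFl; apply/seteqP; split=> y.
  move=> [x [xb xl nx] sx]; split.
  - exact: act_nbot sx xb.
  - by rewrite (act_mono sx sl).
  - move=> _ g [F FFF <-] [f Ff sf] yg; apply: nx FFF Ff _.
    by rewrite -(act_mono sx sf).
move=> [yb yk ny]; have [x sx xl] := act_up sl yk; exists x => //; split=> //.
- by apply: contraNN yb => /eqP xb; move: sx; rewrite xb act_bot => -[<-].
- move=> F f FFF Ff xf; have [f' sf _] := act_down sl (FFl _ _ FFF Ff).
  apply: (ny (pimage (a s) F) f'); [by exists F|by exists f|].
  by rewrite (act_mono sx sf).
Qed.

Lemma admissible_act s l k FF : a s l = Some k -> admissible l FF ->
  admissible k (pimage (a s) @` FF).
Proof.
move=> sl [[F FFF] fFF FFR]; split.
- by exists (pimage (a s) F); exists F.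
- exact: finite_image.
- by move=> _ [G /FFR RG <-]; exact: HI RG.
Qed.

Lemma supp_dom s p l FF : shape p l FF -> supp p `<=` pdom (a s) <-> a s l.
Proof.
move=> sp; split=> [d|sl k pk]; first by case: sp => _ _ /d.
move: sl; case sl: (a s l) => [l'|//] _.
by have [k' sk _] := act_down sl (shape_le sp pk); rewrite /pdom /= sk.
Qed.

(** On supports the action is transport by [s], which shows independence of the presentation and
    makes the laws of an action set-theoretic. *)
Lemma rc_act_relP s p q : rc_act_rel s p q <->
  supp p `<=` pdom (a s) /\ supp q = pimage (a s) (supp p).
Proof.
split=> [[l [k [FF [ad pE sl qE]]]]|[pd qE]].
  have FFl F f : FF F -> F f -> ple f l by case: ad => _ _ H /H; exact: Rle.
  move/supp_rc: pE => /(_ ad) pE; move/supp_rc: qE => /(_ (admissible_act sl ad)) ->.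
  rewrite pE (pimage_compl_set sl)//; split=> // x [_ xl _].
  by have [x' sx _] := act_down sl xl; rewrite /pdom /= sx.
(* For [p = rc0] the domain condition is vacuous, so the presentation at [pbot] is used, which every
   [s] fixes. *)
have [p0|p0] := pselect (p = rc0).
  exists pbot, pbot, [set [set pbot]]; split.
  - exact: admissible_bot.
  - by apply/supp_rc; [exact: admissible_bot | rewrite p0 supp_bot compl_set_bot].
  - exact: act_bot.
  - have ad := admissible_act (act_bot s) admissible_bot.
    apply/supp_rc => //; rewrite qE p0 supp_bot -(pimage_compl_set (act_bot s)).
      by rewrite compl_set_bot.
    by move=> F f -> ->; exact: ple_refl.
have [l [FF sp]] := shape_ex p0; have /(supp_dom s sp) := pd.
case sl: (a s l) => [k|//] _; have [ad pE _] := sp.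
exists l, k, FF; split=> //; first exact/supp_rc.
apply/supp_rc; first exact: (admissible_act sl ad).
by rewrite qE pE; apply: (pimage_compl_set sl) => F f; case: ad => _ _ H /H; exact: Rle.
Qed.

Lemma rc_actP s p q : rc_act s p = Some q <->
  supp p `<=` pdom (a s) /\ supp q = pimage (a s) (supp p).
Proof.
rewrite -rc_act_relP /rc_act; case: pselect => [H|H]; last first.
  by split=> // H'; case: H; exists q.
case: cid => q' /= H'; split=> [[<-]//|]; move: H' => /rc_act_relP[_ q'E].
by move=> /rc_act_relP[_ qE]; congr Some; apply: supp_inj; rewrite qE.
Qed.

Lemma rc_act_ex s p : supp p `<=` pdom (a s) -> exists q, rc_act s p = Some q.
Proof.
move=> pd; suff [q qE] : exists q, supp q = pimage (a s) (supp p).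
  by exists q; apply/rc_actP.
have [p0|p0] := pselect (p = rc0).
  by exists rc0; rewrite p0 supp_bot; apply/esym; rewrite -subset0 => x [].
have [l [FF sp]] := shape_ex p0; have /(supp_dom s sp) := pd.
case sl: (a s l) => [k|//] _; have [ad pE _] := sp.
have [q qE] := rc_mk (admissible_act sl ad); exists q.
by rewrite qE pE (pimage_compl_set sl)// => F f; case: ad => _ _ H /H; exact: Rle.
Qed.

Lemma pimage_sinv s (A : set D) : A `<=` pdom (a s) -> pimage (a (sinv s)) (pimage (a s) A) = A.
Proof.
move=> Ad; apply/seteqP; split=> x.
  by move=> [y [z Az /(lact_sinv HW Ha)]] -> [<-].
move=> Ax; move: (Ad _ Ax); rewrite /pdom /=; case sx: (a s x) => [y|//] _.
by exists y; [exists x | exact: lact_sinv].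
Qed.

Lemma rc_act_sinv s p q : rc_act s p = Some q -> rc_act (sinv s) q = Some p.
Proof.
move=> /rc_actP[pd qE]; apply/rc_actP; rewrite qE pimage_sinv//; split=> //.
by move=> y [x _ /act_sinvE]; rewrite /pdom /= => ->.
Qed.

Lemma rc_lattice_action : lattice_action (@rc_act S D).
Proof.
have dd s : downward_closed (pdom (@rc_act S D s)).
  move=> p q /rc_leP pq; rewrite /pdom /=; case sq: (rc_act s q) => [q'|//] _.
  have [qd _] := (rc_actP _ _ _).1 sq.
  by have [p' ->] := rc_act_ex (subset_trans pq qd).
split.
- move=> s; split; first exact: dd.
  + move=> p q pq [q' /rc_act_sinv sq].
    have : rc_act (sinv s) p by apply: (dd (sinv s)) pq _; rewrite /pdom /= sq.
    case sp: (rc_act _ p) => [p'|//] _; exists p'.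
    by have := rc_act_sinv sp; rewrite sinvK.
  + move=> p q p' q' sp sq.
    have H t (x y x' y' : L1) : rc_act t x = Some x' ->
        rc_act t y = Some y' -> ple x y -> ple x' y'.
      move=> /rc_actP[_ xE] /rc_actP[_ yE] /rc_leP xy; apply/rc_leP; rewrite xE yE.
      by move=> z [w /xy yw tw]; exists w.
    apply/idP/idP; last exact: H sp sq.
    by apply: (H (sinv s)); exact: rc_act_sinv.
- move=> s; apply/rc_actP; rewrite supp_bot; split=> //.
  by apply/esym; rewrite -subset0 => x [].
- have [_ _ M _ _] := Ha.
  move=> s t p; case tp: (rc_act t p) => [q|] /=.
    have [pd qE] := (rc_actP _ _ _).1 tp.
    case sq: (rc_act s q) => [r|].
      have [qd rE] := (rc_actP _ _ _).1 sq.
      apply/rc_actP; split.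
        move=> x px; have := pd _ px; rewrite /pdom /= M; case tx: (a t x) => [y|//] _ /=.
        by apply: qd; rewrite qE; exists x.
      rewrite rE qE; apply/seteqP; split=> z.
        by move=> [y [x px tx] sy]; exists x => //; rewrite M tx.
      move=> [x px]; rewrite M; case tx: (a t x) => [y|//] /= sy.
      by exists y => //; exists x.
    case stp: (rc_act (s * t)%g p) => [r|//].
    have [pd' _] := (rc_actP _ _ _).1 stp.
    have [|r' E] := rc_act_ex (s := s) (p := q); last by rewrite E in sq.
    rewrite qE => y [x px tx]; have := pd' _ px; rewrite /pdom /= M tx //.
  case stp: (rc_act (s * t)%g p) => [r|//].
  have [pd' _] := (rc_actP _ _ _).1 stp.
  have [|r' E] := rc_act_ex (s := t) (p := p); last by rewrite E in tp.
  by move=> x /pd'; rewrite /pdom /= M; case: (a t x).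
- have [_ _ _ a0 _] := Ha => p p0.
  case E: (rc_act _ p) => [q|//]; have [pd _] := (rc_actP _ _ _).1 E.
  have [l [FF [_ _ pl]]] := shape_ex p0; have := pd _ pl.
  by rewrite /pdom /= a0//; apply/eqP; exact: supp_nbot pl.
- have [_ _ _ _ cov] := Ha => p p0.
  have [l [FF sp]] := shape_ex p0; have [_ _ pl] := sp.
  have [|s sl] := cov l; first by apply/eqP; exact: supp_nbot pl.
  by exists s; have [|q ->] := rc_act_ex (s := s) (p := p); first exact/(supp_dom s sp).
Qed.

(** * The covers of relative complements *)

Definition rc_precover p F : set L1 :=
  [set q | supp q = avoids F `&` supp p \/
    exists2 f, F f & supp q = [set x | ple x f] `&` supp p].

(** On supports the cover depends on [p] and [F] alone; of the presentation only the top [l]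
    remains, in the condition [R l F]. *)
Lemma rc_coverE p l FF F : shape p l FF -> R l F ->
  rc_cover l FF F = maximals (rc_precover p F).
Proof.
move=> [ad pE _] RF; congr maximals; apply/seteqP; split=> q.
  case=> [/(supp_rc _ (admissibleU1 ad RF)) qE|[f Ff]].
    by left; rewrite qE compl_setU1 pE.
  have fl := Rle RF Ff.
  move=> /(supp_rc _ (admissible_cut ad fl)) qE; right; exists f => //.
  by rewrite qE (compl_set_cut ad fl) pE.
case=> [qE|[f Ff qE]].
  by left; apply/(supp_rc _ (admissibleU1 ad RF)); rewrite compl_setU1 -pE.
have fl := Rle RF Ff; right; exists f => //.
by apply/(supp_rc _ (admissible_cut ad fl)); rewrite (compl_set_cut ad fl) -pE.
Qed.

(** All presentations of a nonzero [p] have the same top, so the existential over presentations in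
    [rc_covers] may be evaluated at any given one. *)
Lemma rc_coversP p l FF C : shape p l FF ->
  rc_covers p C <-> exists2 F, R l F & C = maximals (rc_precover p F).
Proof.
move=> sp; have p0 := shape_nbot sp; split.
  case=> [[//]|[_ [l' [GG [F [ad /(supp_rc _ ad) pE RF ->]]]]]].
  have sp' : shape p l' GG by split=> //; exact: supp_top pE p0.
  have ll' := shape_top_uniq sp sp'; subst l'.
  by exists F => //; exact: rc_coverE.
move=> [F RF ->]; right; split=> //; exists l, FF, F; have [ad pE _] := sp.
by rewrite (rc_coverE sp RF); split=> //; apply/(supp_rc _ ad).
Qed.

Lemma rc_covers_bot C : rc_covers rc0 C <-> C = [set rc0].
Proof. by split=> [[[_ ->]|[]]//|->]; left. Qed.

Lemma rc_precover_finite p F : finite_set F -> finite_set (rc_precover p F).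
Proof.
move=> fF; pose g f := [set x | ple x f] `&` supp p.
have fA : finite_set ((avoids F `&` supp p) |` g @` F).
  by rewrite finite_setU; split; [exact: finite_set1 | exact: finite_image].
apply: (sub_finite_set _ (finite_supp fA)) => q [qE|[f Ff qE]] /=; first by left.
by right; exists f.
Qed.

Lemma rc_precover_le p F q : rc_precover p F q -> supp q `<=` supp p.
Proof. by case=> [->|[f _ ->]] x []. Qed.

Lemma shape_mem p l FF : shape p l FF -> supp p l.
Proof. by case. Qed.

(** A nonzero [x] below [p], with top [n], meets the cover. If [n] lies below some [f] in [F], then
    [x] is below the part of [p] under [f]. Otherwise the part of [x] avoiding [F] contains [n], so
    it is nonzero, and it lies below the part of [p] avoiding [F]. *)
Lemma rc_cover_finite_cover p l FF F : shape p l FF -> R l F ->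
  finite_cover p (maximals (rc_precover p F)).
Proof.
move=> sp RF; have fP := rc_precover_finite p (Rfin RF); split.
- exact: maximals_finite.
- by move=> q [/rc_precover_le qp _]; apply/rc_leP.
- move=> q qC x [xq /rc_leP xp].
  have qpre c y : rc_precover p F c -> ple y q -> ple y c -> y = rc0.
    move=> Pc yq yc; have [d Cd cd] := maximals_below rc_weak_semilattice fP Pc.
    by apply: (qC d) => //; split=> //; exact: (ple_trans rc_weak_semilattice) cd.
  have [//|x0] := pselect (x = rc0); exfalso.
  have [n [HH sx]] := shape_ex x0; have xn := shape_mem sx.
  have nl := shape_le sp (xp _ xn).
  have [[f Ff nf]|nf] := pselect (exists2 f, F f & ple n f).
    have [c cE] := rc_cut sp (Rle RF Ff); apply: x0; apply: (qpre c) => //.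
      by right; exists f.
    apply/rc_leP; rewrite cE => z xz; split; last exact: xp.
    exact: (ple_trans HW) (shape_le sx xz) nf.
  have [y yE] := rc_avoid sx (Rmeets nl RF).
  have [c cE] := rc_avoid sp RF.
  have yn : supp y n.
    rewrite yE; split=> // g gF ng; apply: nf.
    by apply/(meets_cover_below HW (Rfin RF) (ple_refl HW n)); exists g.
  suff y0 : y = rc0 by rewrite y0 supp_bot in yn.
  have yx : supp y `<=` supp x by rewrite yE => z [].
  apply: (qpre c); first by left.
    by apply: (ple_trans rc_weak_semilattice) xq; apply/rc_leP.
  apply/rc_leP; rewrite cE => z yz; split; last exact/xp/yx.
  move=> f Ff zf; have zn := shape_le sx (yx _ yz); move: yz; rewrite yE => -[zy _].
  have [|g gF zg] := (meets_cover_below HW (Rfin RF) zn).1; first by exists f.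
  exact: zy gF zg.
Qed.

(** If [l] is in [F], the part under [l] is [p]; if [F] is in [FF], the part avoiding [F] is [p].
    The second case makes the number of nontrivial covers drop. *)
Lemma rc_precover_trivial p l FF F : shape p l FF -> F l \/ FF F ->
  maximals (rc_precover p F) p.
Proof.
move=> sp lF; split.
  case: lF => [Fl|FFF].
    right; exists l => //; apply/seteqP; split=> [k pk|k []//].
    by split=> //; exact: shape_le sp pk.
  left; apply/seteqP; split=> [k pk|k []//]; split=> //.
  by move=> f Ff; case: sp pk => _ -> _ [_ _ nk]; exact: nk Ff.
move=> q /rc_precover_le qp /rc_leP pq.
by apply: supp_inj; apply/seteqP; split.
Qed.

Lemma avoids_meets_cover k F z : finite_set F -> ple z k ->
  avoids F z <-> avoids (meets_cover k F) z.
Proof.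
move=> fF zk; split=> nz f Ff zf.
  have [|g Fg zg] := (meets_cover_below HW fF zk).2; first by exists f.
  exact: nz Fg zg.
have [|g Fg zg] := (meets_cover_below HW fF zk).1; first by exists f.
exact: nz Fg zg.
Qed.

(** Mutual cofinality in the sense of [maximals_eq]. Below [k], avoiding [F] and avoiding its
    restriction agree; an [x] below [q] and under [f] has its top below some [g] in
    [meets_cover k F], hence lies under [g]. *)
Lemma rc_cover_restrict p l FF F q k GG : shape p l FF -> R l F -> shape q k GG ->
  ple q p -> meets_cover q (maximals (rc_precover p F)) =
    maximals (rc_precover q (meets_cover k F)).
Proof.
move=> sp RF sq qp; have W1 := rc_weak_semilattice.
have qp' := (rc_leP _ _).1 qp; have kl := shape_le sp (qp' _ (shape_mem sq)).
have fF := Rfin RF; have RkF := Rmeets kl RF; have fP := rc_precover_finite p fF.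
apply: (maximals_eq W1).
- by apply: bigcup_finite; [exact: maximals_finite|move=> *; exact: meets_finite].
- by apply: rc_precover_finite; exact: Rfin RkF.
- move=> x [c [Pc _] /meets_below[/rc_leP xq /rc_leP xc]].
  have [y yE] := rc_avoid sq RkF.
  case: Pc => [cE|[f Ff cE]].
    exists y; first by left.
    apply/rc_leP; rewrite yE => z xz; split; last exact: xq.
    apply/(avoids_meets_cover fF (shape_le sq (xq _ xz))).
    by move: (xc _ xz); rewrite cE => -[].
  have [->|x0] := pselect (x = rc0).
    by exists y; [left|apply/rc_leP; rewrite supp_bot].
  have [n [HH sx]] := shape_ex x0; have xn := shape_mem sx.
  have nk := shape_le sq (xq _ xn).
  have [|g Fg ng] := (meets_cover_below HW fF nk).1.
    by exists f => //; move: (xc _ xn); rewrite cE => -[].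
  have [w wE] := rc_cut sq (meets_cover_le Fg).
  exists w; first by right; exists g.
  apply/rc_leP; rewrite wE => z xz; split; last exact: xq.
  exact: (ple_trans HW) (shape_le sx xz) ng.
- move=> y Py; have yq := rc_precover_le Py.
  suff [c Pc yc] : exists2 c, rc_precover p F c & ple y c.
    have [d Cd cd] := maximals_below W1 fP Pc.
    have [|m qdm ym] := below_meets W1 (k := q) (l := d) (x := y).
      by split; [apply/rc_leP|exact: (ple_trans W1) cd].
    by exists m => //; exists d.
  case: Py => [yE|[g Fg yE]].
    have [c cE] := rc_avoid sp RF; exists c; first by left.
    apply/rc_leP; rewrite cE => z yz; split; last exact/qp'/yq.
    apply/(avoids_meets_cover fF (shape_le sq (yq _ yz))).
    by move: yz; rewrite yE => -[].
  have [[f Ff /meets_below[_ gf]] _] := Fg.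
  have [c cE] := rc_cut sp (Rle RF Ff); exists c; first by right; exists f.
  apply/rc_leP; rewrite cE => z yz; split; last exact/qp'/yq.
  by move: yz; rewrite yE => -[zg _]; exact: (ple_trans HW) zg gf.
Qed.

Lemma rc_cover_system : cover_system (@rc_covers S D).
Proof.
have W1 := rc_weak_semilattice.
have cases p C : rc_covers p C -> (p = rc0 /\ C = [set rc0]) \/
    exists l FF F, [/\ shape p l FF, R l F & C = maximals (rc_precover p F)].
  have [->|p0] := pselect (p = rc0); first by move=> /rc_covers_bot; left.
  by have [l [FF sp]] := shape_ex p0; move=> /(rc_coversP _ sp)[F RF CE]; right; exists l, FF, F.
have fin p C : rc_covers p C -> finite_cover p C.
  move=> /cases[[-> ->]|[l [FF [F [sp RF ->]]]]]; last exact: rc_cover_finite_cover sp RF.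
  split; first exact: finite_set1.
    by move=> _ ->; exact: ple_refl.
  by move=> q _ x [_ xb]; exact: (ple_eqbot W1).
split=> //.
- move=> p; have [->|p0] := pselect (p = rc0); first exact/rc_covers_bot.
  have [l [FF sp]] := shape_ex p0; apply/(rc_coversP _ sp); exists [set l]; first exact: R1.
  have P1 := rc_precover_trivial sp (or_introl (erefl : [set l] l)).
  apply/seteqP; split=> [_ ->//|q Mq].
  have [Pq qmax] := Mq; have [Pp pmax] := P1.
  suff pq : p = q by rewrite pq.
  by apply: qmax => //; apply/rc_leP/rc_precover_le; exact: Pq.
- move=> q p C qp pC.
  have [->|q0] := pselect (q = rc0).
    (* [C] must be nonempty for its restriction to 0 to be [[set rc0]] rather than the empty set;
       the part avoiding [F] always provides a member. *)
    apply/rc_covers_bot; have [c Cc] : C !=set0.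
      move: pC => /cases[[_ ->]|[l [FF [F [sp RF ->]]]]]; first by exists rc0.
      have [c cE] := rc_avoid sp RF.
      have [|m Mm _] := maximals_below W1 (rc_precover_finite p (Rfin RF)) (a := c); first by left.
      by exists m.
    have E d : meets rc0 d = [set rc0].
      apply/seteqP; split=> [x /meets_below[xb _]|_ ->]; first exact: (ple_eqbot W1).
      split; first by split; exact: ple_bot.
      by move=> x [xb _] _; exact: (ple_eqbot W1).
    rewrite /meets_cover (_ : \bigcup_(f in C) _ = [set rc0]).
      by apply/seteqP; split=> [x []//|_ ->]; split=> // x ->.
    by apply/seteqP; split=> [x [d _]|_ ->]; [rewrite E|exists c => //; rewrite E].
  move: pC => /cases[[pb _]|[l [FF [F [sp RF ->]]]]].
    by case: q0; apply: (ple_eqbot W1); rewrite -pb.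
  have [k [GG sq]] := shape_ex q0.
  rewrite (rc_cover_restrict sp RF sq qp); apply/(rc_coversP _ sq).
  exists (meets_cover k F) => //; apply: Rmeets RF; apply: shape_le sp _.
  by apply: (rc_leP _ _).1 qp _ (shape_mem sq).
Qed.

Lemma rc_precover_act s p q F x y : F `<=` pdom (a s) -> rc_act s p = Some q ->
  rc_act s x = Some y -> rc_precover p F x -> rc_precover q (pimage (a s) F) y.
Proof.
move=> Fd /rc_actP[pd qE] /rc_actP[xd yE] [xE|[f Ff xE]].
  left; rewrite yE qE xE; apply/seteqP; split=> z.
    move=> [w [wF pw] sw]; split; last by exists w.
    by move=> g [f Ff sf] zg; apply: (wF f) => //; rewrite -(act_mono sw sf).
  move=> [zF [w pw sw]]; exists w => //; split=> // f Ff wf.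
  move: (Fd _ Ff); rewrite /pdom /=; case sf: (a s f) => [g|//] _.
  by apply: (zF g); [exists f|rewrite (act_mono sw sf)].
move: (Fd _ Ff); rewrite /pdom /=; case sf: (a s f) => [g|//] _.
right; exists g; first by exists f.
rewrite yE qE xE; apply/seteqP; split=> z.
  by move=> [w [wf pw] sw]; split; [rewrite /= (act_mono sw sf)|exists w].
by move=> [zg [w pw sw]]; exists w => //; split=> //=; rewrite -(act_mono sw sf).
Qed.

Lemma rc_invariant_covers : invariant_covers (@rc_act S D) (@rc_covers S D).
Proof.
move=> s p q C sp; have [pd qE] := (rc_actP _ _ _).1 sp.
have Ha1 := rc_lattice_action.
have [pb|p0] := pselect (p = rc0).
  subst p; move=> /rc_covers_bot ->.
  have qb : q = rc0 by move: sp; have [_ -> _ _ _] := Ha1 => -[].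
  subst q; apply/rc_covers_bot; apply/seteqP; split=> [x [_ ->]|_ ->].
    by rewrite sp => -[].
  by exists rc0.
have [l [FF shp]] := shape_ex p0; move=> /(rc_coversP _ shp)[F RF ->].
have /(supp_dom s shp) := pd; case sl: (a s l) => [k|//] _.
have [ad pE pl] := shp.
have FFl G g : FF G -> G g -> ple g l by case: ad => _ _ H /H; exact: Rle.
have shq : shape q k (pimage (a s) @` FF).
  split; first exact: admissible_act ad.
    by rewrite qE pE (pimage_compl_set sl).
  by rewrite qE; exists l.
have Fd : F `<=` pdom (a s).
  by move=> f Ff; have [f' sf _] := act_down sl (Rle RF Ff); rewrite /pdom /= sf.
apply/(rc_coversP _ shq); exists (pimage (a s) F); first exact: HI sl RF.
have mono (x y x' y' : L1) : rc_act s x = Some x' -> rc_act s y = Some y' -> ple x' y' = ple x y.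
  by have [/(_ s)[_ _ H] _ _ _ _] := Ha1; exact: H.
have fwd x y : rc_act s x = Some y -> rc_precover p F x -> rc_precover q (pimage (a s) F) y.
  by move=> sx; exact: rc_precover_act sx.
have F'd : pimage (a s) F `<=` pdom (a (sinv s)).
  by move=> g [f _ /(lact_sinv HW Ha) sg]; rewrite /pdom /= sg.
have bwd x y : rc_act s x = Some y -> rc_precover q (pimage (a s) F) y -> rc_precover p F x.
  move=> /rc_act_sinv sx /(rc_precover_act F'd (rc_act_sinv sp) sx).
  by rewrite pimage_sinv.
have act_pre x : rc_precover p F x -> exists y, rc_act s x = Some y.
  by move=> /rc_precover_le xp; apply: rc_act_ex; exact: subset_trans xp pd.
have act_pre' y : rc_precover q (pimage (a s) F) y -> exists x, rc_act s x = Some y.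
  move=> /rc_precover_le yq; have [_ qd] := (rc_actP _ _ _).1 (rc_act_sinv sp).
  have [|x sx] := rc_act_ex (s := sinv s) (p := y).
    move=> z /yq; rewrite qE => -[w _ /(lact_sinv HW Ha) sw].
    by rewrite /pdom /= sw.
  by exists x; have := rc_act_sinv sx; rewrite sinvK.
apply/seteqP; split=> y.
  move=> [x [Px xmax] sx]; split; first exact: fwd sx Px.
  move=> y' Py' yy'; have [x' sx'] := act_pre' _ Py'.
  have x'x : x' = x by apply: xmax; [exact: bwd sx' Py'|rewrite -(mono _ _ _ _ sx sx')].
  by move: sx'; rewrite x'x sx => -[].
move=> [Py ymax]; have [x sx] := act_pre' _ Py; exists x => //; split; first exact: bwd sx Py.
move=> x' Px' xx'; have [y' sx'] := act_pre _ Px'.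
have y'y : y' = y by apply: ymax; [exact: fwd sx' Px'|rewrite (mono _ _ _ _ sx sx')].
by subst y'; exact: (@lact_inj S L1 (@rc_act S D) rc_weak_semilattice Ha1 s x' x y sx' sx).
Qed.

(** * Semilattices, and the number of nontrivial covers *)

Lemma rc_semilattice : semilattice D -> semilattice L1.
Proof.
move=> [_ meetL]; split; first exact: rc_pposet.
move=> p q.
have lb0 r t : lower_bounds2 r t rc0 by split; exact: (ple_bot rc_weak_semilattice).
have [->|p0] := pselect (p = rc0); first by exists rc0 => // x [].
have [->|q0] := pselect (q = rc0); first by exists rc0 => // x [].
have [l [FF sp]] := shape_ex p0; have [k [GG sq]] := shape_ex q0.
have [m lkm mmax] := meetL l k.
have [|r rE] := rc_meet_ex (m := m) sp sq.
  by split=> // x /mmax xm mx; exact: ple_anti.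
exists r; first by split; apply/rc_leP; rewrite rE => x [[]].
move=> x [/rc_leP xp /rc_leP xq]; apply/rc_leP; rewrite rE => z xz.
have x0 : x <> rc0 by move=> xb; rewrite xb supp_bot in xz.
have [n [HH sx]] := shape_ex x0; have xn := shape_mem sx.
split; [split|exact: xq] => /=; last exact: xp.
apply: (ple_trans HW) (shape_le sx xz) _; apply: mmax.
by split; [exact: shape_le sp (xp _ xn)|exact: shape_le sq (xq _ xn)].
Qed.

(** A member [F0] of [FF] is nontrivial, since [l] is in the support, but it induces a trivial cover
    of [p]. So the nontrivial covers of [p] are induced by nontrivial covers of [l] other than
    [F0]. *)
Lemma nontrivial_covers_rc N : (forall l, nontrivial_covers R l #<= `I_N.+1)%card ->
  (forall p, nontrivial_covers (@rc_covers S D) p #<= `I_N)%card.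
Proof.
move=> RN p; have [->|p0] := pselect (p = rc0).
  rewrite (_ : nontrivial_covers _ _ = set0) ?card_le0x//.
  by rewrite -subset0 => C [/rc_covers_bot ->]; apply.
have [l [FF sp]] := shape_ex p0; have [[[F0 FF0] _ FFR] pE pl] := sp.
have nF0 : nontrivial_covers R l F0.
  split; first exact: FFR.
  by move=> F0l; move: pl; rewrite pE => -[_ _ /(_ _ _ FF0 F0l)]; apply; exact: ple_refl.
pose B := [set F | nontrivial_covers R l F /\ F <> F0].
apply: (@card_le_trans _ _ _ B).
  apply: (@card_le_trans _ _ _ ((fun F => maximals (rc_precover p F)) @` B)).
    apply: subset_card_le => C [/(rc_coversP _ sp)[F RF ->] nC].
    exists F => //; split; [split=> //|].
      by move=> Fl; apply: nC; apply: (rc_precover_trivial sp); left.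
    by move=> FF0'; apply: nC; apply: (rc_precover_trivial sp); right; rewrite FF0'.
  exact: card_image_le.
exact: card_le_rem.
Qed.

(** The presentation of a nonzero element contains a nontrivial cover. *)
Lemma trivial_rc : (forall l, nontrivial_covers R l #<= `I_0)%card -> forall p, p = rc0.
Proof.
move=> R0 p; apply: contrapT => p0.
have [l [FF sp]] := shape_ex p0; have [[[F0 FF0] _ FFR] pE pl] := sp.
move: (R0 l); rewrite II0 card_le0 => /eqP; apply/eqP/set0P; exists F0.
split; first exact: FFR.
by move=> F0l; move: pl; rewrite pE => -[_ _ /(_ _ _ FF0 F0l)]; apply; exact: ple_refl.
Qed.

Lemma trivial_rc_trivial : (forall l : D, l = pbot) -> forall p, p = rc0.
Proof.
move=> D0 p; apply: supp0; rewrite -subset0 => k /supp_nbot.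
by rewrite (D0 k) eqxx.
Qed.

End RelativeComplementsTheory.

(** * The topology of the spectrum *)

Section SpectrumTopology.
Context {L : pposet}.
Implicit Types (chi psi : spectrum L) (l k : L).

Lemma spectrum_cvg (F : set_system (spectrum L)) chi : Filter F ->
  (forall l, F [set psi | spectrum_fun psi l = spectrum_fun chi l]) -> F --> chi.
Proof.
move=> FF H V; rewrite nbhsE => -[_ [[W oW <-] Wchi] WV].
apply: filterS WV _.
have : fmap (fun psi : spectrum L => val psi : {ptws L -> bool}) F --> (val chi : {ptws L -> bool}).
  apply/cvg_sup => l A; rewrite nbhsE => -[_ [[B oB <-] Bchi] BA].
  suff : F [set psi : spectrum L | A (val psi)] by [].
  apply: filterS (H l) => psi /= E; apply: BA.
  by rewrite -[_ (val psi)]/(B (spectrum_fun psi l)) E.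
by apply; apply: open_nbhs_nbhs.
Qed.

Lemma spectrum_fun_continuous l : continuous (fun chi => spectrum_fun chi l).
Proof.
move=> chi; apply: (@continuous_comp _ _ _ (fun chi => val chi : {ptws L -> bool}) (fun f => f l)).
  exact: initial_continuous.
exact: (@proj_continuous L (fun=> bool) l).
Qed.

Lemma open_spectrum_fun l (b : bool) : open [set chi | spectrum_fun chi l = b].
Proof.
have /continuousP cl := @spectrum_fun_continuous l.
by apply: (cl [set b]); exact: discrete_open.
Qed.

Lemma spectrum_nbhs chi (s : seq L) (V : set (spectrum L)) :
  (forall psi, (forall l, l \in s -> spectrum_fun psi l = spectrum_fun chi l) -> V psi) ->
  nbhs chi V.
Proof.
elim: s V => [|l s IH] V H; first by apply: (filterS (P := setT)) => [psi _|];
    [exact: H|exact: filterT].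
have /IH H1 : forall psi, (forall k, k \in s -> spectrum_fun psi k = spectrum_fun chi k) ->
    (spectrum_fun psi l = spectrum_fun chi l -> V psi).
  by move=> psi E El; apply: H => k; rewrite inE => /orP[/eqP ->|/E].
have H2 : nbhs chi [set psi | spectrum_fun psi l = spectrum_fun chi l].
  by apply: open_nbhs_nbhs; split=> //; exact: open_spectrum_fun.
by apply: filterS2 H1 H2 => psi; apply.
Qed.

Context (HL : weak_semilattice L).

Lemma spectrum_mono chi k l : ple k l -> spectrum_fun chi k -> spectrum_fun chi l.
Proof. exact: (character_mono HL (spectrumP chi)). Qed.

Lemma spectrum_meets chi k l : spectrum_fun chi k -> spectrum_fun chi l ->
  exists2 m, meets k l m & spectrum_fun chi m.
Proof. by move=> ck cl; have [_ _ M] := spectrumP chi; apply/M. Qed.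

Lemma spectrum_bot chi : spectrum_fun chi pbot = false.
Proof. by have [] := spectrumP chi. Qed.

Lemma spectrum_ex chi : exists l, spectrum_fun chi l.
Proof. by have [] := spectrumP chi. Qed.

(** Characters are filters, so finitely many positive conditions follow from a single one. The sets
    [B ls] are thus a filter base, and the filter converges to [chi] because it decides each
    value. *)
Lemma spectrum_basis chi (V : set (spectrum L)) : nbhs chi V ->
  exists l (s : seq L), [/\ spectrum_fun chi l, forall k, k \in s -> ~~ spectrum_fun chi k &
    forall psi, spectrum_fun psi l -> (forall k, k \in s -> ~~ spectrum_fun psi k) -> V psi].
Proof.
pose D := [set ls : L * seq L | spectrum_fun chi ls.1 /\
  forall k, k \in ls.2 -> ~~ spectrum_fun chi k].
pose B (ls : L * seq L) := [set psi | spectrum_fun psi ls.1 /\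
  forall k, k \in ls.2 -> ~~ spectrum_fun psi k].
have FF : Filter (filter_from D B).
  apply: filter_from_filter; first by have [l cl] := spectrum_ex chi; exists (l, [::]).
  move=> [l s] [k t] [/= cl cs] [/= ck ct]; have [m mkl cm] := spectrum_meets cl ck.
  have [ml mk] := meets_below mkl.
  exists (m, s ++ t); first by split=> //= x; rewrite mem_cat => /orP[/cs|/ct].
  move=> psi [/= pm pst]; split; split=> /=.
  - exact: spectrum_mono pm.
  - by move=> x xs; apply: pst; rewrite mem_cat xs.
  - exact: spectrum_mono pm.
  - by move=> x xt; apply: pst; rewrite mem_cat xt orbT.
have cv : filter_from D B --> chi.
  apply: spectrum_cvg => l; case cl: (spectrum_fun chi l).
    by exists (l, [::]); [split|move=> psi [/= ->]].
  have [k ck] := spectrum_ex chi.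
  exists (k, [:: l]); first by split=> //= x; rewrite inE => /eqP ->; rewrite cl.
  by move=> psi [/= _ /(_ l)]; rewrite inE eqxx => /(_ isT)/negbTE.
by move=> /cv [[l s] [/= cl cs] BV]; exists l, s; split=> // psi pl ps; apply: BV.
Qed.

(** An ultrafilter [F] converges to its pointwise limit [c], which is nonzero at [l]. It is
    multiplicative because [meets k m] is finite: if [c] vanished on it, [F] would contain the
    intersection of the complements of the [X n] for [n] in [meets k m]. *)
Lemma spectrum_compact l : compact [set chi | spectrum_fun chi l].
Proof.
rewrite compact_ultra => F FU Fl.
pose X k : set (spectrum L) := [set chi | spectrum_fun chi k].
pose c k : bool := `[< F (X k) >].
have cP k : c k <-> F (X k) by split=> /asboolP.
have cN k : ~~ c k -> F (~` X k).
  by move=> /negP nc; have [/cP//|] := in_ultra_setVsetC (X k) FU.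
have PF := ultra_proper.
have chc : is_character c.
  split.
  - by exists l; apply/cP.
  - apply/negbTE/negP => /cP; rewrite (_ : X pbot = set0); first exact: filter_not_empty.
    by rewrite -subset0 => chi; rewrite /X /= spectrum_bot.
  - move=> k m; split=> [[/cP ck /cP cm]|[n kmn /cP cn]]; last first.
      have [nk nm] := meets_below kmn.
      by split; apply/cP; apply: filterS cn => chi; exact: spectrum_mono.
    apply: contrapT => nn; have [Y YE] := finite_fsetP.1 (meets_finite HL k m).
    have : F (\bigcap_(n in [set` Y]) ~` X n).
      apply: filter_bigI => n nY; apply: cN; apply/negP => cn; apply: nn; exists n => //.
      by rewrite YE.
    move=> /(filterI ck)/(filterI cm)/filter_ex[chi [cm' [ck' cY]]].
    have [n kmn cn] := spectrum_meets ck' cm'.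
    by apply: (cY n) => //; rewrite -YE.
exists (Spectrum chc); split; first by apply/cP.
apply: spectrum_cvg => k /=; rewrite /spectrum_fun /=.
case ck: (c k); first by move/cP: ck.
by apply: filterS (cN k (negbT ck)) => chi /negP/negbTE.
Qed.

Lemma spectrum_separate chi psi : chi <> psi ->
  exists l (b : bool), spectrum_fun chi l = b /\ spectrum_fun psi l = ~~ b.
Proof.
move=> cp; apply: contrapT => H; apply: cp; apply: spectrum_eq => l.
apply: contrapT => E; apply: H; exists l, (spectrum_fun chi l); split=> //.
by move: E; case: (spectrum_fun chi l); case: (spectrum_fun psi l) => // E; exfalso; apply: E.
Qed.

Lemma spectrum_lch_td : lch_totally_disconnected (spectrum L).
Proof.
split.
- move=> chi psi H; apply: contrapT => /spectrum_separate[l [b [cl pl]]].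
  have [phi [/= <-]] := H _ _ (open_nbhs_nbhs (conj (open_spectrum_fun l b) cl))
    (open_nbhs_nbhs (conj (open_spectrum_fun l (~~ b)) pl)).
  by case: (spectrum_fun _ _).
- move=> chi _; rewrite withinET; have [l cl] := spectrum_ex chi.
  exists [set psi | spectrum_fun psi l].
    by apply: open_nbhs_nbhs; split=> //; exact: open_spectrum_fun.
  split; first exact: spectrum_compact.
  rewrite (_ : [set _ | _] = ~` [set psi | spectrum_fun psi l = false]).
    by apply: open_closedC; exact: open_spectrum_fun.
  by apply/seteqP; split=> psi /=; case: (spectrum_fun _ _).
- apply: zero_dimension_totally_disconnected => chi psi /eqP.
  move=> /spectrum_separate[l [b [cl pl]]]; exists [set phi | spectrum_fun phi l = b].
  split=> //=; last by rewrite pl; case: b {cl pl}.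
  split; first exact: open_spectrum_fun.
  rewrite (_ : [set _ | _] = ~` [set psi | spectrum_fun psi l = ~~ b]).
    by apply: open_closedC; exact: open_spectrum_fun.
  by apply/seteqP; split=> phi /=; case: (spectrum_fun _ _); case: b {cl pl}.
Qed.

End SpectrumTopology.

(** * Continuity of the action on the spectrum *)

Section SpectrumActionTopology.
Context {S : invSemigroupType} {L : pposet} (a : S -> L -> option L).
Context (HL : weak_semilattice L) (Ha : lattice_action a).
Let b := spectrum_action HL Ha.

Lemma spectrum_ppreimage_open s (V : set (spectrum L)) : open V -> open (ppreimage (b s) V).
Proof.
move=> oV; rewrite openE => chi [psi Vpsi /(spectrum_actP HL Ha)[[l0 l0s cl0] E]].
have [l [t [pl pt lV]]] := spectrum_basis HL (open_nbhs_nbhs (conj oV Vpsi)).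
have [iso _ _ _ _] := Ha; have [_ dr mono] := iso s.
have [j [k [sj kl cj]]] := (E l).1 pl.
(* The condition that the image of chi' vanishes at [x] has to be pulled back, although [x] need not
   be in the range of [s]. Once the image is 1 at [k], it suffices that chi' vanishes on the finite
   set of preimages of [meets k x], which lies in the range because [k] does. *)
pose low x := [set y | exists z, meets k x z /\ a s y = Some z].
have flow x : finite_set (low x).
  apply: (sub_finite_set _ (finite_image (fun z => odflt z (a (sinv s) z)) (meets_finite HL k x))).
  by move=> y [z [kxz /(lact_sinv HL Ha) sy]]; exists z; rewrite // sy.
have [u uE] : exists u : seq L, \bigcup_(x in [set` t]) low x = [set` u].
  apply/finite_seqP; apply: bigcup_finite => //; exact: finite_seq.
apply: (@spectrum_nbhs _ _ (j :: u)) => chi' H.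
have cj' : spectrum_fun chi' j by rewrite H ?mem_head.
have dj : spectrum_dom a s chi' by exists j; rewrite /pdom /= ?sj.
have [psi' p'] := spectrum_act_ex HL Ha dj; exists psi' => //.
have [_ E'] := (spectrum_actP HL Ha _ _ _).1 p'.
apply: lV; first by apply/E'; exists j, k.
move=> x xt; apply/negP => p'x.
have p'k : spectrum_fun psi' k by apply/E'; exists j, k; rewrite (ple_refl HL).
have [z kxz p'z] := spectrum_meets p'k p'x.
have [zk zx] := meets_below kxz.
have [y' [z' [sy' z'z cy']]] := (E' z).1 p'z.
have [y sy] : pran (a s) z by apply: dr zk _; exists j.
have y'y : ple y' y by rewrite -(mono _ _ _ _ sy' sy).
have cy : spectrum_fun chi' y by exact: spectrum_mono y'y cy'.
have yu : y \in u.
  suff : [set` u] y by [].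
  by rewrite -uE; exists x => //; exists z.
have /negP := pt x xt; apply; apply/E; exists y, z; split=> //.
by rewrite -H // inE yu orbT.
Qed.

Lemma paction_ran (X : Type) (c : paction S X) s : pran (c s) = pdom (c (sinv s)).
Proof.
apply/seteqP; split=> y; first by move=> [x sx]; rewrite /pdom /= (act_sinv sx).
rewrite /pdom /=; case sy: (c (sinv s) y) => [x|//] _; exists x.
by have := act_sinv sy; rewrite sinvK.
Qed.

Lemma paction_image (X : Type) (c : paction S X) s V : pimage (c s) V = ppreimage (c (sinv s)) V.
Proof.
apply/seteqP; split=> y; first by move=> [x Vx sx]; exists x => //; exact: act_sinv.
by move=> [x Vx sx]; exists x => //; have := act_sinv sx; rewrite sinvK.
Qed.

Lemma paction_dom (X : Type) (c : paction S X) s : pdom (c s) = ppreimage (c s) setT.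
Proof.
apply/seteqP; split=> x; rewrite /pdom /=; last by move=> [y _ ->].
by case sx: (c s x) => [y|//] _; exists y.
Qed.

Lemma spectrum_action_topological : topological_action b.
Proof.
have od s : open (pdom (b s)).
  by rewrite paction_dom; apply: spectrum_ppreimage_open; exact: openT.
move=> s; split=> //.
- by rewrite paction_ran.
- by move=> V; exact: spectrum_ppreimage_open.
- by move=> V oV; rewrite paction_image; exact: spectrum_ppreimage_open.
Qed.

End SpectrumActionTopology.

(** * Groupoids of germs are ample *)

Section TransformationGroupoidTopology.
Context {S : invSemigroupType} {X : topologicalType} (a : paction S X).
Implicit Types (s t u : S) (x y : X) (V W : set X) (g h : germ a).

Lemma bisectionP s V t x (tx : a t x) : bisection s V (mk_germ tx) <->
  V x /\ exists u, [/\ sle u s, sle u t & a u x].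
Proof.
split=> [[y [sy [Vy /germP[xy [u [ut us ux]]]]]]|[Vx [u [us ut ux]]]].
  by subst y; split=> //; exists u.
have sx : a s x.
  by move: ux; case ux: (a u x) => [z|//] _; rewrite (act_sle us ux).
by exists x, sx; split=> //; apply/germP; split=> //; exists u.
Qed.

Lemma bisection_mk s V x (sx : a s x) : V x -> bisection s V (mk_germ sx).
Proof. by move=> Vx; exists x, sx. Qed.

Lemma open_bisection s V : open V -> open (bisection (a := a) s V).
Proof.
move=> oV; exists [set bisection s V]; last by rewrite bigcup_set1.
move=> _ ->; apply: (@finI_from1 _ _ _ id (bisection s V)).
by exists s, V.
Qed.

Lemma sle_trans s t u : sle s t -> sle t u -> sle s u.
Proof.
by move=> [e ee ->] [f ff ->]; exists (f * e)%g; [exact: sidemM | rewrite mulgA].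
Qed.

Lemma bisection_le s t V W : sle s t -> V `<=` W -> bisection (a := a) s V `<=` bisection t W.
Proof.
move=> st VW _ [y [sy [Vy ->]]]; apply/bisectionP; split; first exact: VW.
by exists s; split=> //; exact: sle_refl.
Qed.

(** The bisections, given as a subbase, are a base: if two of them contain [g], witnessed by [u] and
    [v], then [sle_dom_dir] gives a [z] below both elements of [S] whose bisection over the
    intersected sets contains [g]. *)
Lemma germ_nbhs g (A : set (germ a)) : nbhs g A -> exists s V,
  [/\ open V, bisection s V g & bisection s V `<=` A].
Proof.
move: g A; apply: germW => r x rx A; set g := mk_germ rx.
pose D := [set sV : S * set X | open sV.2 /\ bisection sV.1 sV.2 g].
pose B (sV : S * set X) := bisection (a := a) sV.1 sV.2.
have FF : Filter (filter_from D B).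
  apply: filter_from_filter.
    by exists (r, setT); split=> /=; [exact: openT|exact: bisection_mk].
  move=> [s V] [t W] [/= oV /bisectionP[Vx [u [us ur ux]]]].
  move=> [/= oW /bisectionP[Wx [v [vt vr vx]]]].
  have [z [zu zt zx]] := sle_dom_dir (sle_refl u) ur vr vt ux vx.
  exists (z, V `&` W).
    split=> /=; first exact: openI.
    by apply/bisectionP; split=> //; exists z; split=> //; [exact: sle_refl|exact: sle_trans ur].
  move=> h zh; split; [apply: (bisection_le (sle_trans zu us) _ zh)
    |apply: (bisection_le zt _ zh)]; by move=> ? [].
rewrite nbhsE => -[_ [[D' D'fin <-] [A' D'A' A'g]] A'A].
have : filter_from D B A'.
  have [E Esub EA'] := D'fin _ D'A'; rewrite -EA'.
  apply: filter_bigI => i iE; have /set_mem[s [V [oV iV]]] := Esub _ iE.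
  exists (s, V); last by rewrite iV.
  by split=> //=; move: A'g; rewrite -EA' => /(_ i iE); rewrite iV.
case=> [[s V] [/= oV gsV] BA]; exists s, V; split=> // h hsV; apply: A'A.
by exists A' => //; exact: BA.
Qed.

Lemma germ_cvg (Y : Type) (F : set_system Y) (f : Y -> germ a) g : Filter F ->
  (forall s V, open V -> bisection s V g -> F (f @^-1` bisection s V)) -> f @ F --> g.
Proof.
move=> FF H A /germ_nbhs[s [V [oV gsV sVA]]].
by apply: filterS (H s V oV gsV) => y /sVA.
Qed.

Lemma nbhs_bisection s V x (sx : a s x) : nbhs x V -> nbhs (mk_germ sx) (bisection s V).
Proof.
rewrite nbhsE => -[W [oW Wx] WV].
have : nbhs (mk_germ sx) (bisection (a := a) s W).
  by apply: open_nbhs_nbhs; split; [exact: open_bisection|exact: bisection_mk].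
by apply: filterS; exact: bisection_le (sle_refl s) WV.
Qed.

Context (Ta : topological_action a).

Let dom_nbhs s x : a s x -> nbhs x (pdom (a s)).
Proof. by move=> sx; apply: open_nbhs_nbhs; split=> //; have [] := Ta s. Qed.

Let ppre_nbhs s x y V : a s x = Some y -> nbhs y V -> nbhs x (ppreimage (a s) V).
Proof.
move=> sx; rewrite nbhsE => -[W [oW Wy] WV].
have [_ _ /(_ W oW) oP _] := Ta s.
apply: (@filterS _ _ _ (ppreimage (a s) W)).
  by move=> z [w /WV Vw sz]; exists w.
by apply: open_nbhs_nbhs; split=> //; exists y.
Qed.

Let G := transformation_groupoid a.

Lemma germ_src_continuous : continuous (@src G).
Proof.
apply: germW => s x sx V; rewrite /= germ_srcE => Vx.
apply: filterS (nbhs_bisection sx Vx) => _ [y [sy [Vy ->]]].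
by rewrite /= germ_srcE.
Qed.

Lemma germ_rng_continuous : continuous (@rng G).
Proof.
apply: germW => s x sx V; have sxE := germ_rngE sx => Vx.
apply: filterS (nbhs_bisection sx (ppre_nbhs sxE Vx)) => _ [y [sy [[z Vz syz] ->]]].
by have := germ_rngE sy; rewrite syz /= => -[<-].
Qed.

(** [unit_idem] is chosen point by point. An element [u] below the choice at [x] is idempotent, and
    near [x] its germs are the units, whatever is chosen there. *)
Lemma germ_unit_continuous : continuous (@gunit G).
Proof.
move=> x; apply: germ_cvg => s V oV /bisectionP[Vx [u [us ue ux]]].
have [f ff uf] : exists2 f, sidem f & u = (unit_idem a x * f)%g by case: ue => f ? ?; exists f.
have uu : sidem u.
  by rewrite uf; apply: sidemM => //; rewrite /unit_idem; case: cid2.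
have nV : nbhs x V by apply: open_nbhs_nbhs.
apply: filterS2 nV (dom_nbhs ux) => y Vy uy.
rewrite -[(_ @^-1` _) y]/(bisection s V (germ_unit a y)) -(germ_unitE uy uu).
by apply/bisectionP; split=> //; exists u; split=> //; exact: sle_refl.
Qed.

Lemma germ_inv_continuous : continuous (@ginv G).
Proof.
apply: germW => s x sx; apply: (germ_cvg (nbhs_filter _)) => t V oV.
have sxE := germ_rngE sx; set y := germ_rng _ in sxE.
have sy : a (sinv s) y by rewrite (act_sinv sxE).
rewrite /= (germ_invE sx sy sxE) => /bisectionP[Vy [u [ut us uy]]].
have usx : a (sinv u) x.
  move: uy; case uy: (a u y) => [x'|//] _.
  by have := act_sle us uy; rewrite (act_sinv sxE) => -[->]; rewrite (act_sinv uy).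
have nV : nbhs y V by apply: open_nbhs_nbhs.
apply: filterS (nbhs_bisection sx (filterI (ppre_nbhs sxE nV) (dom_nbhs usx))).
move=> _ [x' [sx' [[[y' Vy' sxy'] ux'] ->]]].
have sy' : a (sinv s) y' by rewrite (act_sinv sxy').
rewrite /= (germ_invE sx' sy' sxy'); apply/bisectionP; split=> //; exists u; split=> //.
move: ux'; rewrite /pdom /=; case ux': (a (sinv u) x') => [z|//] _.
have us' : sle (sinv u) s by rewrite -[s]sinvK; exact: sle_sinv.
have := act_sle us' ux'; rewrite sxy' => -[->].
by have := act_sinv ux'; rewrite sinvK => ->.
Qed.

Lemma germ_mul_continuous :
  {within [set gh : arr G * arr G | src gh.1 = rng gh.2],
    continuous (fun gh => gmul gh.1 gh.2)}.
Proof.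
apply/subspace_continuousP => -[g h] /=; move: g; apply: germW => s y sy.
move: h; apply: germW => t x tx; rewrite germ_srcE => yE.
have txE := germ_rngE tx; rewrite -yE in txE.
have stx : a (s * t)%g x by rewrite actM txE.
apply: germ_cvg => r V oV.
rewrite -[from_subspace _ _ _]/(germ_mul (mk_germ sy) (mk_germ tx)) (germ_mulE sy tx stx txE).
move=> /bisectionP[Vx [u [ur ust ux]]].
have nV : nbhs x V by apply: open_nbhs_nbhs.
exists (bisection s setT, bisection t (V `&` pdom (a u))); rewrite /=.
  split; first by apply: nbhs_bisection; exact: filterT.
  by apply: nbhs_bisection; apply: filterI => //; exact: dom_nbhs.
move=> [g h] [/= [y' [sy' [_ gE]]] [x' [tx' [[Vx' ux'] hE]]]]; subst g h.
rewrite /= germ_srcE => y'E; have tx'E := germ_rngE tx'; rewrite -y'E in tx'E.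
have stx' : a (s * t)%g x' by rewrite actM tx'E.
suff : bisection r V (germ_mul (mk_germ sy') (mk_germ tx')) by [].
by rewrite (germ_mulE sy' tx' stx' tx'E); apply/bisectionP; split=> //; exists u.
Qed.

Lemma germ_src_local_homeo : local_homeo (@src G).
Proof.
split; first exact: germ_src_continuous.
apply: germW => s x sx; exists (bisection s setT); split.
- by apply: open_bisection; exact: openT.
- exact: bisection_mk.
- move=> g h /set_mem[y [sy [_ ->]]] /set_mem[z [sz [_ ->]]]; rewrite /= !germ_srcE => yz.
  by apply/germP; split=> //; exists s; split=> //; exact: sle_refl.
- move=> W oW _; rewrite openE => _ [+ + <-]; apply: germW => t y ty Wy.
  rewrite /= germ_srcE; have [r [V [oV /bisectionP[Vy [u [ur ut uy]]] rVW]]] :=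
    germ_nbhs (open_nbhs_nbhs (conj oW Wy)).
  have nV : nbhs y V by apply: open_nbhs_nbhs.
  apply: filterS2 nV (dom_nbhs uy) => z Vz uz.
  exists (mk_germ (a := a) uz); last by rewrite /= germ_srcE.
  by apply: rVW; apply/bisectionP; split=> //; exists u; split=> //; exact: sle_refl.
Qed.

Lemma transformation_groupoid_ample : lch_totally_disconnected X -> ample G.
Proof.
move=> hX; split=> //; last exact: germ_src_local_homeo.
split; [exact: germ_src_continuous|exact: germ_rng_continuous|exact: germ_unit_continuous|
  exact: germ_inv_continuous|exact: germ_mul_continuous].
Qed.

End TransformationGroupoidTopology.

(** * Equivariant homeomorphisms and restricted groupoids of germs *)

Section RestrictionMorphism.
Context {S : invSemigroupType} {X X' : topologicalType}.
Context (a : paction S X) (a' : paction S X') (Y : set X) (Y' : set X').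
Context (phi : Y -> Y').
Let G := transformation_groupoid a.
Let G' := transformation_groupoid a'.
Context (Yinv : forall s x y, Y x -> a s x = Some y -> Y y).
Context (Y'inv : forall s x y, Y' x -> a' s x = Some y -> Y' y).
Context (phi_act : forall s (x y : Y), a s (val x) = Some (val y) ->
  a' s (val (phi x)) = Some (val (phi y))).

Lemma phi_dom s (x : Y) : a s (val x) -> a' s (val (phi x)).
Proof.
case sx: (a s (val x)) => [y|//] _.
have Yy : Y y by apply: Yinv sx; exact: set_valP.
by rewrite (phi_act (y := exist (fun z => is_true (z \in Y)) y (mem_set Yy)) sx).
Qed.

Lemma germ_reprP (g : germ a) : a (val (repr g)).1 (germ_src g).
Proof. exact: (valP (repr g)). Qed.

Lemma restr_map_dom (g : restr_arr (G := G) Y) :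
  a' (val (repr (val g))).1 (val (phi (restr_src g))).
Proof. by apply: phi_dom; exact: germ_reprP. Qed.

Lemma restr_map_subproof (g : restr_arr (G := G) Y) :
  Y' (@src G' (mk_germ (restr_map_dom g))) /\ Y' (@rng G' (mk_germ (restr_map_dom g))).
Proof.
rewrite /= germ_srcE; split; first exact: set_valP.
have := germ_rngE (restr_map_dom g); apply: Y'inv; exact: set_valP.
Qed.

(** The map [s, x] to [s, phi x], defined on the chosen representative; [restr_mapE] gives
    independence of it. *)
Definition restr_map (g : restr_arr (G := G) Y) : restr_arr (G := G') Y' :=
  restr_Arr (restr_map_subproof g).

Lemma restr_mapE (g : restr_arr (G := G) Y) s (x : Y) (sx : a s (val x)) :
  val g = mk_germ sx -> val (restr_map g) = mk_germ (phi_dom sx).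
Proof.
move=> gE; have [srcE [u [us ur ux]]] := mk_germ_repr sx.
rewrite /=; apply/germP.
have xE : restr_src g = x by apply: val_inj => /=; rewrite gE srcE.
rewrite xE; split=> //; exists u; split=> //; last exact: phi_dom.
by rewrite gE.
Qed.

Lemma restr_arrW (P : restr_arr (G := G) Y -> Prop) :
  (forall (g : restr_arr (G := G) Y) s (x : Y) (sx : a s (val x)), val g = mk_germ sx -> P g) ->
  forall g, P g.
Proof.
have ex (g : germ a) : exists s x (sx : a s x), g = mk_germ sx.
  by move: g; apply: germW => s x sx; exists s, x, sx.
move=> H g; have [s [x [sx E]]] := ex (val g).
have Yx : Y x by have [] := restr_arrP g; rewrite /= E germ_srcE.
exact: (H g s (exist (fun z => is_true (z \in Y)) x (mem_set Yx)) sx E).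
Qed.

Lemma restr_rngP (g : restr_arr (G := G) Y) s (x : Y) (sx : a s (val x)) :
  val g = mk_germ sx -> a s (val x) = Some (val (restr_rng g)).
Proof. by move=> gE; rewrite /= gE; exact: germ_rngE. Qed.

Lemma restr_srcP (g : restr_arr (G := G) Y) s (x : Y) (sx : a s (val x)) :
  val g = mk_germ sx -> restr_src g = x.
Proof. by move=> gE; apply: val_inj; rewrite /= gE germ_srcE. Qed.

Lemma restr_map_src g : restr_src (restr_map g) = phi (restr_src g).
Proof. by apply: val_inj; rewrite /= germ_srcE. Qed.

Lemma restr_map_rng (g : restr_arr (G := G) Y) : restr_rng (restr_map g) = phi (restr_rng g).
Proof.
move: g; apply: restr_arrW => g s x sx gE; apply: val_inj => /=.
have := phi_act (restr_rngP gE).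
have -> := germ_rngE (phi_dom sx).
by have := restr_mapE gE; rewrite /= => -> [].
Qed.

Lemma restr_map_mul (g h : restr_arr (G := G) Y) : restr_src g = restr_rng h ->
  restr_map (restr_mul g h) = restr_mul (restr_map g) (restr_map h).
Proof.
move: g; apply: restr_arrW => g s y sy gE.
move: h; apply: restr_arrW => h t x tx hE gh.
have gh' : @src G (val g) = @rng G (val h) by have := congr1 val gh.
have yE : val y = val (restr_rng h) by rewrite -gh (restr_srcP gE).
have txE := restr_rngP hE; rewrite -yE in txE.
have stx : a (s * t)%g (val x) by rewrite actM txE.
have ghE : val (restr_mul g h) = mk_germ stx.
  by rewrite restr_mulE// gE hE; exact: germ_mulE.
apply: val_inj; rewrite (restr_mapE ghE) restr_mulE; last first.
  have := congr1 val (restr_map_src g); rewrite gh -restr_map_rng //.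
rewrite (restr_mapE gE) (restr_mapE hE); apply/esym; apply: germ_mulE.
exact: phi_act.
Qed.

Context (phi_dom' : forall s (x : Y), a' s (val (phi x)) -> a s (val x)).
Context (phi_continuous : continuous phi).

Lemma restr_map_continuous : continuous restr_map.
Proof.
apply: continuous_comp_initial; apply: restr_arrW => g s x sx gE.
apply: (germ_cvg (nbhs_filter _)) => t V oV.
rewrite -[(_ \o _) g]/(val (restr_map g)) (restr_mapE gE).
move=> /bisectionP[Vx [u [ut us ux]]].
have [W [oW WE]] : exists W : set X, open W /\ set_val @^-1` W = phi @^-1` (set_val @^-1` V).
  have oV' : open (set_val @^-1` V : set Y') by exists V.
  have /continuousP/(_ _ oV')[W oW WE] := phi_continuous.
  by exists W.
have Wx : W (val x).
  suff : (set_val @^-1` W) x by [].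
  by rewrite WE.
(* So far [u] is known to act at [phi x] only. As it also acts at [x], its bisection over [W] is a
   neighborhood of the germ. *)
have ux0 : a u (val x) by exact: phi_dom'.
have : nbhs g (set_val @^-1` (bisection (a := a) u W)).
  apply: open_nbhs_nbhs; split; first by exists (bisection u W) => //; exact: open_bisection.
  suff : bisection (a := a) u W (val g) by [].
  rewrite gE; apply/bisectionP; split=> //; exists u; split=> //; exact: sle_refl.
apply: filterS; apply: restr_arrW => h r z rz hE.
rewrite -[(_ @^-1` _) h]/(bisection (a := a) u W (val h)) hE => /bisectionP[Wz [w [wu wr wz]]].
suff : bisection t V (val (restr_map h)) by [].
rewrite (restr_mapE hE); apply/bisectionP; split.
  suff : (set_val @^-1` W) z by rewrite WE.
  by [].
exists w; split=> //; first exact: sle_trans ut.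
exact: phi_dom.
Qed.

End RestrictionMorphism.

Section RestrictionInverse.
Context {S : invSemigroupType} {X X' : topologicalType}.
Context (a : paction S X) (a' : paction S X') (Y : set X) (Y' : set X').

Lemma restr_mapK (phi : Y -> Y') (psi : Y' -> Y)
  (Yinv : forall s x y, Y x -> a s x = Some y -> Y y)
  (Y'inv : forall s x y, Y' x -> a' s x = Some y -> Y' y)
  (phi_act : forall s (x y : Y), a s (val x) = Some (val y) ->
    a' s (val (phi x)) = Some (val (phi y)))
  (psi_act : forall s (x y : Y'), a' s (val x) = Some (val y) ->
    a s (val (psi x)) = Some (val (psi y))) :
  cancel phi psi -> cancel (restr_map Yinv Y'inv phi_act) (restr_map Y'inv Yinv psi_act).
Proof.
move=> phiK; apply: restr_arrW => g s x sx gE; apply: val_inj.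
rewrite (restr_mapE _ _ psi_act (restr_mapE Yinv Y'inv phi_act gE)) gE.
apply/germP; rewrite phiK; split=> //; exists s; split=> //; exact: sle_refl.
Qed.

End RestrictionInverse.

Section RestrictionIsomorphism.
Context {S : invSemigroupType} {X X' : topologicalType}.
Context (a : paction S X) (a' : paction S X') (Y : set X) (Y' : set X').

Lemma restriction_isomorphic (phi : Y -> Y') (psi : Y' -> Y) :
  (forall s x y, Y x -> a s x = Some y -> Y y) ->
  (forall s x y, Y' x -> a' s x = Some y -> Y' y) ->
  (forall s (x y : Y), a s (val x) = Some (val y) -> a' s (val (phi x)) = Some (val (phi y))) ->
  (forall s (x : Y), a' s (val (phi x)) -> a s (val x)) ->
  cancel phi psi -> cancel psi phi -> continuous phi -> continuous psi ->
  groupoid_isomorphic (@restriction (transformation_groupoid a) Y)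
    (@restriction (transformation_groupoid a') Y').
Proof.
move=> Yinv Y'inv phi_act phi_dom' phiK psiK cphi cpsi.
(* Since [phi] reflects domains, [s] acts at [psi x], with a value [z] in [Y]; equivariance of [phi]
   then forces [phi z = y]. *)
have psi_act s (x y : Y') : a' s (val x) = Some (val y) -> a s (val (psi x)) = Some (val (psi y)).
  move=> sx; have : a s (val (psi x)) by apply: phi_dom'; rewrite psiK sx.
  case E: (a s _) => [z|//] _; have Yz : Y z by apply: Yinv E; exact: set_valP.
  have := phi_act s (psi x) (exist (fun z => is_true (z \in Y)) z (mem_set Yz)) E.
  by rewrite psiK sx => -[/val_inj ->]; rewrite phiK.
have psi_dom' s (x : Y') : a s (val (psi x)) -> a' s (val x).
  by move=> sx; rewrite -(psiK x); exact: (phi_dom Yinv phi_act sx).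
exists phi, (restr_map Yinv Y'inv phi_act), psi, (restr_map Y'inv Yinv psi_act); split=> //.
- by split; exact: restr_mapK.
- by split; exact: restr_map_continuous.
- split.
  + exact: restr_map_src.
  + exact: restr_map_rng.
  + by move=> g h; exact: restr_map_mul.
Qed.

End RestrictionIsomorphism.

Lemma groupoid_isomorphic_refl G : groupoid_isomorphic G G.
Proof. by exists id, id, id, id; split; split=> //; move=> ? ?. Qed.

(** * The covered part of the spectrum, and evaluation onto it *)

Section CoveredSpectrum.
Context {S : invSemigroupType} {L : pposet} (a : S -> L -> option L) (R : L -> set (set L)).
Context (HL : weak_semilattice L) (Ha : lattice_action a)
  (HR : cover_system R) (HI : invariant_covers a R).

(** The closed invariant subset [C_i] of the spectrum of [L_i]. *)
Definition covered_spectrum : set (spectrum L) :=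
  [set chi | forall l F, R l F -> spectrum_fun chi l -> exists2 f, F f & spectrum_fun chi f].

Lemma covered_spectrumN chi : ~ covered_spectrum chi <->
  exists l F, [/\ R l F, spectrum_fun chi l & forall f, F f -> ~ spectrum_fun chi f].
Proof.
split=> [nC|[l [F [RF cl nF]]] /(_ l F RF cl)[f Ff]]; last exact: nF.
apply: contrapT => H; apply: nC => l F RF cl; apply: contrapT => nf.
by apply: H; exists l, F; split=> // f Ff cf; apply: nf; exists f.
Qed.

(** Covers are finite, so violating one is a condition on finitely many values. *)
Lemma covered_spectrum_closed : closed covered_spectrum.
Proof.
rewrite -openC openE => chi /covered_spectrumN[l [F [RF cl nF]]].
have [/(_ l F RF)[fF _ _] _ _] := HR; have [s sE] := (finite_seqP _).1 fF.
apply: (@spectrum_nbhs _ _ (l :: s)) => psi E; apply/covered_spectrumN; exists l, F.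
split=> // [|f Ff]; first by rewrite E ?mem_head.
rewrite E; first exact: nF.
have fs : [set` s] f by rewrite -sE.
by rewrite inE [X in _ || X]fs orbT.
Qed.

(** A cover of [l] is restricted to an element [k] in the range of [s] and carried back by [sinv s]
    to a cover of [j], on which [chi] can be tested. *)
Lemma covered_spectrum_act s chi psi : covered_spectrum chi ->
  spectrum_action HL Ha s chi = Some psi -> covered_spectrum psi.
Proof.
move=> Cchi /(spectrum_actP HL Ha)[_ E] l F RF /E[j [k [sj kl cj]]].
have [Rf R1 Rm] := HR.
have [f [g gkF sg] cf] := Cchi _ _ (HI (lact_sinv HL Ha sj) (Rm _ _ _ kl RF)) cj.
have [[f' Ff' /meets_below[_ gf']] _] := gkF.
exists f' => //; apply/E; exists f, g; split=> //.
by have := lact_sinv HL Ha sg; rewrite sinvK.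
Qed.

Lemma transformation_invariant_set (X : topologicalType) (b : paction S X) (A : set X) :
  (forall s x y, A x -> b s x = Some y -> A y) ->
  invariant_set (G := transformation_groupoid b) A.
Proof.
move=> Ainv; apply: germW => s x sx; rewrite /= germ_srcE; have sxE := germ_rngE sx.
by split=> [Ax|Ay]; [exact: Ainv sxE|exact: Ainv (act_sinv sxE)].
Qed.

Lemma covered_spectrumC_act s chi psi : (~` covered_spectrum) chi ->
  spectrum_action HL Ha s chi = Some psi -> (~` covered_spectrum) psi.
Proof.
by move=> nC sc Cpsi; apply: nC; exact: covered_spectrum_act Cpsi (act_sinv sc).
Qed.

(** The hypotheses from here on are common to two situations: the representation on [X], where [Y]
    is everything, and the sets [eventually_supp p] in the spectrum of the previous stage, where [Y]
    is the complement of its covered part. *)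
Context {X : topologicalType} (b : paction S X) (Y : set X) (U : L -> set X).
Context (hX : hausdorff_space X).
Context (Yinv : forall s x y, Y x -> b s x = Some y -> Y y).
Context (Uopen : forall l, open (U l)) (Uclosed : forall l, closed (U l)).
Context (Uchar : forall x, Y x -> is_character (fun l => `[< U l x >])).
Context (Ucover : forall x l F, Y x -> R l F -> U l x -> exists2 f, F f & U f x).
Context (Usurj : forall chi, covered_spectrum chi ->
  exists x, Y x /\ forall l, spectrum_fun chi l <-> U l x).
Context (Ubasis : forall x V, Y x -> nbhs x V -> exists l (s : seq L),
  [/\ U l x, forall k, k \in s -> ~ U k x &
    forall y, Y y -> U l y -> (forall k, k \in s -> ~ U k y) -> V y]).
Context (Udom : forall s x, Y x -> b s x <-> exists2 l, pdom (a s) l & U l x).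
Context (Uact : forall s l k x y, a s l = Some k -> U l x -> b s x = Some y -> U k y).

(** By [Ubasis], [y] lies in every neighborhood of [x]. *)
Lemma U_inj x y : Y x -> Y y -> (forall l, U l x <-> U l y) -> x = y.
Proof.
move=> Yx Yy E; apply: hX => A B /(Ubasis Yx)[l [s [lx sx lsA]]] By.
exists y; split; last exact: nbhs_singleton.
by apply: lsA => // [|k ks Uy]; [exact/E | apply: (sx k ks); exact/E].
Qed.

Definition evaluation (x : X) (Yx : Y x) : spectrum L := Spectrum (Uchar Yx).

Lemma evaluationP x (Yx : Y x) l : spectrum_fun (evaluation Yx) l <-> U l x.
Proof. by split=> /asboolP. Qed.

Lemma evaluation_covered x (Yx : Y x) : covered_spectrum (evaluation Yx).
Proof.
move=> l F RF /evaluationP /(Ucover Yx RF)[f Ff fx]; exists f => //.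
exact/evaluationP.
Qed.

Definition to_spectrum (x : Y) : covered_spectrum :=
  exist _ (evaluation (set_valP x)) (mem_set (@evaluation_covered _ (set_valP x))).

Lemma to_spectrumP x l : spectrum_fun (val (to_spectrum x)) l <-> U l (val x).
Proof. exact: evaluationP. Qed.

Lemma of_spectrum_subproof (chi : covered_spectrum) :
  {x : Y | forall l, spectrum_fun (val chi) l <-> U l (val x)}.
Proof.
apply: cid; have [x [Yx xE]] := Usurj (set_valP chi).
by exists (exist _ x (mem_set Yx)).
Qed.

Definition of_spectrum chi : Y := projT1 (of_spectrum_subproof chi).

Lemma of_spectrumP chi l : spectrum_fun (val chi) l <-> U l (val (of_spectrum chi)).
Proof. by rewrite /of_spectrum; case: of_spectrum_subproof. Qed.

Lemma to_spectrumK : cancel to_spectrum of_spectrum.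
Proof.
move=> x; apply: val_inj; apply: U_inj; try exact: set_valP.
by move=> l; rewrite -of_spectrumP to_spectrumP.
Qed.

Lemma of_spectrumK : cancel of_spectrum to_spectrum.
Proof.
move=> chi; apply: val_inj; apply: spectrum_eq => l.
by rewrite to_spectrumP -of_spectrumP.
Qed.

Lemma to_spectrum_continuous : continuous to_spectrum.
Proof.
apply: continuous_comp_initial => x.
apply: (spectrum_cvg (fmap_filter _ (nbhs_filter _))) => l.
have cv : continuous (set_val : Y -> X) by exact: initial_continuous.
have [Ux|nUx] := pselect (U l (val x)).
  have : nbhs x (set_val @^-1` U l) by apply: cv; apply: open_nbhs_nbhs.
  apply: filterS => y Uy /=; transitivity true; last apply/esym.
    exact/to_spectrumP.
  exact/to_spectrumP.
have : nbhs x (set_val @^-1` (~` U l)).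
  by apply: cv; apply: open_nbhs_nbhs; split=> //; exact: closed_openC.
apply: filterS => y Uy /=; transitivity false; last apply/esym.
  by apply/negbTE/negP => /to_spectrumP.
by apply/negbTE/negP => /to_spectrumP.
Qed.

Lemma of_spectrum_continuous : continuous of_spectrum.
Proof.
apply: continuous_comp_initial => chi V /(Ubasis (set_valP _))[l [s [lx sx lsV]]].
have cv : continuous (set_val : covered_spectrum -> spectrum L) by exact: initial_continuous.
have : nbhs chi (set_val @^-1` [set psi : spectrum L | spectrum_fun psi l /\
    forall k, k \in s -> ~ spectrum_fun psi k]).
  apply: cv; apply: (@spectrum_nbhs _ _ (l :: s)) => psi E; split.
    by rewrite E ?mem_head//; exact/of_spectrumP.
  by move=> k ks; rewrite E ?inE ?ks ?orbT// => /of_spectrumP; exact: sx.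
apply: filterS => psi [pl ps]; apply: lsV; first exact: set_valP.
  exact/of_spectrumP.
by move=> k ks /of_spectrumP; exact: ps.
Qed.

Lemma to_spectrum_act s (x y : Y) : b s (val x) = Some (val y) ->
  spectrum_action HL Ha s (val (to_spectrum x)) = Some (val (to_spectrum y)).
Proof.
move=> sx; apply/(spectrum_actP HL Ha).
have [l0 l0s l0x] : exists2 l, pdom (a s) l & U l (val x).
  by apply/(Udom s (set_valP x)); rewrite sx.
split; first by exists l0 => //; exact/to_spectrumP.
move: l0s; rewrite /pdom /=; case sl0: (a s l0) => [k0|//] _.
move=> l; split=> [/to_spectrumP Uy|[j [k [sj kl /to_spectrumP jx]]]].
  have [[dd dr mono] ] : order_iso_of_downsets (a s) /\ True by split=> //; have [] := Ha.
  have k0y := Uact sl0 l0x sx.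
  (* [l] need not be in the range of [s]; meeting it with [k0], which is, gives an [m] that can be
     pulled back. *)
  have := @spectrum_meets _ (val (to_spectrum y)) l k0.
  case; [exact/to_spectrumP|exact/to_spectrumP|move=> m /meets_below[ml mk0] /to_spectrumP my _].
  have [j sj] : pran (a s) m by apply: dr mk0 _; exists l0.
  exists j, m; split=> //; apply/to_spectrumP.
  exact: Uact (lact_sinv HL Ha sj) my (act_sinv sx).
suff : spectrum_fun (val (to_spectrum y)) l by [].
apply: (spectrum_mono HL kl); apply/to_spectrumP; exact: Uact sj jx sx.
Qed.

Lemma to_spectrum_dom s (x : Y) : spectrum_action HL Ha s (val (to_spectrum x)) -> b s (val x).
Proof.
move=> sx; apply/(Udom s (set_valP x)).
move: sx; case E: (spectrum_action HL Ha s _) => [psi|//] _.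
have [[l ls /to_spectrumP lx] _] := (spectrum_actP HL Ha _ _ _).1 E.
by exists l.
Qed.

Lemma representation_isomorphic :
  groupoid_isomorphic (@restriction (transformation_groupoid b) Y)
    (@restriction (transformation_groupoid (spectrum_action HL Ha)) covered_spectrum).
Proof.
apply: (restriction_isomorphic Yinv covered_spectrum_act to_spectrum_act to_spectrum_dom
  to_spectrumK of_spectrumK to_spectrum_continuous of_spectrum_continuous).
Qed.

End CoveredSpectrum.

(** * The complement of the covered part as the covered part of the next stage *)

Section SupportedSpectrum.
Context {S : invSemigroupType} (D : covered_lattice S).
Let R : D -> set (set D) := @cl_covers S D.
Let a : S -> D -> option D := @cl_act S D.
Context (HL : lf_weak_semilattice D) (Ha : lattice_action a)
  (HR : cover_system R) (HI : invariant_covers a R).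
Let HW := HL.1.

Local Notation L1 := (rc_poset D).
Local Notation rc0 := (@pbot L1).
Local Notation W1 := (rc_weak_semilattice HL HR).
Implicit Types (p q r : L1) (k l m f : D) (F : set D) (FF : set (set D)) (chi psi : spectrum D).

Let Rfin l F : R l F -> finite_set F.
Proof. by have [/(_ l F) H _ _] := HR => /H[]. Qed.

Let Rle l F f : R l F -> F f -> ple f l.
Proof. by have [/(_ l F) H _ _] := HR => /H[_ + _]; apply. Qed.

Let Rmeets k l F : ple k l -> R l F -> R k (meets_cover k F).
Proof. by have [_ _ H] := HR; exact: H. Qed.

(** The characters which, as filters, are eventually in [supp p]; for
    [p = (l | FF)] these are the [chi] with [chi l = 1] and [chi f = 0] for all
    [f] in [FF]. *)
Definition eventually_supp p : set (spectrum D) :=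
  [set chi | exists2 l, spectrum_fun chi l &
    forall k, ple k l -> spectrum_fun chi k -> supp p k].

Lemma spectrum_dir chi k l : spectrum_fun chi k -> spectrum_fun chi l ->
  exists m, [/\ ple m k, ple m l & spectrum_fun chi m].
Proof. by move=> ck cl; have [m /meets_below[mk ml] cm] := spectrum_meets ck cl; exists m. Qed.

Lemma eventually_suppI p q r chi m : supp r = [set x | ple x m] `&` supp p `&` supp q ->
  spectrum_fun chi m -> eventually_supp p chi -> eventually_supp q chi -> eventually_supp r chi.
Proof.
move=> rE cm [l cl lp] [k ck kq].
have [n [nl nk cn]] := spectrum_dir cl ck; have [i [i_n im ci]] := spectrum_dir cn cm.
exists i => // x xi cx; rewrite rE; split; first split.
- exact: (ple_trans HW) xi im.
- by apply: lp => //; apply: (ple_trans HW) xi _; exact: (ple_trans HW) nl.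
- by apply: kq => //; apply: (ple_trans HW) xi _; exact: (ple_trans HW) nk.
Qed.

Lemma eventually_suppS p q chi : supp p `<=` supp q ->
  eventually_supp p chi -> eventually_supp q chi.
Proof. by move=> pq [l cl lp]; exists l => // k kl ck; apply: pq; exact: lp. Qed.

Lemma eventually_supp_le p m chi : supp p `<=` [set x | ple x m] ->
  eventually_supp p chi -> spectrum_fun chi m.
Proof.
move=> pm [l cl lp]; apply: (spectrum_mono HW _ cl); apply: (pm l).
by apply: lp => //; exact: ple_refl.
Qed.

Lemma eventually_supp_nbot p chi : eventually_supp p chi -> p <> rc0.
Proof.
move=> [l cl lp] p0; have := lp l (ple_refl HW l) cl.
by rewrite p0 supp_bot.
Qed.

(** If [chi f] held for some [f] in a member of [FF], the filter [chi] would eventually be below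
    [f], hence outside the support. *)
Lemma eventually_suppP p l FF chi : supp p = compl_set l FF ->
  eventually_supp p chi <->
  spectrum_fun chi l /\ forall F f, FF F -> F f -> ~ spectrum_fun chi f.
Proof.
move=> pE; split=> [pc|[cl nf]].
  split; first by apply: eventually_supp_le pc; rewrite pE => k [].
  move=> F f FFF Ff cf; have [k ck kp] := pc.
  have [m [mk mf cm]] := spectrum_dir ck cf.
  by have := kp m mk cm; rewrite pE => -[_ _ /(_ _ _ FFF Ff)].
exists l => // k kl ck; rewrite pE; split=> //.
  by apply/eqP => kb; rewrite kb spectrum_bot in ck.
move=> F f FFF Ff kf; apply: (nf F f) => //; exact: (spectrum_mono HW) kf ck.
Qed.

Lemma eventually_supp_cut p q m chi : supp q = [set x | ple x m] `&` supp p ->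
  eventually_supp q chi <-> spectrum_fun chi m /\ eventually_supp p chi.
Proof.
move=> qE; split=> [qc|[cm pc]].
  split; first by apply: eventually_supp_le qc; rewrite qE => x [].
  by apply: eventually_suppS qc; rewrite qE => x [].
by apply: (eventually_suppI _ cm pc pc); rewrite qE -setIA setIid.
Qed.

Lemma eventually_supp_clopen p : open (eventually_supp p) /\ closed (eventually_supp p).
Proof.
have [l [FF [[_ fFF FFR] pE]]] := rc_form HL HR p.
have fB : finite_set (\bigcup_(F in FF) F) by apply: bigcup_finite => // F /FFR; exact: Rfin.
have [s sE] := (finite_seqP _).1 fB.
have E chi psi : (forall k, k \in l :: s -> spectrum_fun psi k = spectrum_fun chi k) ->
    eventually_supp p psi <-> eventually_supp p chi.
  move=> E; rewrite !(eventually_suppP _ pE) E ?mem_head//.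
  suff E' F f : FF F -> F f -> spectrum_fun psi f = spectrum_fun chi f.
    split=> -[cl H]; split=> // F f FFF Ff; first by rewrite -(E' F)//; exact: H FFF Ff.
    by rewrite (E' F)//; exact: H FFF Ff.
  move=> FFF Ff; apply: E; have fs : [set` s] f by rewrite -sE; exists F.
  by rewrite inE [X in _ || X]fs orbT.
split; last rewrite -openC; rewrite openE => chi c.
  by apply: (@spectrum_nbhs _ _ (l :: s)) => psi /E ->.
by apply: (@spectrum_nbhs _ _ (l :: s)) => psi /E E' pc; apply: c; apply/E'.
Qed.

Local Notation O := (~` @covered_spectrum D R).

(** A cover [F0] of [l0] violated by [chi] provides the element [(l0 | {F0})], so the character is
    nonzero. For multiplicativity, [chi] is 1 at the tops of [p] and [q], hence at some [n] among
    their meets, and it is eventually in the support of the product n p q. *)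
Lemma eventually_supp_char chi : O chi ->
  is_character (fun p => `[< eventually_supp p chi >]).
Proof.
move=> /covered_spectrumN[l0 [F0 [RF0 cl0 nF0]]]; split.
- have ad : @admissible S D l0 [set F0].
    by split; [exists F0|exact: finite_set1|move=> _ ->].
  have [p pE] := rc_mk HL HR ad; exists p; apply/asboolP/(eventually_suppP _ pE).
  by split=> // F f ->; exact: nF0.
- by apply/negbTE/negP => /asboolP /eventually_supp_nbot.
- move=> p q; split=> [[/asboolP pc /asboolP qc]|[m pqm /asboolP mc]].
    have [l [FF sp]] := shape_ex HL HR (eventually_supp_nbot pc).
    have [k [GG sq]] := shape_ex HL HR (eventually_supp_nbot qc).
    have cl : spectrum_fun chi l by apply: eventually_supp_le pc => x; exact: shape_le sp.
    have ck : spectrum_fun chi k by apply: eventually_supp_le qc => x; exact: shape_le sq.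
    have [n lkn cn] := spectrum_meets cl ck.
    have [r rE] := rc_meet_ex HL HR sp sq lkn.
    have [|m pqm rm] := below_meets W1 (k := p) (l := q) (x := r).
      by split; apply/(rc_leP HL HR); rewrite rE => x [[]].
    exists m => //; apply/asboolP; apply: (eventually_suppS (p := r)).
      exact/(rc_leP HL HR).
    exact: eventually_suppI rE cn pc qc.
  have [/(rc_leP HL HR) mp /(rc_leP HL HR) mq] := meets_below pqm.
  by split; apply/asboolP; exact: eventually_suppS mc.
Qed.

(** If [chi f] holds for some [f] in [F], then [chi] is eventually in the part of [p] under [f]; if
    it holds for none, no element of the filter lies below any [f], and [chi] is eventually in the
    part avoiding [F]. *)
Lemma eventually_supp_cover chi p C : rc_covers p C -> eventually_supp p chi ->
  exists2 c, C c & eventually_supp c chi.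
Proof.
move=> pC pc; have [l [FF sp]] := shape_ex HL HR (eventually_supp_nbot pc).
move: pC => /(rc_coversP HL HR _ sp)[F RF ->].
suff [c Pc cc] : exists2 c, rc_precover p F c & eventually_supp c chi.
  have [d Cd cd] := maximals_below W1 (rc_precover_finite HL HR p (Rfin RF)) Pc.
  by exists d => //; apply: eventually_suppS cc; exact/(rc_leP HL HR).
have [[f Ff cf]|nf] := pselect (exists2 f, F f & spectrum_fun chi f).
  have [c cE] := rc_cut HL HR sp (Rle RF Ff); exists c; first by right; exists f.
  exact/(eventually_supp_cut _ cE).
have [c cE] := rc_avoid HL HR sp RF; exists c; first by left.
have [k ck kp] := pc; exists k => // x xk cx; rewrite cE; split; last exact: kp.
move=> f Ff xf; apply: nf; exists f => //; exact: (spectrum_mono HW) xf cx.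
Qed.

Section Inverse.
Context (phi : spectrum L1) (Cphi : @covered_spectrum L1 (@rc_covers S D) phi).

Definition down_fun : D -> bool :=
  fun k => `[< exists2 p, spectrum_fun phi p & supp p `<=` [set x | ple x k] >].

Lemma phi_nbot p : spectrum_fun phi p -> p <> rc0.
Proof. by move=> pp p0; rewrite p0 spectrum_bot in pp. Qed.

Lemma phi_meet p q : spectrum_fun phi p -> spectrum_fun phi q ->
  exists r n, [/\ spectrum_fun phi r, supp r `<=` supp p, supp r `<=` supp q,
    supp r n & supp r `<=` [set x | ple x n]].
Proof.
move=> pp pq.
have [r /meets_below[/(rc_leP HL HR) rp /(rc_leP HL HR) rq] pr] := spectrum_meets pp pq.
have [n [FF sr]] := shape_ex HL HR (phi_nbot pr).
exists r, n; split=> //; [exact: shape_mem sr|by move=> x; exact: shape_le sr].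
Qed.

Lemma down_fun_shape p l FF : shape p l FF -> spectrum_fun phi p -> down_fun l.
Proof. by move=> sp pp; apply/asboolP; exists p => // x; exact: shape_le sp. Qed.

Lemma down_fun_char : is_character down_fun.
Proof.
split.
- have [p pp] := spectrum_ex phi.
  have [l [FF sp]] := shape_ex HL HR (phi_nbot pp).
  by exists l; exact: down_fun_shape sp pp.
- apply/negbTE/negP => /asboolP[p pp pb]; apply: (phi_nbot pp).
  apply: (supp0 HL HR); rewrite -subset0 => x px.
  by have := supp_nbot px; rewrite (ple_eqbot HW (pb _ px)) eqxx.
- move=> k l; split=> [[/asboolP[p pp pk] /asboolP[q pq ql]]|
    [m /meets_below[mk ml] /asboolP[p pp pm]]].
    have [r [n [pr rp rq rn rle]]] := phi_meet pp pq.
    have [m klm nm] := below_meets HW (conj (pk _ (rp _ rn)) (ql _ (rq _ rn))).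
    exists m => //; apply/asboolP; exists r => // x /rle xn.
    exact: (ple_trans HW) xn nm.
  by split; apply/asboolP; exists p => // x /pm xm; exact: (ple_trans HW) xm _.
Qed.

Definition down_char : spectrum D := Spectrum down_fun_char.

Lemma down_charP k : spectrum_fun down_char k <->
  exists2 p, spectrum_fun phi p & supp p `<=` [set x | ple x k].
Proof. by split=> /asboolP. Qed.

Lemma down_char_avoid p l FF F f : shape p l FF -> spectrum_fun phi p ->
  FF F -> F f -> ~ spectrum_fun down_char f.
Proof.
move=> [_ pE _] pp FFF Ff /down_charP[q pq qf].
have [r [n [pr rp rq rn _]]] := phi_meet pp pq.
by have := rp _ rn; rewrite pE => -[_ _ /(_ _ _ FFF Ff)]; apply; exact: qf (rq _ rn).
Qed.

Lemma down_charO : O down_char.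
Proof.
have [p pp] := spectrum_ex phi; have [l [FF sp]] := shape_ex HL HR (phi_nbot pp).
have [[[F FFF] _ FFR] _ _] := sp; apply/covered_spectrumN; exists l, F.
split; first exact: FFR.
  exact: down_fun_shape sp pp.
by move=> f Ff; exact: down_char_avoid sp pp FFF Ff.
Qed.

Lemma down_char_eventually p : spectrum_fun phi p <-> eventually_supp p down_char.
Proof.
split=> [pp|pc].
  have [l [FF sp]] := shape_ex HL HR (phi_nbot pp); have [_ pE _] := sp.
  apply/(eventually_suppP _ pE); split; first exact: down_fun_shape sp pp.
  by move=> F f; exact: down_char_avoid sp pp.
have [l [FF sp]] := shape_ex HL HR (eventually_supp_nbot pc).
have [[_ fFF FFR] pE _] := sp; have [cl nf] := (eventually_suppP _ pE).1 pc.
have [t tE] := (finite_seqP _).1 fFF.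
(* [q] is shrunk by one member [F] of [FF] at a time. As [phi] is covered, it is 1 on a member of
   the cover of [q] induced by [F]; a member under some [f] in [F] would make [down_char] equal to 1
   at [f], so it is the part avoiding [F]. *)
have [q [pq ql qt]] : exists q, [/\ spectrum_fun phi q, supp q `<=` [set x | ple x l] &
    forall F, F \in t -> supp q `<=` avoids F].
  have tFF F : F \in t -> FF F by rewrite tE.
  elim: t {tE} tFF => [|F t IH] tFF; first by move/down_charP: cl => [q pq ql]; exists q.
  have [|q [pq ql qt]] := IH; first by move=> G Gt; apply: tFF; rewrite inE Gt orbT.
  have [n [HH sq]] := shape_ex HL HR (phi_nbot pq).
  have nl : ple n l := ql _ (shape_mem sq).
  have FFF : FF F by apply: tFF; exact: mem_head.
  have RnF := Rmeets nl (FFR _ FFF).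
  have [|c Cc pc'] := Cphi (l := q) (F := maximals (rc_precover q (meets_cover n F))) _ pq.
    by apply/(rc_coversP HL HR _ sq); exists (meets_cover n F).
  have cq := rc_precover_le (maximals_sub Cc).
  exists c; split=> //; first exact: subset_trans cq ql.
  move=> G; rewrite inE => /orP[/eqP ->|Gt]; last by exact: subset_trans cq (qt _ Gt).
  case: (maximals_sub Cc) => [cE|[g [[f Ff /meets_below[_ gf]] _] cE]].
    move=> x cx; apply/(avoids_meets_cover HL (Rfin (FFR _ FFF)) (shape_le sq (cq _ cx))).
    by move: cx; rewrite cE => -[].
  exfalso; apply: (nf F f) => //; apply/down_charP; exists c => // x.
  by rewrite cE => -[xg _]; exact: (ple_trans HW) xg gf.
apply: (spectrum_mono W1) pq; apply/(rc_leP HL HR) => x qx; rewrite pE; split.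
- exact: supp_nbot qx.
- exact: ql.
- move=> F f FFF Ff; apply: (qt F) => //.
  suff : [set` t] F by [].
  by rewrite -tE.
Qed.

End Inverse.

(** Cutting a fixed [p0] with [x] translates the condition at [x] into one on relative complements,
    provided [x] lies below the top [l0] of [p0]. The negative [k] may not, so they are replaced by
    the finitely many elements of [meets m k]. *)
Lemma eventually_supp_basis chi (V : set (spectrum D)) : O chi -> nbhs chi V ->
  exists p (t : seq L1), [/\ eventually_supp p chi, forall r, r \in t -> ~ eventually_supp r chi &
    forall psi, O psi -> eventually_supp p psi ->
      (forall r, r \in t -> ~ eventually_supp r psi) -> V psi].
Proof.
move=> Oc nV; have [[p0 /asboolP p0c] _ _] := eventually_supp_char Oc.
have [l0 [FF0 sp0]] := shape_ex HL HR (eventually_supp_nbot p0c).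
have cl0 : spectrum_fun chi l0 by apply: eventually_supp_le p0c => x; exact: shape_le sp0.
have [l [s [cl cs lsV]]] := spectrum_basis HW nV.
have [m [ml ml0 cm]] := spectrum_dir cl cl0.
have [p pE] := rc_cut HL HR sp0 ml0.
have pc : eventually_supp p chi by exact/(eventually_supp_cut _ pE).
pose B := \bigcup_(k in [set` s]) meets m k.
have fB : finite_set B.
  by apply: bigcup_finite => [|k _]; [exact: finite_seq|exact: meets_finite].
have ft : finite_set [set r : L1 | exists2 x, B x & supp r = [set y | ple y x] `&` supp p0].
  have /(finite_supp HL HR) := finite_image (fun x => [set y | ple y x] `&` supp p0) fB.
  by apply: sub_finite_set => r [x Bx rE]; exists x.
have [t tE] := (finite_seqP _).1 ft.
have tP r : r \in t <-> exists2 x, B x & supp r = [set y | ple y x] `&` supp p0.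
  suff : [set` t] r <-> exists2 x, B x & supp r = [set y | ple y x] `&` supp p0 by [].
  by rewrite -tE.
exists p, t; split=> // [r /tP[x [k ks /meets_below[_ xk]] rE]|psi Opsi pp npt].
  move=> /(eventually_supp_cut _ rE)[cx _].
  by have /negP := cs _ ks; apply; exact: (spectrum_mono HW) xk cx.
have [pm p0p] := (eventually_supp_cut _ pE).1 pp.
apply: lsV; first exact: (spectrum_mono HW) ml pm.
move=> k ks; apply/negP => pk; have [x mkx px] := spectrum_meets pm pk.
have [xm _] := meets_below mkx.
have [r rE] := rc_cut HL HR sp0 (ple_trans HW xm ml0).
apply: (npt r); first by apply/tP; exists x => //; exists k.
exact/(eventually_supp_cut _ rE).
Qed.

Lemma eventually_supp_dom s chi : O chi -> spectrum_action HW Ha s chi <->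
  exists2 p, pdom (@rc_act S D s) p & eventually_supp p chi.
Proof.
move=> Oc; split=> [|[p]].
  case E: (spectrum_action HW Ha s chi) => [psi|//] _.
  have [[l ls cl] _] := (spectrum_actP HW Ha _ _ _).1 E.
  have [[p0 /asboolP p0c] _ _] := eventually_supp_char Oc.
  have [l0 [FF0 sp0]] := shape_ex HL HR (eventually_supp_nbot p0c).
  have cl0 : spectrum_fun chi l0 by apply: eventually_supp_le p0c => x; exact: shape_le sp0.
  have [m [ml ml0 cm]] := spectrum_dir cl cl0.
  have [p pE] := rc_cut HL HR sp0 ml0; exists p; last exact/(eventually_supp_cut _ pE).
  have [|q sp] := rc_act_ex HL Ha HR HI (s := s) (p := p); last by rewrite /pdom /= sp.
  move=> x; rewrite pE => -[xm _]; have [/(_ s)[dd _ _] _ _ _ _] := Ha.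
  exact: dd (ple_trans HW xm ml) ls.
rewrite /pdom /=; case sp: (rc_act s p) => [q|//] _ [l cl lp].
have [pd _] := (rc_actP HL Ha HR HI _ _ _).1 sp.
have [|psi] := @spectrum_act_ex _ _ a HW Ha s chi; last by rewrite /= => ->.
by exists l => //; apply: pd; apply: lp => //; exact: ple_refl.
Qed.

Lemma eventually_supp_act s p q chi psi : rc_act s p = Some q -> eventually_supp p chi ->
  spectrum_action HW Ha s chi = Some psi -> eventually_supp q psi.
Proof.
move=> /(rc_actP HL Ha HR HI)[pd qE] [l cl lp] /(spectrum_actP HW Ha)[_ E].
have : pdom (a s) l by apply: pd; apply: lp => //; exact: ple_refl.
rewrite /pdom /=; case sl: (a s l) => [l'|//] _.
exists l'; first by apply/E; exists l, l'; rewrite (ple_refl HW).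
move=> k' k'l' /E[j [j' [sj j'k' cj]]]; have [k sk kl] := act_up Ha sl k'l'.
rewrite qE; exists k => //; apply: lp => //.
by apply: (spectrum_mono HW) cj; rewrite -(act_mono Ha sj sk).
Qed.

(** [HW'] and [Ha'] are parameters because the groupoid depends on these proofs, and the resolution
    brings its own. *)
Lemma complement_isomorphic (HW' : weak_semilattice L1) (Ha' : lattice_action (@rc_act S D)) :
  groupoid_isomorphic
    (@restriction (transformation_groupoid (spectrum_action HW Ha)) O)
    (@restriction (transformation_groupoid (spectrum_action HW' Ha'))
      (@covered_spectrum L1 (@rc_covers S D))).
Proof.
apply: (representation_isomorphic _ _ (rc_cover_system HL HR) (rc_invariant_covers HL Ha HR HI)
  (U := eventually_supp)).
- by have [] := spectrum_lch_td HW.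
- by move=> s chi psi; exact: covered_spectrumC_act.
- by move=> p; have [] := eventually_supp_clopen p.
- by move=> p; have [] := eventually_supp_clopen p.
- exact: eventually_supp_char.
- by move=> chi p C _; exact: eventually_supp_cover.
- move=> phi Cphi; exists (down_char phi); split; first exact: down_charO.
  exact: down_char_eventually.
- exact: eventually_supp_basis.
- exact: eventually_supp_dom.
- exact: eventually_supp_act.
Qed.

End SupportedSpectrum.

(** * Compact open sets in totally disconnected locally compact Hausdorff spaces *)

Section CompactOpenBasis.
Context {X : topologicalType}.
Implicit Types (A B C V W E : set X).

Lemma cluster_closed (F : set_system X) E x : F E -> closed E -> cluster F x -> E x.
Proof. by move=> FE cE Fx; apply: cE => V Vx; exact: Fx. Qed.

(** If [F] converges to no point of [A], the open sets outside [F] cover [A]. They are closed under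
    finite unions because [F] is an ultrafilter, so by compactness one of them contains [A].
    Compactness is used as near covering along the filter [G] of large such sets. *)
Lemma ultra_set_nbhs (F : set_system X) A : UltraFilter F -> compact A ->
  (forall V, open V -> A `<=` V -> F V) -> exists2 x, A x & F --> x.
Proof.
move=> FU cA FA; have PF := ultra_proper.
apply: contrapT => nx.
pose bad V := open V /\ ~ F V.
have badU V W : bad V -> bad W -> bad (V `|` W).
  move=> [oV nV] [oW nW]; split; first exact: openU.
  move=> FVW; have [//|FV] := in_ultra_setVsetC V FU.
  have [//|FW] := in_ultra_setVsetC W FU.
  have F0 : F ((V `|` W) `&` ~` V `&` ~` W) by apply: filterI => //; exact: filterI.
  by have [x [[[Vx|Wx] nVx] nWx]] := filter_ex F0.
have bad0 : bad set0 by split; [exact: open0|exact: filter_not_empty].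
pose G := filter_from bad (fun V => [set W | V `<=` W /\ bad W]).
have GF : Filter G.
  apply: filter_from_filter; first by exists set0.
  move=> V W bV bW; exists (V `|` W); first exact: badU.
  by move=> Z [VWZ bZ]; split; split=> // x ?; apply: VWZ; [left|right].
have /(_ _ G (fun W x => W x) GF)[|V bV] := (compact_near_coveringP A).1 cA.
  move=> x Ax; have [V [bV Vx]] : exists V, bad V /\ V x.
    apply: contrapT => nV; apply: nx; exists x => // N.
    rewrite nbhsE => -[V [oV Vx] VN]; apply: filterS VN _.
    by apply: contrapT => FV; apply: nV; exists V.
  exists (V, [set W | V `<=` W /\ bad W]).
    split=> /=; last by exists V.
    by apply: open_nbhs_nbhs; split=> //; have [] := bV.
  by move=> [y W] [/= Vy [VW _]]; exact: VW.
have [oV nV] := bV; move=> /(_ V (conj (@subset_refl _ V) bV)) AV.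
by apply: nV; exact: FA.
Qed.

(** Otherwise the intersections of neighborhoods of [A] and of [B] generate a proper filter, and a
    finer ultrafilter converges both to a point of [A] and to a point of [B]. *)
Lemma compact_separated A B : hausdorff_space X -> compact A -> compact B ->
  A `&` B = set0 ->
  exists V W, [/\ open V, open W, A `<=` V, B `<=` W & V `&` W = set0].
Proof.
move=> hX cA cB AB; apply: contrapT => nVW.
pose D := [set VW : set X * set X | [/\ open VW.1, open VW.2, A `<=` VW.1 & B `<=` VW.2]].
have FF : ProperFilter (filter_from D (fun VW => VW.1 `&` VW.2)).
  apply: filter_from_proper.
    apply: filter_from_filter; first by exists (setT, setT); split=> //=; exact: openT.
    move=> [V W] [V' W'] [/= oV oW AV BW] [/= oV' oW' AV' BW'].
    exists (V `&` V', W `&` W'); last by move=> x [[? ?] [? ?]].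
    by split=> /=; [exact: openI|exact: openI|rewrite subsetI|rewrite subsetI].
  move=> [V W] [/= oV oW AV BW]; apply: contrapT => /set0P/negP/negPn/eqP VW0.
  by apply: nVW; exists V, W.
have [G [GU FG]] := ultraFilterLemma FF.
have PG := ultra_proper.
have [|x Ax Gx] := @ultra_set_nbhs G A GU cA.
  by move=> V oV AV; apply: FG; exists (V, setT); [split=> //; exact: openT|move=> y []].
have [|y By Gy] := @ultra_set_nbhs G B GU cB.
  by move=> V oV BV; apply: FG; exists (setT, V); [split=> //; exact: openT|move=> z []].
have xy : x = y.
  apply: hX => V W Vx Wy; have GVW : G (V `&` W) by apply: filterI; [exact: Gx|exact: Gy].
  exact: filter_ex GVW.
by subst y; have : (A `&` B) x by []; rewrite AB.
Qed.

(** Otherwise the sets [E] minus [W] generate a proper filter, whose cluster point lies in every [E]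
    but not in [W]. *)
Lemma compact_bigcap_open (DD : set (set X)) C W : compact C -> open W ->
  DD !=set0 -> (forall E, DD E -> E `<=` C /\ closed E) ->
  (forall E E', DD E -> DD E' -> DD (E `&` E')) ->
  \bigcap_(E in DD) E `<=` W -> exists2 E, DD E & E `<=` W.
Proof.
move=> cC oW D0 DC DI DW; apply: contrapT => nE.
have FF : ProperFilter (filter_from DD (fun E => E `&` ~` W)).
  apply: filter_from_proper.
    apply: filter_from_filter => // E E' DE DE'; exists (E `&` E'); first exact: DI.
    by move=> x [[? ?] ?].
  move=> E DE; apply: contrapT => H; apply: nE; exists E => // x Ex.
  by apply: contrapT => Wx; apply: H; exists x.
have [E0 DE0] := D0.
have [|x [Cx xcl]] := cC _ FF.
  by exists E0 => // x [E0x _]; exact: (DC _ DE0).1.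
have xP E : DD E -> (E `&` ~` W) x.
  move=> DE; apply: cluster_closed xcl; first by exists E.
  by apply: closedI; [exact: (DC _ DE).2|exact: open_closedC].
by have [_] := xP _ DE0; apply; apply: DW => E /xP[].
Qed.

(** The quasi-component of [x] in a compact neighborhood [C] is connected, hence
    [{x}], so by compactness some relatively clopen subset of [C] containing [x] lies
    in the interior of [C] and [V]. *)
Lemma compact_open_basis x V : lch_totally_disconnected X -> nbhs x V ->
  exists K, [/\ compact_open K, K x & K `<=` V].
Proof.
move=> [hX lcX tdX] Vx; have [C] := lcX x I; rewrite withinET => Cx [cC clC].
pose DD := [set E | [/\ E `<=` C, E x, closed E & closed (C `&` ~` E)]].
have DD0 : DD !=set0.
  exists C; split=> //; first exact: nbhs_singleton.
  by rewrite setICr; exact: closed0.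
have DDC E : DD E -> E `<=` C /\ closed E by move=> [].
have DDI E E' : DD E -> DD E' -> DD (E `&` E').
  move=> [EC Ex clE clCE] [E'C E'x clE' clCE']; split=> //.
  - by move=> y [/EC].
  - exact: closedI.
  - by rewrite setCI setIUr; exact: closedU.
have DDW := fun W oW => compact_bigcap_open (W := W) cC oW DD0 DDC DDI.
set Q := \bigcap_(E in DD) E in DDW.
have Qx : Q x by move=> E [].
have QC : Q `<=` C by move=> y /(_ C); apply; split=> //;
  [exact: nbhs_singleton|rewrite setICr; exact: closed0].
have clQ : closed Q by apply: closed_bigI => E [].
(* Disjoint open sets around [A] and [B] together contain some [E] in [DD]. The piece of [E] around
   [A] is again in [DD], so [Q] lies in it and misses [B]. *)
have split_Q A B : closed A -> closed B -> A `&` B = set0 -> Q = A `|` B -> A x -> B = set0.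
  move=> clA clB AB QAB Ax.
  have cA : compact A by apply: (subclosed_compact clA cC) => y Ay; apply: QC; rewrite QAB; left.
  have cB : compact B by apply: (subclosed_compact clB cC) => y By; apply: QC; rewrite QAB; right.
  have [P [P' [oP oP' AP BP' PP']]] := compact_separated hX cA cB AB.
  have [|E DE EPP'] := DDW (P `|` P') (openU oP oP').
    by rewrite QAB; exact: setUSS.
  have [EC Ex clE clCE] := DE.
  have DEP : DD (E `&` P).
    have EP : E `&` P = E `&` ~` P'.
      apply/seteqP; split=> y [Ey Py]; split=> //.
        by move=> P'y; have : (P `&` P') y by []; rewrite PP'.
      by case: (EPP' _ Ey).
    split.
    - by move=> y [/EC].
    - by split=> //; exact: AP.
    - by rewrite EP; apply: closedI => //; exact: open_closedC.
    - rewrite setCI setIUr; apply: closedU => //; apply: closedI => //.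
      exact: open_closedC.
  rewrite -subset0 => y By; have Qy : Q y by rewrite QAB; right.
  have [_ Py] := Qy _ DEP; have : (P `&` P') y by split=> //; exact: BP'.
  by rewrite PP'.
have Qconn : connected Q.
  move=> B [b Bb] [O oO BO] [K clK BK].
  have clB : closed B by rewrite BK; exact: closedI.
  have clB' : closed (Q `&` ~` O) by apply: closedI => //; exact: open_closedC.
  have QE : Q = B `|` (Q `&` ~` O) by rewrite BO -setIUr setUCr setIT.
  have BB' : B `&` (Q `&` ~` O) = set0.
    by rewrite BO -subset0 => y [[_ Oy] [_]].
  have [Ox|nOx] := pselect (O x).
    have Bx : B x by rewrite BO.
    by rewrite [RHS]QE (split_Q _ _ clB clB' BB' QE Bx) setU0.
  have B0 : B = set0.
    apply: (split_Q _ _ clB' clB); [by rewrite setIC|by rewrite setUC|by []].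
  by rewrite B0 in Bb.
have Q1 : Q `<=` [set x].
  by rewrite -(tdX x I); exact: connected_component_max.
have [|E DE EW] := DDW (C° `&` V°) (openI (open_interior C) (open_interior V)).
  by move=> y /Q1 ->.
have [EC Ex clE clCE] := DE; exists E; split=> //.
- split; first exact: subclosed_compact clE cC EC.
  rewrite (_ : E = C° `&` ~` (C `&` ~` E)).
    by apply: openI; [exact: open_interior|exact: closed_openC].
  apply/seteqP; split=> y; first by move=> Ey; split; [case: (EW _ Ey)|move=> []].
  move=> [/interior_subset Cy nCE]; apply: contrapT => nEy; exact: nCE.
- by move=> y /EW[_ /interior_subset].
Qed.

End CompactOpenBasis.

(** * The base stage: identification of [X] with the covered spectrum of [L] *)

Section BaseStage.
Context {S : invSemigroupType} {X : topologicalType} {L : pposet}.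
Context (aX : paction S X) (aL : S -> L -> option L) (U : L -> set X) (R : L -> set (set L)).
Context (hX : lch_totally_disconnected X).
Context (HL : weak_semilattice L) (Ha : lattice_action aL)
  (HR : cover_system R) (HI : invariant_covers aL R).
Context (hU : representation U) (hgen : generating U) (heq : equivariant aL aX U)
  (hconc : concrete_covers U R) (hth : thorough U R).

Lemma representation_dir x k l : U k x -> U l x -> exists m, [/\ ple m k, ple m l & U m x].
Proof.
have [_ _ _ UI] := hU => kx lx; have : (U k `&` U l) x by [].
by rewrite UI => -[m /meets_below[mk ml] mx]; exists m.
Qed.

(** Both clauses pass to unions and relative complements, so [generating] yields them for compact
    open sets. The first ensures that a point of [K] satisfies some positive condition. *)
Definition finitely_determined (K : set X) := exists s : seq L,
  (forall x, K x -> exists2 l, l \in s & U l x) /\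
  forall x y, (forall l, l \in s -> U l x <-> U l y) -> K x -> K y.

Lemma compact_open_determined K : compact_open K -> finitely_determined K.
Proof.
rewrite -hgen => /(_ finitely_determined); apply; split.
  split.
    move=> A B [s [sA As]] [t [tB Bt]]; exists (s ++ t); split.
      by move=> x [/sA[l ls lx]|/tB[l ls lx]]; exists l; rewrite // mem_cat ls ?orbT.
    move=> x y E [Ax|Bx]; [left; apply: As Ax|right; apply: Bt Bx] => l lst;
      by apply: E; rewrite mem_cat lst ?orbT.
  move=> A B BA [s [sA As]] [t [tB Bt]]; exists (s ++ t); split.
    by move=> x [/sA[l ls lx] _]; exists l; rewrite // mem_cat ls.
  move=> x y E [Ax nBx]; split.
    by apply: As Ax => l ls; apply: E; rewrite mem_cat ls.
  move=> By; apply: nBx; apply: Bt By => l lt; apply: iff_sym; apply: E.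
  by rewrite mem_cat lt orbT.
move=> _ [l _ <-]; exists [:: l]; split=> [x lx|x y E]; first by exists l; rewrite ?mem_head.
by have /E[] := mem_head l [::].
Qed.

Lemma representation_basis x V : nbhs x V -> exists l (s : seq L),
  [/\ U l x, forall k, k \in s -> ~ U k x &
    forall y, U l y -> (forall k, k \in s -> ~ U k y) -> V y].
Proof.
move=> Vx; have [K [cK Kx KV]] := compact_open_basis hX Vx.
have [s [sK Ks]] := compact_open_determined cK.
have [l0 _ l0x] := sK _ Kx; have [_ Umono _ _] := hU.
have [m [mx ms]] : exists m, U m x /\ forall l, l \in s -> U l x -> ple m l.
  elim: (s) => [|l t [m [mx mt]]]; first by exists l0.
  have [lx|nlx] := pselect (U l x).
    have [n [nm nl nx]] := representation_dir mx lx; exists n; split=> // k.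
    rewrite inE => /orP[/eqP -> //|kt kx]; exact: (ple_trans HL) nm (mt _ kt kx).
  by exists m; split=> // k; rewrite inE => /orP[/eqP ->|kt]; [|exact: mt].
exists m, [seq l <- s | ~~ `[< U l x >]]; split=> //.
  by move=> k; rewrite mem_filter => /andP[/asboolP].
move=> y my ny; apply: KV; apply: Ks Kx => l ls; split=> [lx|ly].
  exact: Umono (ms _ ls lx) _ my.
by apply: contrapT => nlx; apply: (ny l) => //; rewrite mem_filter ls andbT; apply/asboolP.
Qed.

(** At every node of the tree a covered character is 1 on some member of the cover, so it traces a
    branch of full length. *)
Lemma covered_chain chi (T : seq L -> set L) (N : nat) l :
  covered_spectrum R chi -> spectrum_fun chi l ->
  (forall p, chain T p -> (size p < N)%N -> R (last l p) (T p)) ->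
  exists p, [/\ chain T p, size p = N & spectrum_fun chi (last l p)].
Proof.
move=> Cchi cl TR.
suff H n : (n <= N)%N -> exists p, [/\ chain T p, size p = n & spectrum_fun chi (last l p)].
  exact: H.
elim: n => [|n IH] nN; first by exists [::].
have [p [Tp pn cp]] := IH (ltnW nN).
have [|f Tf cf] := Cchi _ _ (TR p Tp _) cp; first by rewrite pn.
exists (rcons p f); split; rewrite ?size_rcons ?pn ?last_rcons// => j.
rewrite size_rcons ltnS leq_eqVlt => /orP[/eqP ->|jp].
  by rewrite nth_rcons ltnn eqxx -cats1 take_size_cat.
by rewrite nth_rcons jp -cats1 takel_cat ?(ltnW jp)//; exact: Tp.
Qed.

Lemma covered_thorough chi l (s : seq L) : covered_spectrum R chi -> spectrum_fun chi l ->
  U l `<=` \bigcup_(i in [set` s]) U i -> exists2 i, i \in s & spectrum_fun chi i.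
Proof.
(* [thorough] speaks of nonempty lists, hence the additional [pbot]; the branch cannot end below it,
   since characters vanish there. *)
move=> Cchi cl ls; have [] := @hth l (pbot :: s); first by [].
  by move=> x /ls[i si ix]; exists i => //=; rewrite inE [X in _ || X]si orbT.
move=> N [T [N0 TR Tend]].
have [p [Tp pN cp]] := covered_chain Cchi cl TR.
have [i] := Tend p Tp pN; rewrite inE => /orP[/eqP ->|si] pi; last first.
  by exists i => //; exact: (spectrum_mono HL) pi cp.
by have := spectrum_mono HL pi cp; rewrite spectrum_bot.
Qed.

Lemma representation_closed l : closed (U l).
Proof. by have [Uc _ _ _] := hU; apply: compact_closed; [case: hX|case: (Uc l)]. Qed.

(** The sets U l minus finitely many U k, where [chi] is 1 at l and 0 at each k, form a filter base;
    if one were empty, [covered_thorough] would give a k with value 1. A cluster point in the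
    compact set U l0 is the required point, because every U l is clopen. *)
Lemma covered_spectrum_surj chi : covered_spectrum R chi ->
  exists x, [set: X] x /\ forall l, spectrum_fun chi l <-> U l x.
Proof.
move=> Cchi; have [Uc Umono _ _] := hU.
pose D := [set ls : L * seq L | spectrum_fun chi ls.1 /\
  forall k, k \in ls.2 -> ~~ spectrum_fun chi k].
pose B (ls : L * seq L) := [set x | U ls.1 x /\ forall k, k \in ls.2 -> ~ U k x].
have [l0 cl0] := spectrum_ex chi.
have FF : ProperFilter (filter_from D B).
  apply: filter_from_proper.
    apply: filter_from_filter; first by exists (l0, [::]).
    move=> [l s] [k t] [/= cl cs] [/= ck ct].
    have [m /meets_below[ml mk] cm] := spectrum_meets cl ck.
    exists (m, s ++ t); first by split=> //= i; rewrite mem_cat => /orP[/cs|/ct].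
    move=> x [/= mx nst]; split; split=> /=; [exact: Umono mx| |exact: Umono mx|].
      by move=> i si; apply: nst; rewrite mem_cat si.
    by move=> i ti; apply: nst; rewrite mem_cat ti orbT.
  move=> [l s] [/= cl cs]; apply: contrapT => nB.
  have [|i si ci] := covered_thorough (s := s) Cchi cl.
    move=> x lx; apply: contrapT => nx; apply: nB; exists x; split=> //= k ks kx.
    by apply: nx; exists k.
  by have /negP := cs _ si.
have [|x [_ xcl]] := (Uc l0).1 _ FF.
  by exists (l0, [::]) => // y [].
exists x; split=> // l; split=> [cl|lx].
  apply: cluster_closed (representation_closed (l := l)) xcl.
  by exists (l, [::]) => // y [].
apply: contrapT => /negP ncl; have : (~` U l) x; last by [].
apply: cluster_closed xcl; last by apply: open_closedC; case: (Uc l).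
exists (l0, [:: l]); first by split=> //= k; rewrite inE => /eqP ->.
by move=> y [_ /(_ l)]; apply; rewrite mem_head.
Qed.

Lemma base_isomorphic : groupoid_isomorphic
  (@restriction (transformation_groupoid aX) setT)
  (@restriction (transformation_groupoid (spectrum_action HL Ha)) (covered_spectrum R)).
Proof.
have [Uc Umono U0 UI] := hU.
apply: (representation_isomorphic _ _ HR HI (U := U)) => //.
- by case: hX.
- by move=> l; case: (Uc l).
- by move=> l; exact: representation_closed.
- move=> x _; split.
  + have [l [s [lx _ _]]] := representation_basis (filterT : nbhs x setT).
    by exists l; apply/asboolP.
  + by rewrite U0; apply/asboolP.
  + move=> k l; split=> [[/asboolP kx /asboolP lx]|[m klm /asboolP mx]].
      have : (U k `&` U l) x by [].
      by rewrite UI => -[m klm mx]; exists m => //; apply/asboolP.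
    have [mk ml] := meets_below klm.
    by split; apply/asboolP; [exact: Umono mk _ mx|exact: Umono ml _ mx].
- by move=> x l F _ RF; rewrite (hconc RF) => -[f Ff fx]; exists f.
- exact: covered_spectrum_surj.
- move=> x V _ /representation_basis[l [s [lx sx lsV]]]; exists l, s; split=> // y _.
  exact: lsV.
- move=> s x _; have [dE _] := heq.
  suff : pdom (aX s) x <-> exists2 l, pdom (aL s) l & U l x by [].
  by rewrite dE.
- move=> s l k x y sl lx sx; have [_ iE] := heq.
  by rewrite -(iE _ _ _ sl); exists x.
Qed.

End BaseStage.

(** * Iteration and vanishing *)

Section Stages.
Context {S : invSemigroupType} (D0 : covered_lattice S).
Local Notation D := (relative_complements_seq D0).

Lemma stages : lf_weak_semilattice D0 -> lattice_action (@cl_act S D0) ->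
  cover_system (@cl_covers S D0) -> invariant_covers (@cl_act S D0) (@cl_covers S D0) ->
  forall k, [/\ lf_weak_semilattice (D k), lattice_action (@cl_act S (D k)),
    cover_system (@cl_covers S (D k)) &
    invariant_covers (@cl_act S (D k)) (@cl_covers S (D k))].
Proof.
move=> HL Ha HR HI; elim=> [//|k [HLk Hak HRk HIk]]; split.
- exact: rc_lf.
- exact: rc_lattice_action.
- exact: rc_cover_system.
- exact: rc_invariant_covers.
Qed.

Context (HL : forall k, lf_weak_semilattice (D k))
  (HR : forall k, cover_system (@cl_covers S (D k))).

Lemma stages_semilattice : semilattice D0 -> forall k, semilattice (D k).
Proof. by move=> H0; elim=> [//|k IH]; exact: rc_semilattice. Qed.

Lemma stages_nontrivial N :
  (forall l, nontrivial_covers (@cl_covers S D0) l #<= `I_N)%card ->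
  forall k, (k <= N)%N -> forall l, (nontrivial_covers (@cl_covers S (D k)) l #<= `I_(N - k))%card.
Proof.
move=> H0; elim=> [|k IH] kN l; first by rewrite subn0.
apply: nontrivial_covers_rc => // p; rewrite subnSK//; exact: IH (ltnW kN) p.
Qed.

(** No nontrivial cover is left at stage [N], so stage [N.+1] is zero by [trivial_rc], and zero
    persists. *)
Lemma stages_trivial N :
  (forall l, nontrivial_covers (@cl_covers S D0) l #<= `I_N)%card ->
  forall i, (N < i)%N -> forall l : D i, l = pbot.
Proof.
move=> H0; elim=> [//|i IH]; rewrite ltnS leq_eqVlt => /orP[/eqP Ni|/IH Hi].
  by subst i; apply: trivial_rc => // l; rewrite -(subnn N); exact: stages_nontrivial.
exact: trivial_rc_trivial.
Qed.

End Stages.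

Lemma trivial_spectrum_groupoid (S : invSemigroupType) (L : pposet) (a : S -> L -> option L)
    (HL : lf_weak_semilattice L) (Ha : lattice_action a) :
  (forall l : L, l = pbot) -> groupoid_empty (spectrum_groupoid HL Ha).
Proof.
move=> L0; apply/eqP; apply: contrapT => /negP/set0P[g _].
have [l] := spectrum_ex (src g); rewrite (L0 l) spectrum_bot //.
Qed.

Unset Implicit Arguments.

Theorem theorem3p15 (S : invSemigroupType)
    (X : topologicalType) (hX : lch_totally_disconnected X)
    (aX : paction S X) (haX : topological_action aX)
    (d : Order.disp_t) (L : bPOrderType d)
    (hL : lf_weak_semilattice (pposet_of L))
    (aL : S -> pposet_of L -> option (pposet_of L)) (haL : lattice_action aL)
    (U : pposet_of L -> set X)
    (hU : representation U) (hUgen : generating U) (hUeq : equivariant aL aX U)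
    (R : pposet_of L -> set (set (pposet_of L)))
    (hR : cover_system R) (hRinv : invariant_covers aL R)
    (hRconc : concrete_covers U R) (hRth : thorough U R) :
  let D := relative_complements_seq (CoveredLattice R aL) in
  exists (HL : forall k, lf_weak_semilattice (D k))
         (Ha : forall k, lattice_action (@cl_act S (D k))),
    let G := transformation_groupoid aX in
    let Gs := fun i => spectrum_groupoid (HL i) (Ha i) in
    [/\ forall k, cover_system (@cl_covers S (D k)) /\
          invariant_covers (@cl_act S (D k)) (@cl_covers S (D k)),
        independent_resolution G Gs,
        forall N, sup_nontrivial_covers R N ->
          forall i, (N.+1 <= i)%N -> groupoid_empty (Gs i) &
        semilattice (pposet_of L) -> forall k, semilattice (D k)].
Proof.
move=> D; have St := @stages S (CoveredLattice R aL) hL haL hR hRinv.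
have HL k : lf_weak_semilattice (D k) by have [] := St k.
have Ha k : lattice_action (@cl_act S (D k)) by have [] := St k.
have HR k : cover_system (@cl_covers S (D k)) by have [] := St k.
have HI k : invariant_covers (@cl_act S (D k)) (@cl_covers S (D k)) by have [] := St k.
exists HL, Ha => G Gs; split=> //.
- split; first exact: transformation_groupoid_ample.
  split=> [i|].
    apply: transformation_groupoid_ample; first exact: spectrum_action_topological.
    exact: spectrum_lch_td (HL i).1.
  exists (fun i => covered_spectrum (@cl_covers S (D i))),
    (fun i => ~` covered_spectrum (@cl_covers S (D i))); split.
  + move=> i; split; [exact: covered_spectrum_closed| |exact: setICr|exact: setUCr].
    by apply: transformation_invariant_set => s x y; exact: covered_spectrum_act.
  + exact: (@base_isomorphic _ _ (pposet_of L) aX aL U R).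
  + by move=> i; exact: (complement_isomorphic (HL i) (Ha i) (HR i) (HI i)).
  + move=> i; exists S, (D i), (@cl_act S (D i)), (HL i), (Ha i).
    exact: groupoid_isomorphic_refl.
- move=> N [RN _] i Ni; apply: trivial_spectrum_groupoid.
  exact: (@stages_trivial S (CoveredLattice R aL) HL HR N RN i Ni).
- exact: (@stages_semilattice S (CoveredLattice R aL) HL HR).
Qed.
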